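(* Let $\mathbf R^3_1$ be Lorentz-Minkowski $3$-space with coordinates $(t,x,y)$ and signature $(-++)$, let $T^1=\mathbf R/2\pi\mathbf Z$, and consider the real analytic maps $$f_E:\mathbf R\times T^1\to\mathbf R^3_1,\quad f_E(u,v)=(u,\sinh u\cos v,\sinh u\sin v),$$ $$f_P:\mathbf R^2\to\mathbf R^3_1,\quad f_P(u,v)=\left(v-\tfrac{v^3}{3}+u^2v,\ v+\tfrac{v^3}{3}-u^2v,\ 2uv\right),$$ $$f_H:\mathbf R^2\to\mathbf R^3_1,\quad f_H(u,v)=(\cosh u\sin v,\ v,\ \sinh u\sin v),$$ $$f_K:\mathbf R\times T^1\to\mathbf R^3_1,\quad f_K(u,v)=(\sinh u\cos v,\ u,\ \cosh u\cos v).$$ (These are the elliptic, parabolic and hyperbolic G-catenoids and the W-catenoid $f_K$.) Then: (1) The image of $f_E$ is an analytically complete subset of $\mathbf R^3_1$. (2) Each of $f_P$, $f_H$ and $f_K$ admits an analytic extension whose image is an analytically complete subset of $\mathbf R^3_1$. (3) Moreover, after taking these analytic completions (that is, the image of $f_E$ itself, and the images of the extensions in (2)), all of the images of these catenoids are real analytic DC-submanifolds of $\mathbf R^3_1$ (of dimension $2$).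
   Context: DC-manifolds. Let $m\ge 2$ (here $m=2$). The standard double-cone is $\mathcal C^m_2=\{(x_1,\dots,x_{m+1})\in\mathbf R^{m+1} : \sum_{j=1}^m x_j^2=x_{m+1}^2\}$, and $\pi^m:S^{m-1}\times\mathbf R\to\mathcal C^m_2$ is $\pi^m(\mathbf x,t)=(t\mathbf x,t)$. A topological DC-manifold of dimension $m$ is a second countable Hausdorff space $X$ each point of which has a neighborhood homeomorphic to an open subset of $\mathcal C^m_2$; a point corresponding to the origin is called a DC-point. If $\hat U\subset\mathcal C^m_2$ is open and $\varphi:\hat U\to O$ is a homeomorphism onto a connected open set $O\subset X$, put $U=(\pi^m)^{-1}(\hat U)$ and $\Phi=\varphi\circ\pi^m|_U$; the pair $(U,\Phi)$ is an inverse DC-coordinate system. A real analytic DC-structure on $X$ is a collection $\{(U_\lambda,\Phi_\lambda)\}$ of inverse DC-coordinate systems such that the sets $O_\lambda=\Phi_\lambda(U_\lambda)$ cover $X$; whenever $O_\lambda\cap O_\mu\neq\varnothing$ there is a real analytic diffeomorphism $\Phi_{\mu\lambda}:\Phi_\lambda^{-1}(O_\mu)\to\Phi_\mu^{-1}(O_\lambda)$ with $\Phi_\mu\circ\Phi_{\mu\lambda}=\Phi_\lambda$; and the collection is maximal with this property. A real analytic DC-manifold is a topological DC-manifold with such a structure. Ordinary real analytic manifolds are regarded as DC-manifolds without DC-points. DC-maps. A map $f:X\to Y$ between real analytic DC-manifolds with structures $\{(U_\alpha,\Phi_\alpha)\}$ and $\{(V_\beta,\Psi_\beta)\}$ is a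 real analytic DC-map if for every $(\alpha,\beta)$ there is a real analytic map $F_{\alpha,\beta}:U_\alpha\cap\Phi_\alpha^{-1}(f^{-1}(\Psi_\beta(V_\beta)))\to V_\beta$ with $\Psi_\beta\circ F_{\alpha,\beta}=f\circ\Phi_\alpha$. (When the target is an ordinary real analytic manifold, this means that every $f\circ\Phi_\alpha$ is real analytic.) Analytic extension. For real analytic DC-maps $f_i:X_i^m\to N^n$ ($i=1,2$) on connected $m$-dimensional real analytic DC-manifolds, $f_2$ is an analytic extension of $f_1$ if there is a real analytic DC-map $\phi:X_1^m\to X_2^m$ with $f_1=f_2\circ\phi$ and $f_1(X_1^m)$ is a proper subset of $f_2(X_2^m)$. DC-submanifolds. Let $N^n$ be a real analytic manifold, $n>m$. A subset $X\subset N^n$ is admissible if there is a discrete subset $\Gamma\subset X$ (a pre-residual subset) such that $X\setminus\Gamma$ is an $m$-dimensional real analytic submanifold of $N^n$; the intersection $\Sigma$ of all pre-residual subsets is the residual set of $X$. For an open set $\Omega\subset\mathbf R^n$ put $\hat U=(\mathcal C^m_2\times\{\mathbf 0_{n-m-1}\})\cap\Omega$, assumed non-empty. A real analytic diffeomorphism $F$ from $\Omega$ into $N^n$ is an extended parametrization of $X$ if (i) $F(\hat U)\subset X$ with $F(\hat U)$ connected, (ii) $F(\mathbf 0)\in\Sigma$ if $\mathbf 0\in\hat U$, and (iii) $F$ gives a real analytic map from the submanifold $\hat U\setminus\{\mathbf 0\}$ into the submanifold $X\setminus\Sigma$. An admissible subset $X$ is a real analytic DC-submanifold of $N^n$ if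 $X$ has an $m$-dimensional real analytic DC-structure such that, for every extended parametrization $F:\Omega\to N^n$ of $X$, the pair $((\hat\pi^m)^{-1}(\Omega),F\circ\hat\pi^m)$ is a local inverse DC-coordinate system of $X$, where $\hat\pi^m(a)=(\pi^m(a),\mathbf 0_{n-m-1})$ for $a\in S^{m-1}\times\mathbf R$. Analytic completeness. A non-empty subset $S\subset N^n$ is analytically complete if every real analytic map $\Gamma:[0,1]\to N^n$ with $\Gamma([0,\varepsilon))\subset S$ for some $\varepsilon\in(0,1)$ satisfies $\Gamma([0,1])\subset S$. *)

(* Defs.v *)
From HB Require Import structures.
From mathcomp Require Import all_boot all_order all_algebra generic_quotient.
From mathcomp Require Import all_classical all_reals all_analysis.

Set Implicit Arguments.
Unset Strict Implicit.
Unset Printing Implicit Defensive.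

Import Order.TTheory GRing.Theory Num.Theory.
Import numFieldNormedType.Exports.

Local Open Scope classical_set_scope.
Local Open Scope ring_scope.

Section Topology.
Context {T Y : topologicalType}.

Definition rel_open (A B : set T) := exists2 W, open W & B = A `&` W.

Definition homeomorphism (A : set T) (phi : T -> Y) (B : set Y) :=
  [/\ set_bij A B phi, {within A, continuous phi} &
      exists psi : Y -> T,
        (forall x, A x -> psi (phi x) = x) /\ {within B, continuous psi}].

End Topology.

Section Analytic.
Context {R : realType}.

(* The multi-indices in the N-th partial sum are those with all entries < N. *)
Definition power_series_sums k (c : ('I_k -> nat) -> R) (h : 'rV[R]_k) (s : R) :=
  let term N (al : {ffun 'I_k -> 'I_N}) :=
    c (fun i => al i) * \prod_(i < k) h 0 i ^+ al i in
  cvgn (fun N => \sum_(al : {ffun 'I_k -> 'I_N}) `|term N al|) /\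
  (fun N => \sum_(al : {ffun 'I_k -> 'I_N}) term N al) @ \oo --> s.

(* The norm of 'rV[R]_k is the sup norm, so convergence is on a polydisc. *)
Definition analytic_at k (f : 'rV[R]_k -> R) (p : 'rV[R]_k) :=
  exists (c : ('I_k -> nat) -> R) (r : R), 0 < r /\
    forall x, `|x - p| < r -> power_series_sums c (x - p) (f x).

(* Real analyticity of a map defined on an arbitrary subset A of R^k: f is
   locally the restriction to A of an analytic map of the ambient space.  For A
   open, for A an analytic submanifold such as S^(m-1) x R, and for A = [0, 1]
   (seen in R^1) this is the usual notion. *)
Definition analytic_on k l (A : set 'rV[R]_k) (f : 'rV[R]_k -> 'rV[R]_l) :=
  forall p, A p -> exists g : 'rV[R]_k -> 'rV[R]_l,
    (forall j, analytic_at (fun x => g x 0 j) p) /\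
    \forall x \near p, A x -> f x = g x.

Definition analytic_diffeo k l (A : set 'rV[R]_k) (f : 'rV[R]_k -> 'rV[R]_l)
    (B : set 'rV[R]_l) :=
  [/\ set_bij A B f, analytic_on A f &
      exists g : 'rV[R]_l -> 'rV[R]_k,
        (forall x, A x -> g (f x) = x) /\ analytic_on B g].

Definition analytic_submanifold m n (S : set 'rV[R]_n) :=
  forall p, S p -> exists (W : set 'rV[R]_n) (h : 'rV[R]_n -> 'rV[R]_n),
    [/\ open W, W p, open (h @` W), analytic_diffeo W h (h @` W) &
        h @` (S `&` W) =
        h @` W `&` [set y | forall j : 'I_n, (m <= j)%N -> y 0 j = 0]].

Definition analytically_complete n (S : set 'rV[R]_n) :=
  S !=set0 /\
  forall gam : R -> 'rV[R]_n,
    analytic_on [set s : 'rV[R]_1 | s 0 0 \in `[0, 1]]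
                (fun s => gam (s 0 0)) ->
    (exists2 eps, eps \in `]0, 1[ & gam @` `[0, eps[ `<=` S) ->
    gam @` `[0, 1] `<=` S.

End Analytic.

Section DoubleCone.
Context {R : realType}.

Definition axis m (x : 'rV[R]_(m + 1)) : R := rsubmx x 0 0.

Definition cone m : set 'rV[R]_(m + 1) :=
  [set x | \sum_(j < m) lsubmx x 0 j ^+ 2 = axis x ^+ 2].

(* S^(m-1) x R, as a submanifold of R^m x R = R^(m+1). *)
Definition cylinder m : set 'rV[R]_(m + 1) :=
  [set a | \sum_(j < m) lsubmx a 0 j ^+ 2 = 1].

Definition cone_proj m (a : 'rV[R]_(m + 1)) : 'rV[R]_(m + 1) :=
  row_mx (axis a *: lsubmx a) (rsubmx a).

(* A map is only meaningful on its domain lp_dom; its other values are junk. *)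
Record local_param (k : nat) (X : Type) := LocalParam {
  lp_dom : set 'rV[R]_k;
  lp_map :> 'rV[R]_k -> X }.

Definition lp_img k X (P : local_param k X) : set X := P @` lp_dom P.

Definition compatible k l X (P : local_param k X) (Q : local_param l X) :=
  exists g : 'rV[R]_k -> 'rV[R]_l,
    analytic_diffeo (lp_dom P `&` P @^-1` lp_img Q) g
                    (lp_dom Q `&` Q @^-1` lp_img P) /\
    forall a, (lp_dom P `&` P @^-1` lp_img Q) a -> Q (g a) = P a.

Definition dc_topological_manifold m (X : topologicalType) :=
  [/\ @second_countable X, hausdorff_space X &
      forall x : X, exists (O : set X) (U : set 'rV[R]_(m + 1))
                           (phi : 'rV[R]_(m + 1) -> X),
        [/\ nbhs x O, rel_open (@cone m) U & homeomorphism U phi O]].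

Definition inverse_dc_coordinate m (X : topologicalType)
    (P : local_param (m + 1) X) :=
  exists (U : set 'rV[R]_(m + 1)) (phi : 'rV[R]_(m + 1) -> X),
    [/\ rel_open (@cone m) U, homeomorphism U phi (phi @` U),
        open (phi @` U) /\ connected (phi @` U),
        lp_dom P = @cylinder m `&` @cone_proj m @^-1` U &
        forall a, lp_dom P a -> P a = phi (cone_proj a)].

Definition pairwise_compatible m (X : topologicalType)
    (A : set (local_param (m + 1) X)) :=
  A `<=` @inverse_dc_coordinate m X /\
  forall P Q, A P -> A Q -> lp_img P `&` lp_img Q !=set0 -> compatible P Q.

Definition dc_structure m (X : topologicalType)
    (A : set (local_param (m + 1) X)) :=
  [/\ pairwise_compatible A,
      forall x : X, exists2 P, A P & lp_img P x &
      forall B, A `<=` B -> pairwise_compatible B -> B = A].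

Definition dc_manifold m (X : topologicalType)
    (A : set (local_param (m + 1) X)) :=
  dc_topological_manifold m X /\ dc_structure A.

(* The DC-structure, without DC-points, of the ordinary real analytic manifold
   of dimension m with the atlas of local parametrizations C. *)
Definition dc_of_atlas m (X : topologicalType) (C : set (local_param m X)) :
    set (local_param (m + 1) X) :=
  [set P | [/\ inverse_dc_coordinate P,
               forall a, lp_dom P a -> axis a != 0 &
               forall Q, C Q -> compatible P Q]].

(* The domain of the local expression of f is required to be open in the
   cylinder, as that of a real analytic map on a manifold has to be. *)
Definition dc_map m m' (X Y : topologicalType)
    (A : set (local_param (m + 1) X)) (B : set (local_param (m' + 1) Y))
    (f : X -> Y) :=
  forall P Q, A P -> B Q ->
    let D := lp_dom P `&` P @^-1` (f @^-1` lp_img Q) in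
    rel_open (@cylinder m) D /\
    exists F : 'rV[R]_(m + 1) -> 'rV[R]_(m' + 1),
      [/\ analytic_on D F, F @` D `<=` lp_dom Q &
          forall a, D a -> Q (F a) = f (P a)].

Definition dc_map_to_space m n (X : topologicalType)
    (A : set (local_param (m + 1) X)) (f : X -> 'rV[R]_n) :=
  forall P, A P -> analytic_on (lp_dom P) (f \o P).

Definition analytic_extension m n (X1 X2 : topologicalType)
    (A1 : set (local_param (m + 1) X1)) (f1 : X1 -> 'rV[R]_n)
    (A2 : set (local_param (m + 1) X2)) (f2 : X2 -> 'rV[R]_n) :=
  [/\ [/\ dc_manifold A1, connected [set: X1] & dc_map_to_space A1 f1],
      [/\ dc_manifold A2, connected [set: X2] & dc_map_to_space A2 f2],
      exists2 phi : X1 -> X2, dc_map A1 A2 phi & f1 = f2 \o phi &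
      range f1 `<` range f2].

(* DC-submanifolds of dimension m of R^n, where n = m + 1 + k. *)

Definition flat_cone m k : set 'rV[R]_(m + 1 + k) :=
  [set x | cone (lsubmx x) /\ rsubmx x = 0].

Definition flat_cone_proj m k (a : 'rV[R]_(m + 1)) : 'rV[R]_(m + 1 + k) :=
  row_mx (cone_proj a) 0.

Definition pre_residual m n (X G : set 'rV[R]_n) :=
  [/\ G `<=` X, G `<=` isolated G & analytic_submanifold m (X `\` G)].

Definition admissible m n (X : set 'rV[R]_n) := exists G, pre_residual m X G.

Definition residual m n (X : set 'rV[R]_n) : set 'rV[R]_n :=
  \bigcap_(G in [set G | pre_residual m X G]) G.

Definition extended_parametrization m k (X : set 'rV[R]_(m + 1 + k))
    (Om : set 'rV[R]_(m + 1 + k))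
    (F : 'rV[R]_(m + 1 + k) -> 'rV[R]_(m + 1 + k)) :=
  let U := @flat_cone m k `&` Om in
  [/\ open Om /\ U !=set0,
      open (F @` Om) /\ analytic_diffeo Om F (F @` Om),
      F @` U `<=` X /\ connected (F @` U),
      U 0 -> residual m X (F 0) &
      F @` (U `\ 0) `<=` X `\` residual m X /\ analytic_on (U `\ 0) F].

(* X is regarded as the space set_type X, with the topology induced by R^n. *)
Definition dc_submanifold m k (X : set 'rV[R]_(m + 1 + k)) :=
  admissible m X /\
  exists A : set (local_param (m + 1) (set_type X)),
    dc_manifold A /\
    forall Om F, extended_parametrization X Om F ->
      exists P, [/\ A P,
        lp_dom P = @cylinder m `&` @flat_cone_proj m k @^-1` Om &
        forall a, lp_dom P a -> set_val (P a) = F (flat_cone_proj k a)].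

End DoubleCone.

Arguments cone {R} m.
Arguments cylinder {R} m.

Section Circle.
Variable R : realType.

Definition circle_rel (x y : R) : bool :=
  `[< exists k : int, y = x + k%:~R * (2 * pi) >].

Lemma circle_rel_refl : reflexive circle_rel.
Proof. by move=> x; apply/asboolP; exists 0; rewrite mul0r addr0. Qed.

Lemma circle_rel_sym : symmetric circle_rel.
Proof.
suff H x y : circle_rel x y -> circle_rel y x.
  by move=> x y; apply/idP/idP; exact: H.
move=> /asboolP[k ->]; apply/asboolP; exists (- k).
by rewrite rmorphN mulNr addrK.
Qed.

Lemma circle_rel_trans : transitive circle_rel.
Proof.
move=> y x z /asboolP[k ->] /asboolP[l ->]; apply/asboolP; exists (k + l).
by rewrite rmorphD -addrA -mulrDl.
Qed.

Canonical circle_equiv :=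
  EquivRel circle_rel circle_rel_refl circle_rel_sym circle_rel_trans.

Definition T1 := quotient_topology {eq_quot circle_equiv}%qT.

Definition to_T1 (v : R) : T1 := \pi_T1%qT v.
Definition of_T1 (q : T1) : R := repr q.

End Circle.

Section Catenoids.
Variable R : realType.

Definition sinh (x : R) : R := (expR x - expR (- x)) / 2.
Definition cosh (x : R) : R := (expR x + expR (- x)) / 2.

(* Coordinates (t, x, y) of R^3_1 *)
Definition vec3 (t x y : R) : 'rV[R]_3 := \row_j nth 0 [:: t; x; y] j.

(* The formulas below are 2 pi-periodic in v = of_T1 q, so the representative
   chosen by of_T1 is irrelevant. *)
Definition f_E (p : R * T1 R) : 'rV[R]_3 :=
  let u := p.1 in let v := of_T1 p.2 in
  vec3 u (sinh u * cos v) (sinh u * sin v).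

Definition f_P (p : R * R) : 'rV[R]_3 :=
  let u := p.1 in let v := p.2 in
  vec3 (v - v ^+ 3 / 3 + u ^+ 2 * v) (v + v ^+ 3 / 3 - u ^+ 2 * v) (2 * u * v).

Definition f_H (p : R * R) : 'rV[R]_3 :=
  let u := p.1 in let v := p.2 in
  vec3 (cosh u * sin v) v (sinh u * sin v).

Definition f_K (p : R * T1 R) : 'rV[R]_3 :=
  let u := p.1 in let v := of_T1 p.2 in
  vec3 (sinh u * cos v) u (cosh u * cos v).

Definition plane_atlas : set (local_param 2 (R * R)) :=
  [set LocalParam setT (fun w => (w 0 0, w 0 1))].

Definition tube_atlas : set (local_param 2 (R * T1 R)) :=
  [set P | exists a : R,
    P = LocalParam [set w | w 0 1 \in `]a, a + 2 * pi[]
                   (fun w => (w 0 0, to_T1 (w 0 1)))].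

Definition plane_dc : set (local_param (2 + 1) (R * R)) :=
  dc_of_atlas plane_atlas.

Definition tube_dc : set (local_param (2 + 1) (R * T1 R)) :=
  dc_of_atlas tube_atlas.

End Catenoids.

Arguments plane_dc R : clear implicits.
Arguments tube_dc R : clear implicits.
Arguments f_E {R}.
Arguments f_P {R}.
Arguments f_H {R}.
Arguments f_K {R}.

(* Main.v *)
(* The completed catenoids are the zero sets
     E: x^2 + y^2 = sinh^2 t,             P: 12 (x^2 + y^2 - t^2) = (t + x)^4,
     H: t^2 = y^2 + sin^2 x,              K: t cosh x = y sinh x.
   Since f o gam is analytic in one variable for an analytic curve gam, the
   identity theorem makes the zero set of a global analytic f analytically
   complete.  Each surface is covered by analytic diffeomorphisms of open sets of
   R^3 under which it corresponds to the cone (for E and H one divides by the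
   nonvanishing functions sinh t / t and sin x / x; P is straightened by a global
   polynomial diffeomorphism; K is a graph, hence an image of half cones), and
   its DC-structure is made of all inverse DC-coordinates compatible with these.
   Transition maps lift to the cylinder because a diffeomorphism mapping the cone
   into itself, say H with H(0) = 0, satisfies H(t a, t) = t sg(a, t) with sg
   analytic.  The same local study shows that a diffeomorphism mapping the cone
   into itself maps it onto the cone locally, so that every extended
   parametrization is one of the charts.  The extension map of f_P, f_H or f_K is
   the corestriction of f itself, lifted to the cylinder by explicit formulas. *)
Require Import Defs.
From HB Require Import structures.
From mathcomp Require Import all_boot all_order all_algebra generic_quotient.
From mathcomp Require Import all_classical all_reals all_analysis.
From mathcomp Require Import ring lra.
Import Order.TTheory GRing.Theory Num.Theory.
Import numFieldNormedType.Exports.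
Set Implicit Arguments.
Unset Strict Implicit.
Unset Printing Implicit Defensive.
Local Open Scope classical_set_scope.
Local Open Scope ring_scope.

(** * Absolutely convergent sums *)

Section UnconditionalSums.
Context {R : realType}.

(** The obstacle throughout is that [cone_proj] collapses a circle over the vertex: a map of cones
    does not determine its lift there, and lifts must be shown analytic across that circle.
    Differential calculus is replaced by division of power series. Hadamard's formula f(x) - f(p) =
    sum_i (x_i - p_i) g_i(x), and the difference quotient of f in one coordinate, analytic in both
    endpoints jointly, come from dividing monomials, with explicit majorants. Invertibility of a
    Jacobian, tangent vectors of the cone and the blow-up at the vertex are then obtained by
    cancelling a factor t and letting t tend to 0. No inverse function theorem occurs, since each
    diffeomorphism comes with its analytic inverse. What an extended parametrization does not give
    at once is that, near the cone, it sends no point off the cone into the surface. This follows by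
    counting zeros of the quadratic form on a vertical line: one near a regular point, two near the
    vertex. The plane and the tube must also be presented by charts starting from the cone; half
    cones serve for that. *)

Definition asum (T : choiceType) (a : T -> R) : \bar R :=
  \esum_(t in [set: T]) `|a t|%:E.

(** [fine] sends an infinite sum to 0, so the value is meaningful only when [asum a] is finite. *)
Definition tsum (T : choiceType) (a : T -> R) : R :=
  fine (\esum_(t in [set: T]) (Num.max (a t) 0)%:E) -
  fine (\esum_(t in [set: T]) (Num.max (- a t) 0)%:E).

Lemma asum_ge0 (T : choiceType) (a : T -> R) : (0 <= asum a)%E.
Proof. by apply: esum_ge0 => t _; rewrite lee_fin. Qed.

Lemma le_asum (T : choiceType) (a b : T -> R) :
  (forall t, `|a t| <= `|b t|) -> (asum a <= asum b)%E.
Proof. by move=> ab; apply: le_esum => t _; rewrite lee_fin. Qed.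

Lemma asum_fin (T : choiceType) (a : T -> R) :
  (asum a < +oo)%E -> asum a \is a fin_num.
Proof. by move=> h; rewrite ge0_fin_numE // asum_ge0. Qed.

Lemma esum_fin_le (T : choiceType) (p a : T -> R) : (asum a < +oo)%E ->
  (forall t, 0 <= p t <= `|a t|) -> \esum_(t in [set: T]) (p t)%:E \is a fin_num.
Proof.
move=> sa pa; have p0 t : 0 <= p t by case/andP: (pa t).
rewrite ge0_fin_numE; last by apply: esum_ge0 => t _; rewrite lee_fin.
apply: le_lt_trans sa; apply: le_esum => t _.
by rewrite lee_fin; case/andP: (pa t).
Qed.

(** Any splitting into summable nonnegative families computes the sum, not only the positive and
    negative parts. Linearity and Fubini reduce to nonnegative families through this freedom. *)
Lemma tsum_decomp (T : choiceType) (a p n : T -> R) :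
  (asum p < +oo)%E -> (asum n < +oo)%E ->
  (forall t, 0 <= p t) -> (forall t, 0 <= n t) -> (forall t, a t = p t - n t) ->
  tsum a = fine (\esum_(t in [set: T]) (p t)%:E) -
           fine (\esum_(t in [set: T]) (n t)%:E).
Proof.
move=> sp sn p0 n0 apn.
have fp : \esum_(t in [set: T]) (p t)%:E \is a fin_num.
  by apply: (esum_fin_le sp) => t; rewrite p0 ger0_norm /=.
have fn : \esum_(t in [set: T]) (n t)%:E \is a fin_num.
  by apply: (esum_fin_le sn) => t; rewrite n0 ger0_norm /=.
have m0 (x : R) : 0 <= Num.max x 0 by rewrite le_max lexx orbT.
have fP : \esum_(t in [set: T]) (Num.max (a t) 0)%:E \is a fin_num.
  apply: (esum_fin_le sp) => t; rewrite m0 /= ger0_norm // ge_max p0 apn.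
  by rewrite lerBlDr lerDl n0.
have fN : \esum_(t in [set: T]) (Num.max (- a t) 0)%:E \is a fin_num.
  apply: (esum_fin_le sn) => t; rewrite m0 /= ger0_norm // ge_max n0 apn.
  by rewrite opprB lerBlDr lerDl p0.
apply/eqP; rewrite /tsum subr_eq addrAC eq_sym subr_eq -!fineD // .
rewrite -!esumD ?fineD //; try by move=> t _; rewrite lee_fin.
apply/eqP; congr fine; apply: eq_esum => t _; rewrite -!EFinD; congr EFin.
have := apn t; case: (leP 0 (a t)) => h.
  by rewrite max_r ?oppr_le0 // => ->; lra.
by rewrite max_l ?oppr_ge0 ?ltW // => ->; lra.
Qed.

Lemma asum_posneg (T : choiceType) (a : T -> R) : (asum a < +oo)%E ->
  exists p n : T -> R, [/\ (asum p < +oo)%E, (asum n < +oo)%E,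
   forall t, 0 <= p t, forall t, 0 <= n t & (forall t, a t = p t - n t) /\
   (forall t, p t + n t = `|a t|)].
Proof.
move=> sa; exists (fun t => Num.max (a t) 0), (fun t => Num.max (- a t) 0).
have m0 (x : R) : 0 <= Num.max x 0 by rewrite le_max lexx orbT.
split=> //.
- apply: le_lt_trans sa; apply: le_asum => t; rewrite (ger0_norm (m0 _)) ge_max.
  by rewrite ler_norm normr_ge0.
- apply: le_lt_trans sa; apply: le_asum => t; rewrite (ger0_norm (m0 _)) ge_max.
  by rewrite -normrN ler_norm normr_ge0.
- split=> t; case: (leP 0 (a t)) => h.
  + by rewrite max_r ?oppr_le0 // subr0.
  + by rewrite max_l ?oppr_ge0 ?ltW // sub0r opprK.
  + by rewrite max_r ?oppr_le0 // addr0 ger0_norm.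
  + by rewrite max_l ?oppr_ge0 ?ltW // add0r ltr0_norm.
Qed.

Lemma tsum_ge0 (T : choiceType) (a : T -> R) :
  (forall t, 0 <= a t) -> tsum a = fine (\esum_(t in [set: T]) (a t)%:E).
Proof.
move=> a0; rewrite /tsum (_ : \esum_(t in _) (Num.max (- a t) 0)%:E = 0%E).
  rewrite subr0; congr fine; apply: eq_esum => t _.
  by rewrite max_l.
by apply: esum1 => t _; rewrite max_r // oppr_le0.
Qed.

Lemma tsum_le_asum (T : choiceType) (a : T -> R) : (asum a < +oo)%E ->
  (`|tsum a|%:E <= asum a)%E.
Proof.
move=> sa; have [p [n [sp sn p0 n0 [apn pna]]]] := asum_posneg sa.
rewrite (tsum_decomp sp sn p0 n0 apn).
have fp : \esum_(t in [set: T]) (p t)%:E \is a fin_num.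
  by apply: (esum_fin_le sp) => t; rewrite p0 ger0_norm /=.
have fn : \esum_(t in [set: T]) (n t)%:E \is a fin_num.
  by apply: (esum_fin_le sn) => t; rewrite n0 ger0_norm /=.
have -> : asum a = (\esum_(t in [set: T]) (p t)%:E +
                    \esum_(t in [set: T]) (n t)%:E)%E.
  rewrite -esumD; try by move=> t _; rewrite lee_fin.
  by apply: eq_esum => t _; rewrite -EFinD pna.
rewrite -(fineK fp) -(fineK fn) -EFinD lee_fin (le_trans (ler_normB _ _)) //.
have e0 (q : T -> R) : (forall t, 0 <= q t) ->
    0 <= fine (\esum_(t in [set: T]) (q t)%:E).
  by move=> q0; apply: fine_ge0; apply: esum_ge0 => t _; rewrite lee_fin.
by rewrite -/(fine _) !fineK // !ger0_norm ?e0.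
Qed.

Lemma eq_tsum (T : choiceType) (a b : T -> R) : a =1 b -> tsum a = tsum b.
Proof. by move=> /funext ->. Qed.

Lemma asumZ (T : choiceType) (c : R) (a : T -> R) :
  asum (fun t => c * a t) = (`|c|%:E * asum a)%E.
Proof.
have [->|c0] := eqVneq c 0.
  rewrite normr0 mul0e; apply: esum1 => t _; by rewrite mul0r normr0.
(* The same inequality for [c^-1] and the family c a gives the reverse one. *)
wlog suff le : c c0 a / (asum (fun t => c * a t)%R <= `|c|%:E * asum a)%E.
  apply/eqP; rewrite eq_le le //=.
  have := le c^-1; rewrite invr_eq0 => /(_ c0 (fun t => c * a t)).
  under [X in asum X]eq_fun do rewrite mulKf //.
  rewrite -(@lee_pmul2l _ `|c|%:E) //; last by rewrite lte_fin normr_gt0.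
  by rewrite muleA -EFinM -normrM divff // normr1 mul1e.
apply: ge_ereal_sup => /= _ [X [finX _]] <-.
rewrite (_ : \sum_(x \in X) _ = `|c|%:E * \sum_(x \in X) `|a x|%:E)%E.
  rewrite lee_pmul2l ?lte_fin ?normr_gt0 //.
  by apply: ereal_sup_ubound; exists X.
rewrite ge0_mule_fsumr; last by move=> *; rewrite lee_fin.
by apply: eq_fsbigr => x _; rewrite normrM EFinM.
Qed.

Lemma asumD (T : choiceType) (a b : T -> R) :
  (asum (fun t => a t + b t)%R <= asum a + asum b)%E.
Proof.
rewrite -esumD; try by move=> t _; rewrite lee_fin.
by apply: le_esum => t _; rewrite -EFinD lee_fin ler_normD.
Qed.

Lemma esum_fineZ (T : choiceType) (c : R) (p : T -> R) : 0 <= c ->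
  (forall t, 0 <= p t) ->
  fine (\esum_(t in [set: T]) (c * p t)%:E) =
  c * fine (\esum_(t in [set: T]) (p t)%:E).
Proof.
move=> c0 p0; have E (q : T -> R) : (forall t, 0 <= q t) ->
    \esum_(t in [set: T]) (q t)%:E = asum q.
  by move=> q0; apply: eq_esum => t _; rewrite ger0_norm.
rewrite !E //; last by move=> t; rewrite mulr_ge0.
rewrite asumZ ger0_norm //; case: (asum p) (asum_ge0 p) => //= _.
have [->|cn0] := eqVneq c 0; first by rewrite mul0e mul0r.
by rewrite gt0_muley ?lte_fin ?lt_def ?cn0 // mulr0.
Qed.

Lemma tsumZ (T : choiceType) (c : R) (a : T -> R) : (asum a < +oo)%E ->
  tsum (fun t => c * a t) = c * tsum a.
Proof.
move=> sa; have [p [n [sp sn p0 n0 [apn _]]]] := asum_posneg sa.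
rewrite (tsum_decomp sp sn p0 n0 apn).
have sZ (d : R) q : (asum q < +oo)%E -> (asum (fun t : T => d * q t)%R < +oo)%E.
  by move=> sq; rewrite asumZ -(fineK (asum_fin sq)) -EFinM ltry.
have Zge0 (d : R) q : 0 <= d -> (forall t : T, 0 <= q t) ->
    forall t, 0 <= d * q t by move=> d0 q0 t; exact: mulr_ge0.
have [c0|c0] := leP 0 c.
  apply: etrans (tsum_decomp (sZ c p sp) (sZ c n sn) (Zge0 _ _ c0 p0)
    (Zge0 _ _ c0 n0) _) _; first by move=> t; rewrite apn mulrBr.
  by rewrite (esum_fineZ c0 p0) (esum_fineZ c0 n0) mulrBr.
have c0' : 0 <= - c by rewrite oppr_ge0 ltW.
apply: etrans (tsum_decomp (sZ (- c) n sn) (sZ (- c) p sp) (Zge0 _ _ c0' n0)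
    (Zge0 _ _ c0' p0) _) _; first by move=> t; rewrite apn; ring.
by rewrite (esum_fineZ c0' n0) (esum_fineZ c0' p0); ring.
Qed.

Lemma asum_lt (T : choiceType) (a : T -> R) (M : R) :
  (asum a <= M%:E)%E -> (asum a < +oo)%E.
Proof. by move/le_lt_trans; apply; rewrite ltry. Qed.

Lemma tsumD (T : choiceType) (a b : T -> R) :
  (asum a < +oo)%E -> (asum b < +oo)%E ->
  tsum (fun t => a t + b t) = tsum a + tsum b.
Proof.
move=> sa sb; have [p [n [sp sn p0 n0 [apn _]]]] := asum_posneg sa.
have [p' [n' [sp' sn' p0' n0' [apn' _]]]] := asum_posneg sb.
rewrite (tsum_decomp sp sn p0 n0 apn) (tsum_decomp sp' sn' p0' n0' apn').
have sD (f g : T -> R) : (asum f < +oo)%E -> (asum g < +oo)%E ->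
    (asum (fun t => f t + g t)%R < +oo)%E.
  by move=> sf sg; apply: le_lt_trans (asumD _ _) _; rewrite lte_add_pinfty.
have Dge0 (f g : T -> R) : (forall t, 0 <= f t) -> (forall t, 0 <= g t) ->
    forall t, 0 <= f t + g t by move=> f0 g0 t; exact: addr_ge0.
apply: etrans (tsum_decomp (sD _ _ sp sp') (sD _ _ sn sn') (Dge0 _ _ p0 p0')
  (Dge0 _ _ n0 n0') _) _; first by move=> t; rewrite apn apn'; ring.
have fD (f g : T -> R) : (asum f < +oo)%E -> (asum g < +oo)%E ->
      (forall t, 0 <= f t) -> (forall t, 0 <= g t) ->
      fine (\esum_(t in [set: T]) (f t + g t)%:E) =
      fine (\esum_(t in [set: T]) (f t)%:E) + fine (\esum_(t in [set: T]) (g t)%:E).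
  move=> sf sg f0 g0; rewrite -fineD.
  - rewrite -esumD; try by move=> t _; rewrite lee_fin.
    by congr fine; apply: eq_esum.
  - by apply: (esum_fin_le sf) => t; rewrite f0 ger0_norm /=.
  - by apply: (esum_fin_le sg) => t; rewrite g0 ger0_norm /=.
by rewrite (fD _ _ sp sp' p0 p0') (fD _ _ sn sn' n0 n0'); ring.
Qed.

Lemma asum_prod (I J : choiceType) (a : I -> J -> R) :
  asum (fun p : I * J => a p.1 p.2) =
  \esum_(i in [set: I]) asum (a i).
Proof.
rewrite /asum esum_esum; last by move=> *; rewrite lee_fin.
by congr esum; apply/seteqP; split.
Qed.

Lemma asum_slice (I J : choiceType) (a : I -> J -> R) i :
  (asum (a i) <= asum (fun p : I * J => a p.1 p.2))%E.
Proof.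
rewrite asum_prod (esumID [set i]) /=; last by move=> *; exact: asum_ge0.
rewrite setTI esum_set1 ?asum_ge0 // leeDl //.
by apply: esum_ge0 => ? _; exact: asum_ge0.
Qed.

(** Fubini holds for the nonnegative families p and n as an identity of extended sums; their
    difference is then recombined by [tsum_decomp], in each row and for the family of row sums. *)
Lemma tsum_prod (I J : choiceType) (a : I -> J -> R) :
  (asum (fun p : I * J => a p.1 p.2) < +oo)%E ->
  tsum (fun p : I * J => a p.1 p.2) = tsum (fun i => tsum (a i)) /\
  (asum (fun i => tsum (a i)) <= asum (fun p : I * J => a p.1 p.2))%E.
Proof.
move=> sa; have si i : (asum (a i) < +oo)%E.
  by apply: le_lt_trans sa; exact: asum_slice.
have bd : (asum (fun i => tsum (a i)) <= asum (fun p : I * J => a p.1 p.2))%E.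
  rewrite asum_prod; apply: le_esum => i _; exact: tsum_le_asum.
split=> //.
have [p [n [sp sn p0 n0 [apn pna]]]] := asum_posneg sa.
rewrite (tsum_decomp sp sn p0 n0 apn).
have F (q : I * J -> R) : (asum q < +oo)%E -> (forall t, 0 <= q t) ->
   [/\ forall i, (asum (fun j => q (i, j)) < +oo)%E,
       (asum (fun i => tsum (fun j => q (i, j))) < +oo)%E,
       forall i, 0 <= tsum (fun j => q (i, j)) &
       \esum_(t in [set: I * J]) (q t)%:E =
       \esum_(i in [set: I]) (tsum (fun j => q (i, j)))%:E].
  move=> sq q0.
  have qE : q = (fun p : I * J => (fun i j => q (i, j)) p.1 p.2).
    by apply/funext => -[].
  have sl i : (asum (fun j => q (i, j)) < +oo)%E.
    apply: le_lt_trans sq; rewrite {2}qE; exact: (asum_slice (fun i j => q (i, j))).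
  have t0 i : 0 <= tsum (fun j => q (i, j)).
    by rewrite tsum_ge0 // fine_ge0 // esum_ge0 // => ? _; rewrite lee_fin.
  split=> //.
    apply: le_lt_trans sq; rewrite {2}qE (asum_prod (fun i j => q (i, j))).
    by apply: le_esum => i _; exact: tsum_le_asum.
  transitivity (\esum_(i in [set: I]) \esum_(j in [set: J]) (q (i, j))%:E).
    rewrite esum_esum; last by move=> *; rewrite lee_fin.
    rewrite (_ : [set: I] `*`` _ = setT); last by apply/seteqP.
    by apply: eq_esum => -[].
  apply: eq_esum => i _; rewrite tsum_ge0 // fineK //.
  by apply: (esum_fin_le (sl i)) => j; rewrite q0 ger0_norm /=.
have [pl ps pp ->] := F p sp p0; have [nl ns nn ->] := F n sn n0.
rewrite (@tsum_decomp _ (fun i => tsum (a i)) (fun i => tsum (fun j => p (i, j)))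
  (fun i => tsum (fun j => n (i, j)))) //.
move=> i; rewrite (@tsum_decomp _ (a i) (fun j => p (i, j)) (fun j => n (i, j))) //.
- by rewrite -!tsum_ge0.
- by move=> j; rewrite -apn.
Qed.

Lemma asum_reindex (I J : choiceType) (e : I -> J) (a : J -> R) :
  bijective e -> asum (fun i => a (e i)) = asum a.
Proof.
move=> be; have eb : set_bij [set: I] [set: J] e by rewrite setTT_bijective.
by rewrite /asum (reindex_esum _ _ _ _ eb).
Qed.

Lemma tsum_reindex (I J : choiceType) (e : I -> J) (a : J -> R) :
  bijective e -> tsum (fun i => a (e i)) = tsum a.
Proof.
move=> be; have eb : set_bij [set: I] [set: J] e by rewrite setTT_bijective.
by rewrite /tsum !(reindex_esum _ _ _ _ eb).
Qed.

Lemma swap_bij (I J : choiceType) : bijective (fun p : I * J => (p.2, p.1)).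
Proof. by exists (fun p : J * I => (p.2, p.1)) => -[]. Qed.

Lemma asum_swap (I J : choiceType) (a : I -> J -> R) :
  asum (fun p : J * I => a p.2 p.1) = asum (fun p : I * J => a p.1 p.2).
Proof. by rewrite -(asum_reindex _ (swap_bij J I)). Qed.

Lemma tsum_swap (I J : choiceType) (a : I -> J -> R) :
  tsum (fun p : J * I => a p.2 p.1) = tsum (fun p : I * J => a p.1 p.2).
Proof. by rewrite -(tsum_reindex _ (swap_bij J I)). Qed.

Lemma tsum_single (T : choiceType) (t0 : T) (a : T -> R) :
  (forall t, t != t0 -> a t = 0) ->
  tsum a = a t0 /\ asum a = `|a t0|%:E.
Proof.
move=> a0; have S (p : T -> R) : (forall t, 0 <= p t) ->
    (forall t, t != t0 -> p t = 0) -> \esum_(t in [set: T]) (p t)%:E = (p t0)%:E.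
  move=> p0 pz; rewrite (esumID [set t0]); last by move=> *; rewrite lee_fin.
  rewrite setTI esum_set1 ?lee_fin // esum1 ?adde0 //.
  by move=> t [_ /eqP /pz ->].
split; last by apply: S => // t /a0 ->; rewrite normr0.
have m0 (x : R) : 0 <= Num.max x 0 by rewrite le_max lexx orbT.
rewrite /tsum !S //=.
- case: (leP 0 (a t0)) => h.
    by rewrite max_r ?oppr_le0 // subr0.
  by rewrite max_l ?oppr_ge0 ?ltW // sub0r opprK.
- by move=> t /a0 ->; rewrite oppr0 maxxx.
- by move=> t /a0 ->; rewrite maxxx.
Qed.

End UnconditionalSums.

(** * Real analytic functions *)

Section RowNorm.
Context {R : realType}.

Lemma rV_normP k (x : 'rV[R]_k) (r : R) : 0 <= r ->
  (forall i, `|x 0 i| <= r) <-> `|x| <= r.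
Proof.
move=> r0; rewrite [in X in _ <-> X]/Num.norm /= mx_normrE; split=> h.
  by apply/bigmax_leP; split=> // -[i j] _ /=; rewrite ord1.
by move=> i; move/bigmax_leP: h => [_ /(_ (0, i))]; apply.
Qed.

Lemma rV_norm_ltP k (x : 'rV[R]_k) (r : R) : 0 < r ->
  (forall i, `|x 0 i| < r) <-> `|x| < r.
Proof.
move=> r0; rewrite [in X in _ <-> X]/Num.norm /= mx_normrE; split=> h.
  by apply/bigmax_ltP; split=> // -[i j] _ /=; rewrite ord1.
by move=> i; move/bigmax_ltP: h => [_ /(_ (0, i))]; apply.
Qed.

Lemma rV_norm_ge k (x : 'rV[R]_k) i : `|x 0 i| <= `|x|.
Proof. by move: i; apply/rV_normP. Qed.

End RowNorm.

Section PowerSeries.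
Context {R : realType}.
Notation expo k := {ffun 'I_k -> nat}.

Definition monom k (h : 'rV[R]_k) (al : expo k) : R := \prod_(i < k) h 0 i ^+ al i.
Definition mdeg k (al : expo k) := (\sum_i al i)%N.

(* f is, on the closed ball of radius r around p, the sum of a power series
   whose majorant at (r, ..., r) is at most M.  Unlike analytic_at, this
   quantitative form is visibly stable under countable sums. *)
Definition rep k (p : 'rV[R]_k) (r : R) (f : 'rV[R]_k -> R) (M : R) :=
  exists a : expo k -> R,
    (asum (fun al => a al * r ^+ mdeg al)%R <= M%:E)%E /\
    forall x, `|x - p| <= r -> f x = tsum (fun al => a al * monom (x - p) al).

Lemma monom_le k (h : 'rV[R]_k) r al : `|h| <= r -> `|monom h al| <= r ^+ mdeg al.
Proof.
move=> hr; have r0 : 0 <= r := le_trans (normr_ge0 _) hr.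
rewrite /monom normr_prod /mdeg -prodrXr ler_prod // => i _.
by rewrite normrX exprn_ge0 //= lerXn2r ?nnegrE // (le_trans (rV_norm_ge _ _)).
Qed.

Lemma monom0 k (al : expo k) : monom 0 al = (mdeg al == 0)%N%:R.
Proof.
rewrite /monom /mdeg; case: eqP => [/eqP|/eqP] h.
  apply: big1 => i _; move: h; rewrite sum_nat_eq0 => /forallP /(_ i) /eqP ->.
  by rewrite expr0.
move: h; rewrite sum_nat_eq0 negb_forall => /existsP[i /= ai].
by rewrite (bigD1 i) //= mxE expr0n (negbTE ai) mul0r.
Qed.

Lemma monomD k (h : 'rV[R]_k) (al be : expo k) :
  monom h [ffun i => al i + be i]%N = monom h al * monom h be.
Proof. by rewrite /monom -big_split /=; apply: eq_bigr => i _; rewrite ffunE exprD. Qed.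

Lemma mdegD k (al be : expo k) :
  mdeg [ffun i => al i + be i]%N = (mdeg al + mdeg be)%N.
Proof. by rewrite /mdeg -big_split /=; apply: eq_bigr => i _; rewrite ffunE. Qed.

Lemma rep_asum k (r : R) (a : expo k -> R) (h : 'rV[R]_k) : `|h| <= r ->
  (asum (fun al => a al * monom h al)%R <= asum (fun al => a al * r ^+ mdeg al)%R)%E.
Proof.
move=> hr; have r0 : 0 <= r := le_trans (normr_ge0 _) hr.
apply: le_asum => al; rewrite !normrM ler_wpM2l //.
by rewrite (le_trans (monom_le _ hr)) // ler_norm.
Qed.

Lemma rep_bound k (p : 'rV[R]_k) r f M x : rep p r f M -> `|x - p| <= r ->
  `|f x| <= M.
Proof.
move=> [a [aM fE]] xr; rewrite fE // -lee_fin.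
have h := le_trans (rep_asum a xr) aM.
by rewrite (le_trans (tsum_le_asum _)) // (asum_lt h).
Qed.

Lemma rep_M_ge0 k (p : 'rV[R]_k) r f M : rep p r f M -> 0 <= M.
Proof. by move=> [a [aM _]]; rewrite -lee_fin (le_trans _ aM) // asum_ge0. Qed.

Lemma rep_ext k (p : 'rV[R]_k) r f g M M' :
  (forall x, `|x - p| <= r -> f x = g x) -> M <= M' -> rep p r f M -> rep p r g M'.
Proof.
move=> fg MM [a [aM fE]]; exists a; split; first by rewrite (le_trans aM).
by move=> x xr; rewrite -fg // fE.
Qed.

Lemma rep_restrict k (p : 'rV[R]_k) r r' f M :
  0 <= r' -> r' <= r -> rep p r f M -> rep p r' f M.
Proof.
move=> r0 rr [a [aM fE]]; exists a; split.
  apply: le_trans aM; apply: le_asum => al.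
  have r1 : 0 <= r by apply: le_trans rr.
  by rewrite !normrM ler_wpM2l // !ger0_norm ?exprn_ge0 // lerXn2r ?nnegrE.
by move=> x xr; rewrite fE // (le_trans xr).
Qed.

(** Regrouping by the value of [e]: both orders of summation of the family supported on the graph of
    [e] are compared. With [w] a monomial this collects repeated exponents into one coefficient. *)
Lemma tsum_collect (T S : choiceType) (a : T -> R) (e : T -> S) (w : S -> R) :
  (asum (fun t => a t * w (e t))%R < +oo)%E ->
  let c s := tsum (fun t => if e t == s then a t else 0) in
  (asum (fun s => c s * w s)%R <= asum (fun t => a t * w (e t))%R)%E /\
  tsum (fun s => c s * w s) = tsum (fun t => a t * w (e t)).
Proof.
move=> sa c; pose b (t : T) (s : S) := if e t == s then a t * w (e t) else 0.
have bt t : tsum (b t) = a t * w (e t) /\ asum (b t) = `|a t * w (e t)|%:E.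
  have [|-> ->] := @tsum_single _ _ (e t) (b t).
    by move=> s; rewrite /b eq_sym => /negbTE ->.
  by rewrite /b eqxx.
have sb : asum (fun q : T * S => b q.1 q.2) = asum (fun t => a t * w (e t)).
  by rewrite asum_prod; apply: eq_esum => t _; rewrite (bt t).2.
have sb' : asum (fun q : S * T => b q.2 q.1) = asum (fun t => a t * w (e t)).
  by rewrite (asum_swap b) sb.
have fs : (asum (fun q : S * T => (fun s t => b t s) q.1 q.2) < +oo)%E.
  by rewrite sb'.
have [E1 E2] := tsum_prod (a := fun s t => b t s) fs.
have cE s : c s * w s = tsum (fun t => b t s).
  have bs t : w s * (if e t == s then a t else 0) = b t s.
    rewrite /b; case: eqP => [->|]; first by rewrite mulrC.
    by rewrite mulr0.
  (* The coefficient [c s] is known to converge only when [w s] is nonzero; otherwise it may be a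
     default value, but it is multiplied by 0. *)
  rewrite mulrC; have [ws|ws] := eqVneq (w s) 0.
    rewrite ws mul0r; under eq_tsum do rewrite -bs ws mul0r.
    case: (pselect (exists t : T, True)) => [[t _]|nT].
      by have [-> _] := @tsum_single _ _ t (fun=> 0 : R) (fun _ _ => erefl).
    by rewrite tsum_ge0 // esum1.
  under eq_tsum do rewrite -bs.
  rewrite tsumZ //; have sl := asum_slice (fun s t => b t s) s.
  have {}sl := le_lt_trans sl fs.
  have -> : (fun t => if e t == s then a t else 0) = (fun t => (w s)^-1 * b t s).
    by apply/funext => t; rewrite -bs mulKf.
  by rewrite asumZ -(fineK (asum_fin sl)) -EFinM ltry.
under [X in asum X]eq_fun do rewrite cE.
under [X in tsum X]eq_fun do rewrite cE.
split; first by rewrite (le_trans E2) // sb'.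
rewrite -E1 (tsum_swap b) (tsum_prod _).1 ?sb //.
by apply: eq_tsum => t; rewrite (bt t).1.
Qed.

(** Lets a series be given by monomials indexed by any type, with repeated exponents, so that no
    coefficient ever has to be computed. *)
Lemma rep_family k (p : 'rV[R]_k) r f M (T : choiceType) (a : T -> R)
    (e : T -> expo k) :
  (asum (fun t => a t * r ^+ mdeg (e t))%R <= M%:E)%E ->
  (forall x, `|x - p| <= r -> f x = tsum (fun t => a t * monom (x - p) (e t))) ->
  rep p r f M.
Proof.
move=> aM fE; exists (fun s => tsum (fun t => if e t == s then a t else 0)).
split.
  have [h _] := @tsum_collect _ _ a e (fun al => r ^+ mdeg al) (asum_lt aM).
  exact: le_trans aM.
move=> x xr; rewrite fE //.
have [|_ ->] // := @tsum_collect _ _ a e (fun al => monom (x - p) al).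
apply: le_lt_trans (asum_lt aM); apply: le_asum => t.
have r0 : 0 <= r := le_trans (normr_ge0 _) xr.
by rewrite !normrM ler_wpM2l // (le_trans (monom_le _ xr)) // ler_norm.
Qed.

(** The Weierstrass test at the level of majorants. Products, substitutions and difference quotients
    of power series are all obtained as instances. *)
Lemma rep_sum k (p : 'rV[R]_k) r F M (I : choiceType) (f : I -> 'rV[R]_k -> R)
    (m : I -> R) :
  (forall i, rep p r (f i) `|m i|) -> (asum m <= M%:E)%E ->
  (forall x, `|x - p| <= r -> F x = tsum (fun i => f i x)) -> rep p r F M.
Proof.
move=> /choice[a fa] mM FE.
have aM : (asum (fun t : I * expo k => a t.1 t.2 * r ^+ mdeg t.2)%R <= M%:E)%E.
  rewrite (asum_prod (fun i al => a i al * r ^+ mdeg al)) (le_trans _ mM) //.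
  apply: le_esum => i _; exact: (fa i).1.
apply: (@rep_family _ _ _ _ _ _ (fun t : I * expo k => a t.1 t.2) snd) => //.
move=> x xr; rewrite FE //.
have sx : (asum (fun t : I * expo k => a t.1 t.2 * monom (x - p) t.2)%R < +oo)%E.
  apply: le_lt_trans (asum_lt aM); apply: le_asum => t.
  have r0 : 0 <= r := le_trans (normr_ge0 _) xr.
  by rewrite !normrM ler_wpM2l // (le_trans (monom_le _ xr)) // ler_norm.
rewrite (tsum_prod (a := fun i al => a i al * monom (x - p) al) sx).1.
by apply: eq_tsum => i; rewrite (fa i).2.
Qed.

Lemma tsum_bool (b : bool -> R) : tsum b = b true + b false.
Proof.
pose b1 t : R := if t then b true else 0; pose b2 t : R := if t then 0 else b false.
have [E1 F1] := @tsum_single _ _ true b1 ltac:(by case).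
have [E2 F2] := @tsum_single _ _ false b2 ltac:(by case).
rewrite -[b true]/(b1 true) -[b false]/(b2 false) -E1 -E2 -tsumD ?F1 ?F2 ?ltry //.
by apply: eq_tsum => -[]; rewrite /b1 /b2 ?addr0 ?add0r.
Qed.

Lemma asum_bool (b : bool -> R) : (asum b <= (`|b true| + `|b false|)%:E)%E.
Proof.
pose b1 t : R := if t then b true else 0; pose b2 t : R := if t then 0 else b false.
have [E1 F1] := @tsum_single _ _ true b1 ltac:(by case).
have [E2 F2] := @tsum_single _ _ false b2 ltac:(by case).
have -> : b = fun t => b1 t + b2 t.
  by apply/funext => -[]; rewrite /b1 /b2 ?addr0 ?add0r.
apply: (le_trans (asumD _ _)); rewrite F1 F2 -EFinD lee_fin /b1 /b2.
by rewrite addr0 add0r.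
Qed.

Lemma rep_add k (p : 'rV[R]_k) r f g M N :
  rep p r f M -> rep p r g N -> rep p r (fun x => f x + g x) (M + N).
Proof.
move=> hf hg; pose F b := if b then f else g; pose m b := if b then M else N.
apply: (@rep_sum _ _ _ _ _ _ F m).
- by case; rewrite /F /m ger0_norm //; [exact: rep_M_ge0 hf|exact: rep_M_ge0 hg].
- rewrite (le_trans (asum_bool _)) // lee_fin /m !ger0_norm //.
    exact: rep_M_ge0 hg.
  exact: rep_M_ge0 hf.
- by move=> x _; rewrite tsum_bool.
Qed.

Lemma rep_monom_mul k (p : 'rV[R]_k) r c al g M : 0 <= r -> rep p r g M ->
  rep p r (fun x => c * monom (x - p) al * g x) (`|c| * r ^+ mdeg al * M).
Proof.
move=> r0 [a [aM gE]].
apply: (@rep_family _ _ _ _ _ _ (fun be => c * a be)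
  (fun be : expo k => [ffun i => al i + be i]%N : expo k)).
  have -> : (fun t => c * a t * r ^+ mdeg [ffun i => al i + t i]%N) =
            (fun t => (c * r ^+ mdeg al) * (a t * r ^+ mdeg t)).
    by apply/funext => t; rewrite mdegD exprD; ring.
  rewrite asumZ normrM (ger0_norm (exprn_ge0 _ r0)) [leRHS]EFinM.
  apply: lee_pmul => //; rewrite ?lee_fin ?mulr_ge0 ?exprn_ge0 //.
  exact: asum_ge0.
move=> x xr; rewrite gE // -tsumZ.
  by apply: eq_tsum => t; rewrite monomD; ring.
apply: le_lt_trans (asum_lt aM); exact: rep_asum.
Qed.

Lemma tsumZr (T : choiceType) (c : R) (a : T -> R) : (asum a < +oo)%E ->
  tsum (fun t => a t * c) = tsum a * c.
Proof. by move=> sa; rewrite mulrC -tsumZ //; apply: eq_tsum => t; rewrite mulrC. Qed.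

Lemma rep_mul k (p : 'rV[R]_k) r f g M N : 0 <= r ->
  rep p r f M -> rep p r g N -> rep p r (fun x => f x * g x) (M * N).
Proof.
move=> r0 [a [aM fE]] hg; have N0 := rep_M_ge0 hg.
apply: (@rep_sum _ _ _ _ _ _ (fun al x => a al * monom (x - p) al * g x)
  (fun al => (a al * r ^+ mdeg al) * N)).
- move=> al; rewrite !normrM (ger0_norm N0) (ger0_norm (exprn_ge0 _ r0)).
  exact: rep_monom_mul.
- have -> : (fun al => a al * r ^+ mdeg al * N) = (fun al => N * (a al * r ^+ mdeg al)).
    by apply/funext => al; rewrite mulrC.
  rewrite asumZ (ger0_norm N0) (mulrC M) EFinM.
  by apply: lee_pmul => //; rewrite ?lee_fin ?asum_ge0.
- move=> x xr; rewrite fE // -tsumZr //.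
  exact: le_lt_trans (rep_asum _ xr) (asum_lt aM).
Qed.

Lemma rep_cst k (p : 'rV[R]_k) r c : rep p r (fun=> c) `|c|.
Proof.
pose z : expo k := [ffun=> 0%N].
have dz : mdeg z = 0%N by rewrite /mdeg big1 // => i _; rewrite ffunE.
have mz h : monom h z = 1 by rewrite /monom big1 // => i _; rewrite ffunE expr0.
apply: (@rep_family _ _ _ _ _ _ (fun _ : unit => c) (fun=> z)).
  have [_ ->] := @tsum_single _ _ tt (fun=> c * r ^+ mdeg z) ltac:(by case).
  by rewrite dz expr0 mulr1.
move=> x _; have [-> _] := @tsum_single _ _ tt (fun=> c * monom (x - p) z) ltac:(by case).
by rewrite mz mulr1.
Qed.

Lemma rep_coord k (p : 'rV[R]_k) r i : 0 <= r -> rep p r (fun x => x 0 i - p 0 i) r.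
Proof.
move=> r0; pose z : expo k := [ffun j => (j == i) : nat].
have dz : mdeg z = 1%N.
  rewrite /mdeg (bigD1 i) //= ffunE eqxx big1 // => j ji.
  by rewrite ffunE (negbTE ji).
have mz h : monom h z = h 0 i.
  rewrite /monom (bigD1 i) //= ffunE eqxx expr1 big1 ?mulr1 // => j ji.
  by rewrite ffunE (negbTE ji) expr0.
apply: (@rep_family _ _ _ _ _ _ (fun _ : unit => 1) (fun=> z)).
  have [_ ->] := @tsum_single _ _ tt (fun=> 1 * r ^+ mdeg z) ltac:(by case).
  by rewrite dz expr1 mul1r ger0_norm.
move=> x _; have [-> _] := @tsum_single _ _ tt (fun=> 1 * monom (x - p) z) ltac:(by case).
by rewrite mz mul1r !mxE.
Qed.

Lemma rep_big_add k (p : 'rV[R]_k) r (I : Type) (s : seq I) f m : 0 <= r ->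
  (forall i, rep p r (f i) (m i)) ->
  rep p r (fun x => \sum_(i <- s) f i x) (\sum_(i <- s) m i).
Proof.
move=> r0 fm; elim: s => [|i s IH].
  apply: (@rep_ext _ _ _ (fun=> 0) _ `|0|); last exact: rep_cst.
    by move=> x _; rewrite big_nil.
  by rewrite normr0 big_nil.
rewrite big_cons; apply: (rep_ext _ (lexx _)); last exact: rep_add (fm i) IH.
by move=> x _ /=; rewrite big_cons.
Qed.

Lemma rep_exp k (p : 'rV[R]_k) r f M n : 0 <= r -> rep p r f M ->
  rep p r (fun x => f x ^+ n) (M ^+ n).
Proof.
move=> r0 fM; elim: n => [|n IH].
  by rewrite expr0 -[X in rep _ _ _ X]normr1; exact: rep_cst.
rewrite exprS; apply: (rep_ext _ (lexx _)); last exact: rep_mul fM IH.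
by move=> x _; rewrite exprS.
Qed.

Lemma rep_big_mul k (p : 'rV[R]_k) r (I : Type) (s : seq I) f m : 0 <= r ->
  (forall i, rep p r (f i) (m i)) ->
  rep p r (fun x => \prod_(i <- s) f i x) (\prod_(i <- s) m i).
Proof.
move=> r0 fm; elim: s => [|i s IH].
  rewrite big_nil -[X in rep _ _ _ X]normr1.
  apply: (rep_ext _ (lexx _)); last exact: rep_cst.
  by move=> x _; rewrite big_nil.
rewrite big_cons; apply: (rep_ext _ (lexx _)); last exact: rep_mul (fm i) IH.
by move=> x _ /=; rewrite big_cons.
Qed.

(** The majorants of the components of H - q are at most [rho], the radius at which the majorant of
    [g] is evaluated. The substituted series is therefore dominated by that of [g], and the bound
    [M] survives unchanged. *)
Lemma rep_comp k l (p : 'rV[R]_k) (q : 'rV[R]_l) r rho g M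
    (H : 'rV[R]_k -> 'rV[R]_l) : 0 <= r -> 0 <= rho ->
  rep q rho g M -> (forall j, rep p r (fun x => H x 0 j - q 0 j) rho) ->
  rep p r (g \o H) M.
Proof.
move=> r0 rho0 [c [cM gE]] hH.
apply: (@rep_sum _ _ _ _ _ _ (fun al x => c al * monom (H x - q) al)
  (fun al => c al * rho ^+ mdeg al)) => //.
- move=> al; rewrite normrM (ger0_norm (exprn_ge0 _ rho0)).
  apply: rep_mul => //; first exact: rep_cst.
  rewrite /monom /mdeg -prodrXr.
  apply: (rep_ext _ (lexx _)); last first.
    apply: (@rep_big_mul _ _ _ _ _ (fun i x => (H x 0 i - q 0 i) ^+ al i)) => //.
    by move=> i; exact: rep_exp.
  by move=> x _ /=; apply: eq_bigr => i _; rewrite !mxE.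
- move=> x xr /=; rewrite gE //.
  apply/rV_normP => // i; rewrite !mxE; exact: rep_bound (hH i) xr.
Qed.

Lemma tsum_big (T : choiceType) (I : eqType) (s : seq I) (a : I -> T -> R) :
  (forall i, i \in s -> (asum (a i) < +oo)%E) ->
  tsum (fun t => \sum_(i <- s) a i t) = \sum_(i <- s) tsum (a i) /\
  (asum (fun t => \sum_(i <- s) a i t)%R < +oo)%E.
Proof.
elim: s => [|i s IH] sa.
  have Z : asum (fun _ : T => 0 : R) = 0%E by apply: esum1 => t _; rewrite normr0.
  rewrite big_nil; under eq_tsum do rewrite big_nil.
  under [X in asum X]eq_fun do rewrite big_nil.
  split; last by rewrite Z ltry.
  by rewrite tsum_ge0 // esum1.
have [E F] := IH (fun j js => sa j (mem_behead (s := i :: s) js)).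
have Fi := sa i (mem_head _ _).
rewrite big_cons; under eq_tsum do rewrite big_cons.
under [X in asum X]eq_fun do rewrite big_cons.
rewrite tsumD // E; split=> //.
by apply: le_lt_trans (asumD _ _) _; rewrite lte_add_pinfty.
Qed.

(** Each monomial of positive degree is divided by one coordinate that occurs in it, chosen by
    [pick], and the constant term cancels in f x - f p. Dividing by a coordinate divides the
    majorant by [r]. *)
Lemma rep_hadamard k (p : 'rV[R]_k) r f M : 0 < r -> rep p r f M ->
  exists g : 'I_k -> 'rV[R]_k -> R, (forall i, rep p r (g i) (M / r)) /\
    forall x, `|x - p| <= r -> f x - f p = \sum_i (x 0 i - p 0 i) * g i x.
Proof.
move=> r0 [a [aM fE]].
pose pk (al : expo k) := [pick i | (0 < al i)%N].
pose b i al := if pk al == Some i then a al else 0.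
pose e i (al : expo k) : expo k := [ffun j => al j - (j == i)]%N.
pose g i x := tsum (fun al => b i al * monom (x - p) (e i al)).
have pkP i al : pk al = Some i -> (0 < al i)%N.
  by rewrite /pk; case: pickP => // j aj [<-].
have sE i (al : expo k) : pk al = Some i -> al = [ffun j => ((j == i) + e i al j)%N].
  move/pkP => ai; apply/ffunP => j; rewrite !ffunE subnKC //.
  by case: eqP => [->|].
pose z i : expo k := [ffun j => (j == i) : nat].
have dz i : mdeg (z i) = 1%N.
  rewrite /mdeg (bigD1 i) //= ffunE eqxx big1 // => j ji.
  by rewrite ffunE (negbTE ji).
have mz i h : monom h (z i) = h 0 i.
  rewrite /monom (bigD1 i) //= ffunE eqxx expr1 big1 ?mulr1 // => j ji.
  by rewrite ffunE (negbTE ji) expr0.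
have dE i al : pk al = Some i -> mdeg al = (mdeg (e i al)).+1.
  move=> h; rewrite [in LHS](sE _ _ h) -add1n -(dz i) -mdegD; congr mdeg.
  by apply/ffunP => j; rewrite !ffunE.
have mE i al h : pk al = Some i -> monom h al = h 0 i * monom h (e i al).
  move=> hp; rewrite [in LHS](sE _ _ hp) -(mz i) -monomD; congr monom.
  by apply/ffunP => j; rewrite !ffunE.
have bM i : (asum (fun al => b i al * r ^+ mdeg (e i al))%R <= (M / r)%:E)%E.
  have : (asum (fun al => r^-1 * (a al * r ^+ mdeg al))%R <= (M / r)%:E)%E.
    rewrite asumZ gtr0_norm ?invr_gt0 // [M / r]mulrC EFinM.
    by apply: lee_pmul => //; rewrite ?lee_fin ?asum_ge0 // invr_ge0 ltW.
  apply: le_trans; apply: le_asum => al; rewrite /b.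
  case: eqP => [h|_]; last by rewrite mul0r normr0.
  by rewrite (dE _ _ h) exprS [r^-1 * _]mulrCA mulKf ?gt_eqF //.
exists g; split=> [i|x xr].
  by apply: (@rep_family _ _ _ _ _ _ (b i) (e i)).
have sb i : (asum (fun al => b i al * monom (x - p) (e i al))%R < +oo)%E.
  apply: le_lt_trans (asum_lt (bM i)); apply: le_asum => al.
  by rewrite !normrM ler_wpM2l // (le_trans (monom_le _ xr)) // ler_norm.
have sa (y : 'rV[R]_k) : `|y - p| <= r -> (asum (fun al => a al * monom (y - p) al)%R < +oo)%E.
  by move=> yr; apply: le_lt_trans (rep_asum _ yr) (asum_lt aM).
have pr : `|p - p| <= r by rewrite subrr normr0 ltW.
have spx := sa x xr; have spp := sa p pr.
have s1 : (asum (fun al => -1 * (a al * monom (p - p) al))%R < +oo)%E.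
  by rewrite asumZ -(fineK (asum_fin spp)) -EFinM ltry.
rewrite (fE _ xr) (fE _ pr) -[in LHS]mulN1r -(tsumZ _ spp) -(tsumD spx s1).
transitivity (tsum (fun al => \sum_i (x 0 i - p 0 i) * (b i al * monom (x - p) (e i al)))).
  apply: eq_tsum => al; rewrite subrr monom0.
  case E: (pk al) => [i|].
    rewrite (dE _ _ E) /= mulr0 mulr0 addr0 (bigD1 i) //= /b E eqxx big1 ?addr0.
      by rewrite (mE _ _ _ E) !mxE; ring.
    by move=> j ji; rewrite ifN ?mul0r ?mulr0 //; apply: contra ji => /eqP[->].
  have a0 i : al i = 0%N.
    by move: E; rewrite /pk; case: pickP => // /(_ i); rewrite lt0n => /negbFE /eqP.
  rewrite (_ : mdeg al = 0%N) ?eqxx; last by rewrite /mdeg big1.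
  rewrite (_ : monom _ al = 1); last by rewrite /monom big1 // => i _; rewrite a0 expr0.
  rewrite big1; first by rewrite !mulr1; ring.
  by move=> i _; rewrite /b E mul0r mulr0.
have sc i : (asum (fun al => (x 0 i - p 0 i) * (b i al * monom (x - p) (e i al)))%R < +oo)%E.
  by rewrite asumZ -(fineK (asum_fin (sb i))) -EFinM ltry.
have [-> _] := @tsum_big _ _ (index_enum 'I_k)
  (fun i al => (x 0 i - p 0 i) * (b i al * monom (x - p) (e i al))) (fun i _ => sc i).
by apply: eq_bigr => i _; rewrite (tsumZ _ (sb i)).
Qed.

End PowerSeries.

(** * Unordered sums as limits along exhausting finite sets *)

Section Exhaustion.
Context {R : realType}.

Lemma exhaust_finite (T : choiceType) (B : nat -> seq T) (X : set T) :
  (forall t, exists N, forall n, (N <= n)%N -> t \in B n) -> finite_set X ->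
  exists N, forall n, (N <= n)%N -> X `<=` [set` B n].
Proof.
move=> /choice[N NB] fX; exists (\max_(t <- finmap.enum_fset (fset_set X)) N t)%N => n nN t Xt /=.
by apply: NB; apply: leq_trans nN; apply: leq_bigmax_seq; rewrite // in_fset_set // inE.
Qed.

Lemma esum_exhaust (T : choiceType) (B : nat -> seq T) (p : T -> R) :
  (forall n, uniq (B n)) ->
  (forall t, exists N, forall n, (N <= n)%N -> t \in B n) ->
  (forall t, 0 <= p t) ->
  (forall M : R, (forall n, \sum_(t <- B n) p t <= M) ->
     (\esum_(t in [set: T]) (p t)%:E <= M%:E)%E) /\
  (forall n, (\sum_(t <- B n) p t)%:E <= \esum_(t in [set: T]) (p t)%:E)%E.
Proof.
move=> uB eB p0.
have fB n : \sum_(t <- B n) p t = \sum_(t \in [set` B n]) p t by rewrite fsbig_seq.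
split=> [M hM|n].
  apply: ge_ereal_sup => /= _ [X [finX _]] <-.
  have [N NX] := exhaust_finite eB finX.
  apply: (@le_trans _ _ (\sum_(t \in [set` B N]) (p t)%:E)%E).
    apply: lee_fsum_nneg_subset => //.
      by move=> t; rewrite !inE => /(NX N (leqnn _)).
    by move=> t _; rewrite lee_fin.
  by rewrite fsumEFin // -fB lee_fin.
rewrite fB -fsumEFin //; apply: ereal_sup_ubound.
by exists [set` B n] => //; split.
Qed.

Lemma tsum_cvg (T : choiceType) (B : nat -> seq T) (a : T -> R) :
  (forall n, uniq (B n)) ->
  (forall t, exists N, forall n, (N <= n)%N -> t \in B n) ->
  (asum a < +oo)%E ->
  (fun n => \sum_(t <- B n) a t) @ \oo --> tsum a.
Proof.
move=> uB eB sa; have [p [n [sp sn p0 n0 [apn _]]]] := asum_posneg sa.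
have P (q : T -> R) : (asum q < +oo)%E -> (forall t, 0 <= q t) ->
    (fun n => \sum_(t <- B n) q t) @ \oo --> tsum q.
  move=> sq q0; have fq : \esum_(t in [set: T]) (q t)%:E \is a fin_num.
    by apply: (esum_fin_le sq) => t; rewrite q0 ger0_norm /=.
  have [_ ub] := esum_exhaust uB eB q0.
  rewrite tsum_ge0 //; apply/cvgrPdist_le => e e0.
  have [_ [X [finX _] <-] hX] := ub_ereal_sup_adherent e0 fq.
  have [N NX] := exhaust_finite eB finX.
  exists N => // m /= Nm; rewrite ger0_norm; last first.
    by rewrite subr_ge0 -lee_fin fineK.
  rewrite lerBlDr -lerBlDl -lee_fin EFinB fineK // (le_trans (ltW hX)) //.
  have -> : \sum_(t <- B m) q t = \sum_(t \in [set` B m]) q t by rewrite fsbig_seq.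
  rewrite -fsumEFin //; apply: lee_fsum_nneg_subset => //.
    by move=> t; rewrite !inE => /(NX m Nm).
  by move=> t _; rewrite lee_fin.
rewrite (tsum_decomp sp sn p0 n0 apn) -!tsum_ge0 //.
have -> : (fun m => \sum_(t <- B m) a t) =
  (fun m => \sum_(t <- B m) p t - \sum_(t <- B m) n t).
  by apply/funext => m; rewrite -sumrB; apply: eq_bigr => t _.
exact: cvgB (P _ sp p0) (P _ sn n0).
Qed.

End Exhaustion.

Section Analytic.
Context {R : realType}.
Notation expo k := {ffun 'I_k -> nat}.

Definition box_expo k N (al : {ffun 'I_k -> 'I_N}) : expo k :=
  [ffun i => al i : nat].
Definition box k N : seq (expo k) := [seq box_expo al | al : {ffun 'I_k -> 'I_N}].

Lemma box_uniq k N : uniq (box k N).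
Proof.
rewrite map_inj_uniq ?enum_uniq // => a b /ffunP ab; apply/ffunP => i.
by apply: val_inj; have := ab i; rewrite !ffunE.
Qed.

Lemma box_exhaust k (al : expo k) : exists N, forall n, (N <= n)%N -> al \in box k n.
Proof.
exists (\max_i al i).+1 => n Nn.
have an i : (al i < n)%N.
  by apply: leq_trans Nn; rewrite ltnS; exact: leq_bigmax.
apply/mapP; exists [ffun i => Ordinal (an i)]; first by rewrite mem_enum.
by apply/ffunP => i; rewrite !ffunE.
Qed.

Lemma box_sum k N (F : expo k -> R) :
  \sum_(t <- box k N) F t = \sum_(al : {ffun 'I_k -> 'I_N}) F (box_expo al).
Proof. by rewrite big_map big_enum. Qed.

(** At the point p + (s, ..., s) with s = r / 2 every monomial attains its maximum s^deg on the
    closed ball of radius s. Absolute convergence at this single point therefore bounds the whole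
    majorant. *)
Lemma analytic_atP k (f : 'rV[R]_k -> R) p :
  analytic_at f p <-> exists r M, 0 < r /\ rep p r f M.
Proof.
split=> [[c [r [r0 h]]]|[r [M [r0 [a [aM fE]]]]]].
  pose a (al : expo k) := c (fun i => al i).
  have tE x N (al : {ffun 'I_k -> 'I_N}) :
      a (box_expo al) * monom x (box_expo al) =
      c (fun i => al i) * \prod_(i < k) x 0 i ^+ al i.
    congr (c _ * _); first by apply/funext => i; rewrite ffunE.
    by apply: eq_bigr => i _; rewrite ffunE.
  pose s := r / 2; have s0 : 0 < s by rewrite divr_gt0.
  have sr : s < r by rewrite ltr_pdivrMr // ltr_pMr // ltr1n.
  pose x0 : 'rV[R]_k := p + \row_i s.
  have x0s : `|x0 - p| <= s.
    apply/rV_normP; first exact: ltW.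
    by move=> i; rewrite !mxE addrAC subrr add0r gtr0_norm.
  have [cv _] := h _ (le_lt_trans x0s sr).
  have m0 (al : expo k) : monom (x0 - p) al = s ^+ mdeg al.
    rewrite /monom /mdeg -prodrXr; apply: eq_bigr => i _.
    by rewrite !mxE addrAC subrr add0r.
  have [M hM] : exists M : R, forall n, \sum_(t <- box k n) `|a t * s ^+ mdeg t| <= M.
    have ndec : nondecreasing_seq (fun n => \sum_(t <- box k n) `|a t * s ^+ mdeg t|).
      move=> n m nm; rewrite -lee_fin -!sumEFin.
      have F n' : (\sum_(t <- box k n') `|a t * s ^+ mdeg t|%:E =
        \sum_(t \in [set` box k n']) `|a t * s ^+ mdeg t|%:E)%E.
        by rewrite fsbig_seq // box_uniq.
      rewrite !F; apply: lee_fsum_nneg_subset.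
      - exact: finite_seq.
      - exact: finite_seq.
      - move=> t; rewrite !inE /= => /mapP[al _ ->]; apply/mapP.
        exists [ffun i => widen_ord nm (al i)]; first by rewrite mem_enum.
        by apply/ffunP => i; rewrite !ffunE.
      - by move=> t _ /=; rewrite lee_fin.
    have cv' : cvgn (fun n => \sum_(t <- box k n) `|a t * s ^+ mdeg t|).
      rewrite (_ : (fun n => _) = (fun N => \sum_(al : {ffun 'I_k -> 'I_N})
        `|c (fun i => al i) * \prod_(i < k) (x0 - p) 0 i ^+ al i|)) //.
      apply/funext => n; rewrite box_sum; apply: eq_bigr => al _.
      by rewrite -tE m0.
    exists (limn (fun n => \sum_(t <- box k n) `|a t * s ^+ mdeg t|)) => n.
    exact: nondecreasing_cvgn_le.
  exists s, M; split=> //; exists a.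
  have aM : (asum (fun al => a al * s ^+ mdeg al)%R <= M%:E)%E.
    exact: (esum_exhaust (@box_uniq k) (@box_exhaust k) _).1.
  split=> [|x xs]; first exact: aM.
  have [_ cx] := h _ (le_lt_trans xs sr).
  have cx' := tsum_cvg (@box_uniq k) (@box_exhaust k)
    (le_lt_trans (rep_asum a xs) (asum_lt aM)).
  apply: (@cvg_unique _ (@Rhausdorff R) _ _ _ _ cx).
  rewrite (_ : (fun N => _) = (fun n => \sum_(t <- box k n) a t * monom (x - p) t)) //.
  by apply/funext => N; rewrite box_sum; apply: eq_bigr => al _; rewrite tE.
exists (fun be => a [ffun i => be i]), r; split=> // x xr.
have sx := le_lt_trans (rep_asum a (ltW xr)) (asum_lt aM).
have tE N (al : {ffun 'I_k -> 'I_N}) :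
    a [ffun i => al i : nat] * \prod_(i < k) (x - p) 0 i ^+ al i =
    a (box_expo al) * monom (x - p) (box_expo al).
  by congr (a _ * _); apply: eq_bigr => i _; rewrite ffunE.
split=> /=.
  apply/cvg_ex; exists (tsum (fun al => `|a al * monom (x - p) al|)).
  rewrite (_ : (fun N => _) = (fun n => \sum_(t <- box k n) `|a t * monom (x - p) t|)).
    apply: tsum_cvg; [exact: box_uniq|exact: box_exhaust|].
    by apply: le_lt_trans sx; apply: le_asum => t; rewrite normr_id.
  by apply/funext => N; rewrite box_sum; apply: eq_bigr => al _; rewrite tE.
rewrite fE ?ltW //.
rewrite (_ : (fun N => _) = (fun n => \sum_(t <- box k n) a t * monom (x - p) t)).
  by apply: tsum_cvg; [exact: box_uniq|exact: box_exhaust|].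
by apply/funext => N; rewrite box_sum; apply: eq_bigr => al _; rewrite tE.
Qed.

Lemma analytic_at_common k (I : finType) (f : I -> 'rV[R]_k -> R) p :
  (forall i, analytic_at (f i) p) ->
  exists r, 0 < r /\ forall i, exists M, rep p r (f i) M.
Proof.
move=> fA; have /choice[r hr] : forall i, exists r, 0 < r /\ exists M, rep p r (f i) M.
  by move=> i; have /analytic_atP[r [M [r0 h]]] := fA i; exists r; split=> //; exists M.
exists (\big[Num.min/1]_i r i); split.
  by apply/bigmin_gtP; split=> // i _; case: (hr i).
move=> i; have [r0 [M hM]] := hr i; exists M.
apply: rep_restrict hM; last exact: bigmin_le_cond.
by apply/bigmin_geP; split=> // j _; case: (hr j) => /ltW.
Qed.

(** By Hadamard's formula the majorant of f - f p at radius r' is at most r' k M / r, which shrinks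
    with r'. This is what makes compositions possible without control of the original radius. *)
Lemma analytic_small k (f : 'rV[R]_k -> R) p rho : 0 < rho -> analytic_at f p ->
  exists r, 0 < r /\ forall r', 0 <= r' -> r' <= r -> rep p r' (fun x => f x - f p) rho.
Proof.
move=> rho0 /analytic_atP[r [M [r0 fM]]].
have [g [gM fE]] := rep_hadamard r0 fM.
have M0 := rep_M_ge0 fM.
(* The added 1 keeps the denominator positive when [k] or [M] vanishes. *)
pose r1 := Num.min r (rho / (k%:R * (M / r) + 1)).
have d0 : 0 < k%:R * (M / r) + 1.
  by rewrite ltr_wpDl // mulr_ge0 // divr_ge0 // ltW.
exists r1; split; first by rewrite lt_min r0 divr_gt0.
move=> r' r'0; rewrite le_min => /andP[r'r r'rho].
apply: (@rep_ext _ _ _ _ (fun x => \sum_i (x 0 i - p 0 i) * g i x) _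
   (\sum_(i < k) r' * (M / r))); last first.
- apply: rep_big_add => // i; apply: rep_mul => //; first exact: rep_coord.
  exact: rep_restrict (gM i).
- rewrite sumr_const card_ord -mulr_natl mulrCA.
  apply: (@le_trans _ _ (r' * (k%:R * (M / r) + 1))).
    by rewrite ler_wpM2l // lerDl.
  by rewrite -ler_pdivlMr.
- by move=> x xr; rewrite -fE // (le_trans xr).
Qed.

Lemma analytic_comp k l (g : 'rV[R]_l -> R) (H : 'rV[R]_k -> 'rV[R]_l) p :
  (forall j, analytic_at (fun x => H x 0 j) p) -> analytic_at g (H p) ->
  analytic_at (g \o H) p.
Proof.
move=> HA /analytic_atP[rho [M [rho0 gM]]].
have /choice[r hr] := fun j => analytic_small rho0 (HA j).
pose s := \big[Num.min/1]_j r j.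
have s0 : 0 < s by apply/bigmin_gtP; split=> // i _; case: (hr i).
apply/analytic_atP; exists s, M; split=> //.
apply: (rep_comp (ltW s0) (ltW rho0) gM) => j.
by apply: (hr j).2; [exact: ltW|exact: bigmin_le_cond].
Qed.

Lemma analytic_cst k (p : 'rV[R]_k) c : analytic_at (fun=> c) p.
Proof. by apply/analytic_atP; exists 1, `|c|; split=> //; exact: rep_cst. Qed.

Lemma analytic_coord k (p : 'rV[R]_k) i : analytic_at (fun x => x 0 i) p.
Proof.
apply/analytic_atP; exists 1, (1 + `|p 0 i|); split=> //.
apply: (rep_ext _ (lexx _)); last exact: rep_add (rep_coord p i ler01) (rep_cst p _ _).
by move=> x _ /=; rewrite subrK.
Qed.

Lemma analytic_pair k (f g : 'rV[R]_k -> R) p :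
  analytic_at f p -> analytic_at g p ->
  exists r M N, [/\ 0 < r, rep p r f M & rep p r g N].
Proof.
move=> fA gA; have [|r [r0 h]] := @analytic_at_common k bool (fun b => if b then f else g) p.
  by case.
by have [M hM] := h true; have [N hN] := h false; exists r, M, N.
Qed.

Lemma analytic_add k (f g : 'rV[R]_k -> R) p : analytic_at f p -> analytic_at g p ->
  analytic_at (fun x => f x + g x) p.
Proof.
move=> fA gA; have [r [M [N [r0 fM gN]]]] := analytic_pair fA gA.
by apply/analytic_atP; exists r, (M + N); split=> //; exact: rep_add.
Qed.

Lemma analytic_mul k (f g : 'rV[R]_k -> R) p : analytic_at f p -> analytic_at g p ->
  analytic_at (fun x => f x * g x) p.
Proof.
move=> fA gA; have [r [M [N [r0 fM gN]]]] := analytic_pair fA gA.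
by apply/analytic_atP; exists r, (M * N); split=> //; apply: rep_mul => //; exact: ltW.
Qed.

Lemma analytic_opp k (f : 'rV[R]_k -> R) p : analytic_at f p ->
  analytic_at (fun x => - f x) p.
Proof.
move=> fA; rewrite (_ : (fun x => _) = (fun x => -1 * f x)).
  by apply: analytic_mul => //; exact: analytic_cst.
by apply/funext => x; rewrite mulN1r.
Qed.

Lemma analytic_sub k (f g : 'rV[R]_k -> R) p : analytic_at f p -> analytic_at g p ->
  analytic_at (fun x => f x - g x) p.
Proof. by move=> fA gA; apply: analytic_add => //; exact: analytic_opp. Qed.

Lemma analytic_exp k (f : 'rV[R]_k -> R) n p : analytic_at f p ->
  analytic_at (fun x => f x ^+ n) p.
Proof.
move=> fA; elim: n => [|n IH]; first exact: analytic_cst.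
rewrite (_ : (fun x => _) = (fun x => f x * f x ^+ n)); first exact: analytic_mul.
by apply/funext => x; rewrite exprS.
Qed.

Lemma analytic_sum k (I : Type) (s : seq I) (P : pred I) (f : I -> 'rV[R]_k -> R) p :
  (forall i, analytic_at (f i) p) -> analytic_at (fun x => \sum_(i <- s | P i) f i x) p.
Proof.
move=> fA; elim: s => [|i s IH].
  rewrite (_ : (fun x => _) = (fun=> 0)); first exact: analytic_cst.
  by apply/funext => x; rewrite big_nil.
rewrite (_ : (fun x => _) = (fun x => (if P i then f i x else 0) +
   \sum_(i <- s | P i) f i x)).
  by apply: analytic_add => //; case: (P i) => //; exact: analytic_cst.
by apply/funext => x; rewrite big_cons; case: (P i); rewrite ?add0r.
Qed.

Lemma near_normP k (p : 'rV[R]_k) (P : set 'rV[R]_k) :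
  (\forall x \near p, P x) <-> exists2 r, 0 < r & forall x, `|x - p| < r -> P x.
Proof.
split=> [/nbhs_ballP[r /= r0 h]|[r r0 h]].
  by exists r => // x xr; apply: h; rewrite -ball_normE /= distrC.
by apply/nbhs_ballP; exists r => //= x; rewrite -ball_normE /= distrC => /h.
Qed.

Lemma analytic_near k (f g : 'rV[R]_k -> R) p :
  (\forall x \near p, f x = g x) -> analytic_at f p -> analytic_at g p.
Proof.
move=> /near_normP[s s0 fg] /analytic_atP[r [M [r0 fM]]].
pose t := Num.min r (s / 2); have t0 : 0 < t by rewrite lt_min r0 divr_gt0.
apply/analytic_atP; exists t, M; split=> //.
apply: (@rep_ext _ _ _ _ f _ M) => //.
  move=> x xt; apply: fg; apply: le_lt_trans xt _; rewrite gt_min.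
  by rewrite [s / 2 < s]ltr_pdivrMr // ltr_pMr // ltr1n orbT.
by apply: rep_restrict fM; [exact: ltW|rewrite ge_min lexx].
Qed.

Lemma analytic_hadamard k (f : 'rV[R]_k -> R) p : analytic_at f p ->
  exists g : 'I_k -> 'rV[R]_k -> R, (forall i, analytic_at (g i) p) /\
    \forall x \near p, f x - f p = \sum_i (x 0 i - p 0 i) * g i x.
Proof.
move=> /analytic_atP[r [M [r0 fM]]].
have [g [gM fE]] := rep_hadamard r0 fM.
exists g; split=> [i|]; first by apply/analytic_atP; exists r, (M / r).
by apply/near_normP; exists r => // x xr; rewrite fE // ltW.
Qed.

Lemma analytic_continuous k (f : 'rV[R]_k -> R) p : analytic_at f p ->
  {for p, continuous f}.
Proof.
move=> fA; apply/(@cvgrPdist_le _ _ _ (nbhs p) (nbhs_filter p)) => e e0.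
have [r [r0 h]] := analytic_small e0 fA.
apply/near_normP; exists r => // x xr; rewrite distrC.
exact: (rep_bound (h _ (ltW r0) (lexx _)) (ltW xr)).
Qed.

(** Stated with partial sums, the form in which the series of the exponential, sine, cosine and
    inverse are available; [analytic_comp1] converts it. *)
Definition analytic1 (phi : R -> R) (y : R) :=
  exists (c : nat -> R) (r M : R), [/\ 0 < r,
    forall n, \sum_(0 <= i < n) `|c i| * r ^+ i <= M &
    forall h, `|h| <= r ->
      (fun n => \sum_(0 <= i < n) c i * h ^+ i) @ \oo --> phi (y + h)].

Lemma analytic_comp1 k (phi : R -> R) (f : 'rV[R]_k -> R) p :
  analytic1 phi (f p) -> analytic_at f p -> analytic_at (phi \o f) p.
Proof.
move=> [c [rho [M [rho0 cM cv]]]] fA.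
have [r [r0 h]] := analytic_small rho0 fA; have {}h := h _ (ltW r0) (lexx _).
have uB n : uniq (index_iota 0 n) by exact: iota_uniq.
have eB (t : nat) : exists N, forall n, (N <= n)%N -> t \in index_iota 0 n.
  by exists t.+1 => n; rewrite mem_index_iota.
have sM : (asum (fun i => c i * rho ^+ i)%R <= M%:E)%E.
  apply: (esum_exhaust uB eB _).1 => [t|n]; first exact: normr_ge0.
  rewrite (le_trans _ (cM n)) //; apply: ler_sum => i _.
  by rewrite normrM (ger0_norm (exprn_ge0 _ (ltW rho0))).
apply/analytic_atP; exists r, M; split=> //.
apply: (@rep_sum _ _ _ _ _ _ _ (fun i x => c i * (f x - f p) ^+ i)
  (fun i => c i * rho ^+ i)) => //.
- move=> i; rewrite normrM (ger0_norm (exprn_ge0 _ (ltW rho0))).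
  apply: rep_mul; [exact: ltW|exact: rep_cst|].
  by apply: rep_exp => //; exact: ltW.
- move=> x xr /=; have hb := rep_bound h xr.
  have := cv _ hb; rewrite [f p + _]addrC subrK => cx.
  have cx' := @tsum_cvg _ _ _ (fun i => c i * (f x - f p) ^+ i) uB eB.
  apply: (@cvg_unique _ (@Rhausdorff R) _ _ _ _ cx); apply: cx'.
  apply: le_lt_trans (asum_lt sM); apply: le_asum => i.
  rewrite !normrM ler_wpM2l // !normrX lerXn2r ?nnegrE //.
  by rewrite (ger0_norm (ltW rho0)).
Qed.

Lemma analytic1_expR y : analytic1 expR y.
Proof.
exists (fun n => expR y / n`!%:R), 1, (expR y * expR 1); split=> //.
  move=> n; rewrite (eq_bigr (fun i => expR y * exp_coeff 1 i)); last first.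
    move=> i _; rewrite /exp_coeff /= expr1n mulr1 normrM ger0_norm ?expR_ge0 //.
    by rewrite normfV normr_nat mul1r.
  rewrite -mulr_sumr ler_wpM2l ?expR_ge0 //.
  apply: nondecreasing_cvgn_le; last exact: is_cvg_series_exp_coeff.
  by apply/nondecreasing_seqP => m; rewrite -subr_ge0 seriesSB exp_coeff_ge0.
move=> h _; rewrite expRD.
rewrite (_ : (fun n => _) = (fun n => expR y * series (exp_coeff h) n)).
  by apply: cvgZr; exact: is_cvg_series_exp_coeff.
apply/funext => n; rewrite /series /= mulr_sumr; apply: eq_bigr => i _.
by rewrite /exp_coeff /=; ring.
Qed.

Lemma series_exp_bound n (c : nat -> R) : (forall i, `|c i| <= i`!%:R^-1) ->
  \sum_(0 <= i < n) `|c i| * 1 ^+ i <= expR 1.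
Proof.
move=> ci; apply: (@le_trans _ _ (series (exp_coeff (1 : R)) n)).
  by apply: ler_sum => i _; rewrite /exp_coeff /= expr1n mulr1 mul1r.
apply: nondecreasing_cvgn_le; last exact: is_cvg_series_exp_coeff.
by apply/nondecreasing_seqP => m; rewrite -subr_ge0 seriesSB exp_coeff_ge0.
Qed.

Lemma analytic1_sin0 : analytic1 sin 0.
Proof.
exists (fun n => (odd n)%:R * (-1) ^+ n.-1./2 * (n`!%:R)^-1), 1, (expR 1); split=> //.
  move=> n; apply: series_exp_bound => i.
  rewrite !normrM normrX normrN1 expr1n mulr1 normfV normr_nat.
  by case: (odd i); rewrite ?normr0 ?normr1 ?mul0r ?mul1r ?invr_ge0 // ?normr_nat.
by move=> h _; rewrite add0r sin.unlock; have := @is_cvg_series_sin_coeff R h; rewrite sin_coeffE.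
Qed.

Lemma analytic1_cos0 : analytic1 cos 0.
Proof.
exists (fun n => (~~ odd n)%:R * (-1) ^+ n./2 * (n`!%:R)^-1), 1, (expR 1); split=> //.
  move=> n; apply: series_exp_bound => i.
  rewrite !normrM normrX normrN1 expr1n mulr1 normfV normr_nat.
  by case: (odd i); rewrite ?normr0 ?normr1 ?mul0r ?mul1r ?invr_ge0 // ?normr_nat.
by move=> h _; rewrite add0r cos.unlock; have := @is_cvg_series_cos_coeff R h; rewrite cos_coeffE.
Qed.

Lemma analytic1_inv y : y != 0 -> analytic1 GRing.inv y.
Proof.
move=> y0; have ny : 0 < `|y| by rewrite normr_gt0.
(* 1 / (y + h) is the sum of (-1)^n h^n / y^(n+1). At radius |y| / 2 the majorant is geometric of
   ratio 1/2, with sum 2 / |y|. *)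
exists (fun n => (-1) ^+ n / y ^+ n.+1), (`|y| / 2), (2 / `|y|); split.
- by rewrite divr_gt0.
- move=> n; rewrite (eq_bigr (fun i => geometric `|y|^-1 2^-1 i)); last first.
    move=> i _; rewrite /geometric /= normrM normrX normrN1 expr1n mul1r normfV normrX.
    have a0 : `|y| != 0 by rewrite normr_eq0.
    by rewrite exprS expr_div_n exprVn; field; rewrite a0 !expf_neq0.
  have -> : \sum_(0 <= i < n) geometric `|y|^-1 (2^-1 : R) i =
            series (geometric `|y|^-1 2^-1) n by [].
  have h2 : (2^-1 : R) != 1 by lra.
  rewrite (geometric_seriesE _ h2) /= mulrAC; have : 0 <= (2^-1 : R) ^+ n by [].
  move=> t0; rewrite (_ : 2 / `|y| = `|y|^-1 * (1 - 2^-1)^-1); last by field; lra.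
  rewrite ler_piMr ?divr_ge0 ?invr_ge0 //; lra.
- move=> h hy.
  have yh : `| - h / y| < 1.
    rewrite normrM normrN normfV ltr_pdivrMr // mul1r (le_lt_trans hy) //.
    by rewrite ltr_pdivrMr // ltr_pMr // ltr1n.
  have h1 : y + h != 0.
    apply/eqP => /eqP; rewrite addr_eq0 => /eqP yE; move: hy.
    by rewrite yE normrN in ny *; rewrite leNgt ltr_pdivrMr // ltr_pMr // ltr1n.
  have := @cvg_geometric_series R y^-1 _ yh.
  rewrite (_ : y^-1 * (1 - - h / y)^-1 = (y + h)^-1); last first.
    have e1 : 1 - - h / y = (y + h) / y by rewrite mulNr opprK mulrDl divff.
    by rewrite e1 invf_div mulrA mulVf // mul1r.
  rewrite (_ : series _ = (fun n => \sum_(0 <= i < n) (-1) ^+ i / y ^+ i.+1 * h ^+ i)) //.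
  apply/funext => n; rewrite /series /=; apply: eq_bigr => i _.
  by rewrite /geometric /= exprMn [(- h) ^+ i]exprNn exprVn exprS invfM; ring.
Qed.

Lemma analytic_inv k (f : 'rV[R]_k -> R) p : f p != 0 -> analytic_at f p ->
  analytic_at (fun x => (f x)^-1) p.
Proof. by move=> f0; apply: analytic_comp1; exact: analytic1_inv. Qed.

Lemma analytic_div k (f g : 'rV[R]_k -> R) p : g p != 0 -> analytic_at f p ->
  analytic_at g p -> analytic_at (fun x => f x / g x) p.
Proof. by move=> g0 fA gA; apply: analytic_mul => //; exact: analytic_inv. Qed.

Lemma analytic_expR k (f : 'rV[R]_k -> R) p : analytic_at f p ->
  analytic_at (fun x => expR (f x)) p.
Proof. by apply: analytic_comp1; exact: analytic1_expR. Qed.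

(** The addition theorems move the expansion to 0, the only point at which the series of sine and
    cosine are used. *)
Lemma analytic_sincos k (f : 'rV[R]_k -> R) p : analytic_at f p ->
  analytic_at (fun x => sin (f x)) p /\ analytic_at (fun x => cos (f x)) p.
Proof.
move=> fA; have dA : analytic_at (fun x => f x - f p) p.
  by apply: analytic_sub => //; exact: analytic_cst.
have sA : analytic_at (fun x => sin (f x - f p)) p.
  by apply: analytic_comp1 dA; rewrite subrr; exact: analytic1_sin0.
have cA : analytic_at (fun x => cos (f x - f p)) p.
  by apply: analytic_comp1 dA; rewrite subrr; exact: analytic1_cos0.
split.
  rewrite (_ : (fun x => _) = (fun x => sin (f x - f p) * cos (f p) + cos (f x - f p) * sin (f p))).
    by apply: analytic_add; apply: analytic_mul => //; exact: analytic_cst.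
  by apply/funext => x; rewrite -sinD subrK.
rewrite (_ : (fun x => _) = (fun x => cos (f x - f p) * cos (f p) - sin (f x - f p) * sin (f p))).
  by apply: analytic_sub; apply: analytic_mul => //; exact: analytic_cst.
by apply/funext => x; rewrite -cosD subrK.
Qed.

End Analytic.

(** * Difference quotients in one coordinate *)

Section Slopes.
Context {R : realType}.
Notation expo k := {ffun 'I_k -> nat}.

Definition upd k (x : 'rV[R]_k) (i : 'I_k) (s : R) : 'rV[R]_k :=
  \row_j (if j == i then s else x 0 j).

(** The quotient (a^n - b^n) / (a - b) has n terms; halving the radius pays for them because n <
    2^n. *)
Lemma half_pow_bound (r : R) n : 0 < r ->
  \sum_(l < n) (r / 2) ^+ (n.-1 - l) * (r / 2) ^+ l <= 2 / r * r ^+ n.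
Proof.
move=> r0; case: n => [|n]; first by rewrite big_ord0 expr0 mulr1 divr_ge0 // ltW.
rewrite (eq_bigr (fun=> (r / 2) ^+ n)); last first.
  by move=> l _; rewrite -exprD subnK // -ltnS.
rewrite sumr_const card_ord expr_div_n -[_ *+ n.+1]mulr_natl.
have p2 : 0 < (2 : R) ^+ n by rewrite exprn_gt0.
have -> : 2 / r * r ^+ n.+1 = 2 * r ^+ n by rewrite exprS; field; rewrite gt_eqF.
rewrite mulrA ler_pdivrMr // [leRHS]mulrAC ler_wpM2r ?exprn_ge0 1?ltW //.
have : (n.+1%:R : R) < (2 ^ n.+1)%:R by rewrite ltr_nat ltn_expl.
by rewrite natrX exprS.
Qed.

(** The quotient is taken monomial by monomial, hence is analytic in (x, s) jointly, also where s
    equals the i-th coordinate of x. Its being nonzero bounds the number of zeros of f on a line,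
    and it can be iterated. *)
Lemma analytic_slope k (f : 'rV[R]_k -> R) p i : analytic_at f p ->
  exists K : 'rV[R]_(k + 1) -> R,
    analytic_at K (row_mx p (p 0 i)%:M) /\
    exists r, 0 < r /\ forall x s, `|x - p| < r -> `|s - p 0 i| < r ->
      f x - f (upd x i s) = (x 0 i - s) * K (row_mx x s%:M).
Proof.
move=> /analytic_atP[r [M [r0 [a [aM fE]]]]].
pose P : 'rV[R]_(k + 1) := row_mx p (p 0 i)%:M.
pose r' := r / 2; have r'0 : 0 < r' by rewrite divr_gt0.
have r'r : r' <= r by rewrite ler_pdivrMr // ler_pMr // ler1n.
(* [rest] is the part of the monomial free of the i-th coordinate, and [geo n] is (a^n - b^n) / (a -
   b) for the two values of that coordinate, measured from p. *)
pose rest (al : expo k) (z : 'rV[R]_(k + 1)) :=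
  \prod_(j < k | j != i) (z 0 (lshift 1 j) - P 0 (lshift 1 j)) ^+ al j.
pose geo (n : nat) (z : 'rV[R]_(k + 1)) := \sum_(l < n)
  (z 0 (lshift 1 i) - P 0 (lshift 1 i)) ^+ (n.-1 - l) *
  (z 0 (rshift k 0) - P 0 (rshift k 0)) ^+ l.
pose Kal al z := a al * (rest al z * geo (al i) z).
pose m (al : expo k) := 2 / r * (a al * r ^+ mdeg al).
have repK al : rep P r' (Kal al) `|m al|.
  have -> : `|m al| = `|a al| * (\prod_(j < k | j != i) r ^+ al j * (2 / r * r ^+ al i)).
    rewrite /m !normrM (ger0_norm (exprn_ge0 _ (ltW r0))) /mdeg -prodrXr (bigD1 i) //=.
    by rewrite normfV (ger0_norm (ltW r0)) normr_nat; ring.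
  apply: rep_mul; [exact: ltW|exact: rep_cst|].
  apply: rep_mul; first exact: ltW.
  - rewrite -big_filter; apply: (@rep_ext _ _ _ _ (fun z =>
      \prod_(j <- [seq j <- index_enum 'I_k | j != i])
        (z 0 (lshift 1 j) - P 0 (lshift 1 j)) ^+ al j) _
      (\prod_(j <- [seq j <- index_enum 'I_k | j != i]) r' ^+ al j)).
    + by move=> z _; rewrite /rest big_filter.
    + apply: ler_prod => j _; have r'g := ltW r'0.
      by rewrite exprn_ge0 //= lerXn2r ?nnegrE // ltW.
    + apply: rep_big_mul => [|j]; first exact: ltW.
      by apply: rep_exp; [exact: ltW|apply: rep_coord; exact: ltW].
  - apply: (@rep_ext _ _ _ _ (geo (al i)) _ (\sum_(l < al i) r' ^+ ((al i).-1 - l) * r' ^+ l)) => //.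
      exact: half_pow_bound.
    apply: rep_big_add => [|l]; first exact: ltW.
    apply: rep_mul; first exact: ltW.
      by apply: rep_exp; [exact: ltW|apply: rep_coord; exact: ltW].
    by apply: rep_exp; [exact: ltW|apply: rep_coord; exact: ltW].
have mM : (asum m <= (2 / r * M)%:E)%E.
  have c0 : 0 <= 2 / r by rewrite divr_ge0 // ltW.
  by rewrite asumZ ger0_norm // [leRHS]EFinM; apply: lee_pmul; rewrite // asum_ge0.
exists (fun z => tsum (fun al => Kal al z)); split.
  apply/analytic_atP; exists r', (2 / r * M); split=> //.
  by apply: (rep_sum repK mM).
exists r'; split=> // x s xr sr.
have xr1 : `|x - p| <= r by apply: le_trans r'r; exact: ltW.
have ur1 : `|upd x i s - p| <= r.
  apply/rV_normP => [|j]; first exact: ltW.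
  rewrite !mxE; case: eqP => [->|_]; first by apply: le_trans r'r; exact: ltW.
  by apply: le_trans xr1; have := rV_norm_ge (x - p) j; rewrite !mxE.
have zr : `|row_mx x s%:M - P| <= r'.
  apply/rV_normP => [|j]; first exact: ltW.
  rewrite /P; case: (splitP j) => j' jE.
    have -> : j = lshift 1 j' by apply: val_inj.
    rewrite !mxE !(unsplitK (inl _ j')).
    by have := le_trans (rV_norm_ge (x - p) j') (ltW xr); rewrite !mxE.
  have -> : j = rshift k j' by apply: val_inj.
  rewrite !mxE !(unsplitK (inr _ j')) !mxE !ord1 eqxx.
  exact: ltW.
have sx : (asum (fun al => a al * monom (x - p) al)%R < +oo)%E.
  exact: le_lt_trans (rep_asum a xr1) (asum_lt aM).
have su : (asum (fun al => a al * monom (upd x i s - p) al)%R < +oo)%E.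
  exact: le_lt_trans (rep_asum a ur1) (asum_lt aM).
have sK : (asum (fun al => Kal al (row_mx x s%:M)) < +oo)%E.
  apply: le_lt_trans (asum_lt mM); apply: le_asum => al.
  exact: rep_bound (repK al) zr.
have s1 : (asum (fun al => -1 * (a al * monom (upd x i s - p) al))%R < +oo)%E.
  by rewrite asumZ -(fineK (asum_fin su)) -EFinM ltry.
rewrite (fE _ xr1) (fE _ ur1) -[in LHS]mulN1r -(tsumZ _ su) -(tsumD sx s1) -(tsumZ _ sK).
apply: eq_tsum => al; rewrite /Kal /rest /geo /P.
rewrite (eq_bigr (fun j => (x 0 j - p 0 j) ^+ al j)); last first.
  by move=> j ji; rewrite !row_mxEl.
set Pr := \prod_(j < k | _) _.
have mE (y : 'rV[R]_k) : (forall j, j != i -> y 0 j = x 0 j) ->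
    monom (y - p) al = (y 0 i - p 0 i) ^+ al i * Pr.
  move=> yx; rewrite /monom (bigD1 i) //= !mxE; congr (_ * _).
  by apply: eq_bigr => j ji; rewrite !mxE yx.
rewrite !mE //; last by move=> j ji; rewrite mxE (negbTE ji).
rewrite (_ : upd x i s 0 i = s); last by rewrite mxE eqxx.
have := subrXX (x 0 i - p 0 i) (s - p 0 i) (al i).
rewrite opprB addrA subrK => E.
transitivity (a al * Pr * ((x 0 i - p 0 i) ^+ al i - (s - p 0 i) ^+ al i)); first by ring.
rewrite E; set S1 := \sum_(j < _) _.
suff <- : \sum_(l < al i)
    (row_mx x s%:M 0 (lshift 1 i) - row_mx p (p 0 i)%:M 0 (lshift 1 i)) ^+ ((al i).-1 - l) *
    (row_mx x s%:M 0 (rshift k 0) - row_mx p (p 0 i)%:M 0 (rshift k 0)) ^+ l = S1.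
  by rewrite !row_mxEl; ring.
apply: eq_bigr => l _; rewrite !row_mxEl !row_mxEr !mxE eqxx !mulr1n.
by rewrite -subn1 subnAC subn1.
Qed.

End Slopes.

(** * The identity theorem on an interval *)

Section IdentityTheorem.
Context {R : realType}.

(** If some coefficient is nonzero, take one of least degree n. Vanishing at distance h to the left
    of p bounds it by a constant times h, and h is arbitrarily small. One side suffices because a
    curve is controlled only at earlier times. *)
Lemma analytic_left_zero (f : 'rV[R]_1 -> R) (p : 'rV[R]_1) (d : R) : analytic_at f p -> 0 < d ->
  (forall x : 'rV[R]_1, p 0 0 - d < x 0 0 < p 0 0 -> f x = 0) -> \forall x \near p, f x = 0.
Proof.
move=> /analytic_atP[r [M [r0 [a [aM fE]]]]] d0 f0.
have M0 : 0 <= M by rewrite -lee_fin (le_trans _ aM) // asum_ge0.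
have [a0|[al1 al1n]] : (forall al, a al = 0) \/ exists al, a al != 0.
  case: (pselect (exists al, a al != 0)); [by right|move=> h; left=> al].
  by apply/eqP/negPn/negP => al0; apply: h; exists al.
  apply/near_normP; exists r => // x xr; rewrite fE ?ltW //.
  rewrite (_ : (fun al => _) = (fun=> 0)); last by apply/funext => al; rewrite a0 mul0r.
  by rewrite tsum_ge0 // esum1.
exfalso; have exn : exists n, `[< exists2 al, mdeg al = n & a al != 0 >].
  by exists (mdeg al1); apply/asboolP; exists al1.
have [n /asboolP[al aln ala] nmin] := ex_minnP exn.
have amin be : (mdeg be < n)%N -> a be = 0.
  move=> bn; apply/eqP/negPn/negP => abe; 
  suff /nmin : `[< exists2 al, mdeg al = mdeg be & a al != 0 >] by rewrite leqNgt bn.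
  by apply/asboolP; exists be.
have mdE (be : {ffun 'I_1 -> nat}) : mdeg be = be 0 by rewrite /mdeg big_ord1.
have aleq be : mdeg be = n -> be = al.
  move=> bn; apply/ffunP => j; rewrite ord1 -(mdE be) -(mdE al); congruence.
have key h : 0 < h -> h < d -> h <= r -> `|a al| <= h * (M / r ^+ n.+1).
  move=> h0 hd hr; pose x : 'rV[R]_1 := \row_j (p 0 0 - h).
  have xh : `|x - p| <= h.
    apply/rV_normP; first exact: ltW.
    by move=> j; rewrite ord1 !mxE addrAC subrr add0r normrN gtr0_norm.
  have xr : `|x - p| <= r by exact: le_trans xh hr.
  have fx : f x = 0 by apply: f0; rewrite !mxE; lra.
  have mx be : `|monom (x - p) be| = h ^+ mdeg be.
    rewrite /monom big_ord1 normrX mdE; congr (_ ^+ _).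
    by rewrite !mxE addrAC subrr add0r normrN gtr0_norm.
  pose b be := if mdeg be == n then a be * monom (x - p) be else 0.
  pose c be := if (n < mdeg be)%N then a be * monom (x - p) be else 0.
  have sa : (asum (fun be => a be * monom (x - p) be)%R < +oo)%E.
    exact: le_lt_trans (rep_asum a xr) (asum_lt aM).
  have [bE bA] : tsum b = b al /\ asum b = `|b al|%:E.
    apply: tsum_single => be bal; rewrite /b; case: eqP => // bn.
    by rewrite (aleq _ bn) eqxx in bal.
  have hr0 : 0 <= (h / r) ^+ n.+1 by rewrite exprn_ge0 // divr_ge0 // ltW.
  (* Every term of degree above n gains at least the factor (h / r)^(n+1) over its majorant. *)
  have cA : (asum c <= ((h / r) ^+ n.+1 * M)%:E)%E.
    have : (asum (fun be => (h / r) ^+ n.+1 * (a be * r ^+ mdeg be))%R <=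
            ((h / r) ^+ n.+1 * M)%:E)%E.
      rewrite asumZ ger0_norm // [leRHS]EFinM.
      by apply: lee_pmul; rewrite // asum_ge0.
    apply: le_trans; apply: le_asum => be; rewrite /c.
    case: ltnP => nb; last by rewrite normr0.
    have [hge rge] := (ltW h0, ltW r0).
    rewrite !normrM mx mulrCA ler_wpM2l // (ger0_norm hr0) ger0_norm ?exprn_ge0 //.
    rewrite -(subnKC nb) !exprD mulrA -exprMn divfK ?gt_eqF //.
    by rewrite ler_wpM2l ?exprn_ge0 // lerXn2r ?nnegrE.
  have E : f x = tsum b + tsum c.
    rewrite fE // -tsumD ?bA ?ltry // ?(asum_lt cA) //.
    apply: eq_tsum => be; rewrite /b /c; case: (ltngtP n (mdeg be)) => nb.
    - by rewrite add0r.
    - by rewrite (amin _ nb) mul0r addr0.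
    - by rewrite addr0.
  have : `|b al| <= (h / r) ^+ n.+1 * M.
    have -> : b al = - tsum c by apply/eqP; rewrite -addr_eq0 -bE -E fx.
    by rewrite normrN -lee_fin (le_trans (tsum_le_asum (asum_lt cA))).
  rewrite /b aln eqxx normrM mx aln expr_div_n exprS => le1.
  have hn : 0 < h ^+ n by rewrite exprn_gt0.
  rewrite -(ler_pM2r hn) (le_trans le1) // le_eqVlt; apply/orP; left; apply/eqP.
  by field; rewrite gt_eqF // exprn_gt0.
have A0 : 0 < `|a al| by rewrite normr_gt0.
pose C := M / r ^+ n.+1; have C0 : 0 <= C by rewrite divr_ge0 // exprn_ge0 // ltW.
pose h := Num.min (Num.min (d / 2) r) (`|a al| / (2 * (C + 1))).
have C1 : 0 < 2 * (C + 1) by lra.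
have h0 : 0 < h by rewrite !lt_min r0 !divr_gt0.
have hd : h < d.
  apply: (@le_lt_trans _ _ (d / 2)); last by lra.
  by rewrite /h !ge_min lexx.
have hr : h <= r by rewrite /h !ge_min lexx orbT.
have ha : h <= `|a al| / (2 * (C + 1)) by rewrite /h !ge_min lexx orbT.
have := key h h0 hd hr; rewrite -/C.
have : h * C <= `|a al| / (2 * (C + 1)) * C by rewrite ler_wpM2r.
have -> : `|a al| / (2 * (C + 1)) * C = `|a al| * (C / (2 * (C + 1))) by ring.
have : C / (2 * (C + 1)) < 1 by rewrite ltr_pdivrMr //; lra.
move=> c1; have : `|a al| * (C / (2 * (C + 1))) < `|a al| by rewrite gtr_pMr.
by lra.
Qed.

Lemma zero_set_complete n (f : 'rV[R]_n -> R) :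
  (forall p, analytic_at f p) -> (exists p, f p = 0) ->
  analytically_complete [set p | f p = 0].
Proof.
move=> fA [p0 p00]; split; first by exists p0.
move=> gam gA [eps /[!in_itv]/= /andP[e0 e1] ge].
(* The times before which the curve has stayed in the zero set. The supremum cannot be below 1,
   since vanishing to its left spreads to a full neighbourhood. *)
pose Z := [set s : R | 0 <= s <= 1 /\ forall t, 0 <= t < s -> f (gam t) = 0].
have Ze : Z eps.
  split; first by rewrite !ltW.
  by move=> t /andP[t0 te]; apply: ge; exists t => //=; rewrite in_itv /= t0 te.
have Zs : has_sup Z by split; [exists eps|exists 1 => s [/andP[]]].
pose s0 := sup Z.
have es0 : eps <= s0 by apply: ub_le_sup => //; case: Zs.
have s01 : s0 <= 1 by apply: ge_sup; [exists eps|move=> s [/andP[]]].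
have zs0 t : 0 <= t < s0 -> f (gam t) = 0.
  move=> /andP[t0 ts]; have st : 0 < s0 - t by rewrite subr_gt0.
  have [s [_ sz] ts'] := sup_adherent st Zs.
  by apply: sz; rewrite t0 /=; move: ts'; rewrite subKr.
pose P : 'rV[R]_1 := \row_j s0.
have AP : [set s : 'rV[R]_1 | s 0 0 \in `[0, 1]] P.
  by rewrite /= in_itv /= mxE s01 (le_trans (ltW e0) es0).
have [g [gan gnear]] := gA _ AP.
have hA : analytic_at (f \o g) P by apply: analytic_comp.
have [d d0 gd] := (near_normP _ _).1 gnear.
have row_near (t b : R) : 0 < b -> `|t - s0| < b -> `|(\row_j t : 'rV[R]_1) - P| < b.
  move=> b0 tb; apply/rV_norm_ltP => // j; by rewrite !mxE.
have geq t : 0 <= t <= 1 -> `|t - s0| < d -> f (gam t) = (f \o g) (\row_j t).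
  move=> t01 td; have := gd _ (row_near _ _ d0 td) .
  by rewrite /= in_itv /= !mxE => /(_ t01) ->.
(* As [eps <= s0], the interval of length [d'] left of [s0] stays in [0, 1], where [gam] agrees with
   its local analytic extension [g]. *)
pose d' := Num.min d eps.
have d'0 : 0 < d' by rewrite lt_min d0.
have lz (x : 'rV[R]_1) : P 0 0 - d' < x 0 0 < P 0 0 -> (f \o g) x = 0.
  rewrite mxE => /andP[x1 x2].
  have d'e : d' <= eps by rewrite ge_min lexx orbT.
  have d'd : d' <= d by rewrite ge_min lexx.
  have -> : (f \o g) x = (f \o g) (\row_j (x 0 0)).
    by congr ((f \o g) _); apply/rowP => j; rewrite mxE ord1.
  by rewrite -geq; [apply: zs0; lra|lra|rewrite ltr_norml; lra].
have [d2 d20 fz] := (near_normP _ _).1 (analytic_left_zero hA d'0 lz).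
have zz t : 0 <= t <= 1 -> t < s0 + Num.min d d2 -> f (gam t) = 0.
  move=> t01 ts; have [|ts0] := ltP t s0; first by move=> h; apply: zs0; lra.
  have dd : Num.min d d2 <= d by rewrite ge_min lexx.
  have dd2 : Num.min d d2 <= d2 by rewrite ge_min lexx orbT.
  rewrite geq //; last by rewrite ltr_norml; lra.
  by apply: fz; apply: row_near => //; rewrite ltr_norml; lra.
have md0 : 0 < Num.min d d2 by rewrite lt_min d0.
have s0e : s0 = 1.
  apply/eqP; rewrite eq_le s01 /= leNgt; apply/negP => s1.
  pose s2 := Num.min 1 (s0 + Num.min d d2).
  have s2s : s0 < s2 by rewrite lt_min s1 /=; lra.
  have s21 : s2 <= 1 by rewrite ge_min lexx.
  have s2d : s2 <= s0 + Num.min d d2 by rewrite ge_min lexx orbT.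
  suff : Z s2 by move=> /(ub_le_sup Zs.2); rewrite leNgt s2s.
  split; first by lra.
  by move=> t ht; apply: zz; lra.
by move=> _ [t + <-]; rewrite /= in_itv /= => t01; apply: zz => //; lra.
Qed.

End IdentityTheorem.

(** * Analytic lifts and DC-structures *)

Section AnalyticOn.
Context {R : realType}.

Lemma withinP (T Y : topologicalType) (A : set T) (f : T -> Y) :
  {within A, continuous f} <-> forall x, A x -> forall V, nbhs (f x) V ->
    \forall y \near x, A y -> V (f y).
Proof.
split=> [/subspace_continuousP h x Ax V Vf|h].
  by have := h x Ax V Vf; rewrite nbhs_simpl /= /within /=.
by apply/subspace_continuousP => x Ax V Vf; exact: h.
Qed.

Lemma analytic_on_at k l (A : set 'rV[R]_k) (f : 'rV[R]_k -> 'rV[R]_l) :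
  (forall p, A p -> forall j, analytic_at (fun x => f x 0 j) p) -> analytic_on A f.
Proof. by move=> fA p Ap; exists f; split; [exact: fA|near=> x]. Unshelve. all: by end_near. Qed.

Lemma analytic_on_subset k l (A B : set 'rV[R]_k) (f : 'rV[R]_k -> 'rV[R]_l) :
  A `<=` B -> analytic_on B f -> analytic_on A f.
Proof.
move=> AB fB p Ap; have [g [gA gf]] := fB p (AB p Ap); exists g; split=> //.
by apply: filterS gf => x h /AB.
Qed.

Lemma analytic_on_local k l (A : set 'rV[R]_k) (f : 'rV[R]_k -> 'rV[R]_l) :
  (forall p, A p -> exists N g, [/\ nbhs p N, analytic_on (A `&` N) g &
     forall x, A x -> N x -> f x = g x]) -> analytic_on A f.
Proof.
move=> h p Ap; have [N [g [Np gA fg]]] := h p Ap.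
have [g' [g'A gg']] := gA p (conj Ap (nbhs_singleton Np)); exists g'; split=> //.
near=> x => Ax; have Nx : N x by near: x.
rewrite fg //; move: (conj Ax Nx : (A `&` N) x).
by near: x.
Unshelve. all: by end_near. Qed.

Lemma rV_continuous (T : topologicalType) l (g : T -> 'rV[R]_l) (p : T) :
  (forall j, (fun x => g x 0 j) @ p --> g p 0 j) -> g @ p --> g p.
Proof.
move=> h; apply/cvgrPdist_lt => e e0.
have : \forall x \near p, forall j, j \in enum 'I_l -> `|g p 0 j - g x 0 j| < e.
  elim: (enum 'I_l) => [|j s IH]; first by near=> x.
  have /cvgrPdist_lt /(_ e e0) hj := h j.
  by near=> x => j'; rewrite inE => /orP[/eqP ->|js]; [near: x|move: j' js; near: x].
apply: filterS => x hx; apply/rV_norm_ltP => // j; rewrite !mxE.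
by apply: hx; rewrite mem_enum.
Unshelve. all: by end_near. Qed.

Lemma analytic_on_continuous k l (A : set 'rV[R]_k) (f : 'rV[R]_k -> 'rV[R]_l) :
  analytic_on A f -> forall p, A p -> forall V, nbhs (f p) V ->
    \forall x \near p, A x -> V (f x).
Proof.
move=> fA p Ap V Vf; have [g [gA gf]] := fA p Ap.
have gp : f p = g p by have := nbhs_singleton gf; apply.
have gc : g @ p --> g p.
  by apply: rV_continuous => j; exact: analytic_continuous.
have gV : \forall x \near p, V (g x) by apply: gc; rewrite -gp.
by near=> x => Ax; rewrite (near gf x) //; near: x.
Unshelve. all: by end_near. Qed.

Lemma analytic_on_comp k l m (A : set 'rV[R]_k) (B : set 'rV[R]_l)
    (f : 'rV[R]_k -> 'rV[R]_l) (g : 'rV[R]_l -> 'rV[R]_m) :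
  analytic_on A f -> analytic_on B g -> (forall x, A x -> B (f x)) ->
  analytic_on A (g \o f).
Proof.
move=> fA gB AB p Ap; have [f' [f'A ff']] := fA p Ap.
have [g' [g'A gg']] := gB _ (AB p Ap).
have fp : f p = f' p by have := nbhs_singleton ff'; apply.
exists (g' \o f'); split=> [j|].
  by apply: (@analytic_comp _ _ _ (fun y => g' y 0 j) f') => //; rewrite -fp.
have := analytic_on_continuous fA Ap gg'.
move=> h; near=> x => Ax; rewrite /= -(near ff' x) // (near h x) //.
exact: AB.
Unshelve. all: by end_near. Qed.

Lemma analytic_diffeo_sym k l (A : set 'rV[R]_k) f (B : set 'rV[R]_l) :
  analytic_diffeo A f B -> exists g, [/\ analytic_diffeo B g A,
    (forall x, A x -> g (f x) = x) & (forall y, B y -> f (g y) = y)].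
Proof.
move=> [[fAB finj fsurj] fA [g [gf gB]]].
have fg y : B y -> f (g y) = y by move=> /fsurj[x Ax <-]; rewrite gf.
exists g; split=> //; split=> //; last by exists f.
split.
- by move=> y /fsurj[x Ax <-]; rewrite gf.
- move=> y y' /set_mem By /set_mem By' e.
  by rewrite -(fg y) // e fg.
- by move=> x Ax; exists (f x); [exact: fAB|rewrite gf].
Qed.

Lemma analytic_diffeo_of k l (A : set 'rV[R]_k) (B : set 'rV[R]_l) f g :
  analytic_on A f -> analytic_on B g -> (forall x, A x -> B (f x)) ->
  (forall y, B y -> A (g y)) -> (forall x, A x -> g (f x) = x) ->
  (forall y, B y -> f (g y) = y) -> analytic_diffeo A f B.
Proof.
move=> fA gB AB BA gf fg; split=> //; last by exists g.
split=> [x|x x' /set_mem Ax /set_mem Ax' e|y By]; first exact: AB.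
  by rewrite -(gf x) // e gf.
by exists (g y); [exact: BA|exact: fg].
Qed.

End AnalyticOn.

(** * Gluing of local lifts and compatibility through a cover *)

Section Gluing.
Context {R : realType} {X : topologicalType}.
Hypothesis X2 : hausdorff_space X.

(* An inverse DC-coordinate system is injective except over at most one point,
   the DC-point, over which it collapses a sphere. *)
Definition inj_off k (Q : @local_param R k X) (Z : set X) :=
  (forall z z', Z z -> Z z' -> z = z') /\
  forall b b', lp_dom Q b -> lp_dom Q b' -> Q b = Q b' -> b = b' \/ Z (Q b).

(** What gluing has to know of a chart. The last clause says that points alone over their image are
    dense in the domain; [lifts_inverse] rests on it. *)
Definition tame_param k (Q : @local_param R k X) :=
  [/\ {within lp_dom Q, continuous Q}, open (lp_img Q), exists Z, inj_off Q Z &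
      forall a W, lp_dom Q a -> nbhs a W -> exists a', [/\ lp_dom Q a', W a' &
        forall b, lp_dom Q b -> Q b = Q a' -> b = a']].

Lemma near_neq (z x : X) : z <> x -> nbhs x [set y | y <> z].
Proof.
move=> zx; have : open (~` [set z]).
  by apply: closed_openC; apply: accessible_closed_set1; exact: hausdorff_accessible.
by move=> o; apply: open_nbhs_nbhs; split=> //= /esym.
Qed.

(* Two lifts through Q can only disagree over the exceptional point, so the lift
   chosen at psi p serves on a whole neighbourhood of p. *)
Lemma lift_glue k l (D : set 'rV[R]_k) (psi : 'rV[R]_k -> X) (Q : @local_param R l X) :
  {within D, continuous psi} -> (exists Z, inj_off Q Z) ->
  (forall a, D a -> exists V F, [/\ nbhs (psi a) V,
     analytic_on (D `&` psi @^-1` V) F &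
     forall b, D b -> V (psi b) -> lp_dom Q (F b) /\ Q (F b) = psi b]) ->
  exists F, analytic_on D F /\ forall a, D a -> lp_dom Q (F a) /\ Q (F a) = psi a.
Proof.
move=> /withinP pc [Z [Z1 Qinj]] loc.
(* The local lift is chosen for each point of [X], not for each point of [D], so that all points
   over the exceptional point use one and the same lift. *)
have /choice[L LP] : forall x, exists VF : set X * ('rV[R]_k -> 'rV[R]_l),
    (exists2 a, D a & psi a = x) -> [/\ nbhs x VF.1,
     analytic_on (D `&` psi @^-1` VF.1) VF.2 &
     forall b, D b -> VF.1 (psi b) -> lp_dom Q (VF.2 b) /\ Q (VF.2 b) = psi b].
  move=> x; case: (pselect (exists2 a, D a & psi a = x)) => [[a Da <-]|n].
    by have [V [F h]] := loc a Da; exists (V, F).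
  by exists (setT, fun=> 0) => /n.
pose F a := (L (psi a)).2 a.
have FP a : D a -> lp_dom Q (F a) /\ Q (F a) = psi a.
  move=> Da; have [|nV _ h] := LP (psi a); first by exists a.
  by apply: h => //; exact: nbhs_singleton.
exists F; split=> //; apply: analytic_on_local => p Dp.
have [|nV FA h] := LP (psi p); first by exists p.
(* The exceptional point is removed from the neighbourhood, unless it is [psi p] itself. *)
pose W := (L (psi p)).1 `&` [set x | x = psi p \/ ~ Z x].
have nW : nbhs (psi p) W.
  apply: filterI => //; case: (pselect (exists2 z, Z z & z <> psi p)) => [[z Zz zp]|n].
    apply: filterS (near_neq zp) => y yz; right => Zy; apply: yz; exact: Z1.
  apply: filterS filterT => y _; case: (pselect (Z y)) => Zy; [left|by right].
  by apply: contrapT => yp; apply: n; exists y.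
exists [set a | D a -> W (psi a)], (L (psi p)).2; split.
- exact: pc.
- apply: analytic_on_subset FA => a [Da /(_ Da) [? _]]; by split.
- move=> a Da /(_ Da)[Va [e|nZ]]; first by rewrite /F e.
  have [d1 q1] := FP a Da; have [d2 q2] := h a Da Va.
  by case: (Qinj (F a) ((L (psi p)).2 a)) => //; rewrite ?q1 ?q2.
Qed.

(** For injective [Q] the lift is unique point by point, so neighbourhoods in the source will do;
    [lift_glue] asks for neighbourhoods in [X]. *)
Lemma lift_glue_inj k l (D : set 'rV[R]_k) (psi : 'rV[R]_k -> X) (Q : @local_param R l X) :
  (forall b b', lp_dom Q b -> lp_dom Q b' -> Q b = Q b' -> b = b') ->
  (forall a, D a -> exists N F, [/\ nbhs a N, analytic_on (D `&` N) F &
     forall b, D b -> N b -> lp_dom Q (F b) /\ Q (F b) = psi b]) ->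
  exists F, analytic_on D F /\ forall a, D a -> lp_dom Q (F a) /\ Q (F a) = psi a.
Proof.
move=> Qinj loc.
have /choice[F FP] : forall a, exists b, D a -> lp_dom Q b /\ Q b = psi a.
  move=> a; case: (pselect (D a)) => Da; last by exists 0.
  by have [N [F [nN _ h]]] := loc a Da; exists (F a) => _; apply: h => //; exact: nbhs_singleton.
exists F; split=> //; apply: analytic_on_local => p Dp.
have [N [G [nN GA h]]] := loc p Dp; exists N, G; split=> // a Da Na.
have [d1 q1] := FP a Da; have [d2 q2] := h a Da Na.
by apply: Qinj => //; rewrite q1 q2.
Qed.

Lemma compatible_sym k l (P : @local_param R k X) (Q : @local_param R l X) :
  compatible P Q -> compatible Q P.
Proof.
move=> [g [gd gE]]; have [h [hd hg gh]] := analytic_diffeo_sym gd.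
exists h; split=> // b Db; rewrite -[in RHS](gh b Db) gE //.
by have [[hE _ _] _ _] := hd; exact: hE.
Qed.

Lemma compatible_disjoint k l (P : @local_param R k X) (Q : @local_param R l X) :
  ~ (lp_img P `&` lp_img Q !=set0) -> compatible P Q.
Proof.
move=> n; have e1 : lp_dom P `&` P @^-1` lp_img Q = set0.
  apply/seteqP; split=> // a [Pa Qa]; apply: n; exists (P a); split=> //.
  by exists a.
have e2 : lp_dom Q `&` Q @^-1` lp_img P = set0.
  apply/seteqP; split=> // a [Pa Qa]; apply: n; exists (Q a); split=> //.
  by exists a.
exists (fun=> 0); rewrite e1 e2; split=> //.
by apply: (@analytic_diffeo_of _ _ _ _ _ _ (fun=> 0)).
Qed.

Lemma tame_preimage_near k l (P : @local_param R k X) (Q : @local_param R l X) a :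
  tame_param P -> open (lp_img Q) -> lp_dom P a -> lp_img Q (P a) ->
  \forall a' \near a, lp_dom P a' -> lp_img Q (P a').
Proof.
move=> [/withinP Pc _ _ _] oQ Pa Qa; apply: Pc => //.
by apply: open_nbhs_nbhs; split.
Qed.

(** F' o F lifts [P] through itself, so it fixes every point that is alone over its image. Such
    points are dense, and continuity in a Hausdorff space extends the identity to all of D. *)
Lemma lifts_inverse k l (P : @local_param R k X) (Q : @local_param R l X) F F' :
  let D := lp_dom P `&` P @^-1` lp_img Q in
  let D' := lp_dom Q `&` Q @^-1` lp_img P in
  tame_param P -> open (lp_img Q) -> analytic_on D F -> analytic_on D' F' ->
  (forall a, D a -> lp_dom Q (F a) /\ Q (F a) = P a) ->
  (forall b, D' b -> lp_dom P (F' b) /\ P (F' b) = Q b) ->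
  forall a, D a -> F' (F a) = a.
Proof.
move=> D D' tP oQ FA FA' FE FE' a Da.
have DD' a' : D a' -> D' (F a').
  move=> Da'; have [d1 q1] := FE a' Da'; split=> //; rewrite /preimage /= q1.
  by exists a' => //; case: Da'.
apply: (@norm_hausdorff _ 'rV[R]_k) => V W nV nW.
have cF : \forall x \near a, D x -> V (F' (F x)).
  by have := analytic_on_continuous (analytic_on_comp FA FA' DD') Da; apply.
have nD : \forall x \near a, lp_dom P x -> D x.
  by case: Da => Pa Qa; have := tame_preimage_near tP oQ Pa Qa; apply: filterS => x h Px; split=> //; exact: h.
have [_ _ _ dens] := tP.
have [a' [Pa' [[/(_ Pa') Da' Va'] Wa'] inj]] := dens a _ Da.1 (filterI (filterI nD cF) nW).
exists a'; split=> //.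
have [d1 q1] := FE a' Da'; have [d2 q2] := FE' _ (DD' a' Da').
by rewrite -[X in V X](inj _ d2) ?q2 //; exact: Va'.
Qed.

Lemma compatible_of_lifts k l (P : @local_param R k X) (Q : @local_param R l X) F F' :
  let D := lp_dom P `&` P @^-1` lp_img Q in
  let D' := lp_dom Q `&` Q @^-1` lp_img P in
  tame_param P -> tame_param Q -> analytic_on D F -> analytic_on D' F' ->
  (forall a, D a -> lp_dom Q (F a) /\ Q (F a) = P a) ->
  (forall b, D' b -> lp_dom P (F' b) /\ P (F' b) = Q b) -> compatible P Q.
Proof.
move=> D D' tP tQ FA FA' FE FE'.
have DD' a' : D a' -> D' (F a').
  move=> Da'; have [d1 q1] := FE a' Da'; split=> //; rewrite /preimage /= q1.
  by exists a' => //; case: Da'.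
have D'D a' : D' a' -> D (F' a').
  move=> Da'; have [d1 q1] := FE' a' Da'; split=> //; rewrite /preimage /= q1.
  by exists a' => //; case: Da'.
exists F; split=> [|a Da]; last by case: (FE a Da).
apply: (analytic_diffeo_of FA FA') => //.
  by apply: lifts_inverse => //; case: tQ.
by apply: lifts_inverse => //; case: tP.
Qed.

(** Over the image of each chart of the cover the two transition maps compose to a lift; the pieces
    are glued by [lift_glue]. This is the source of transitivity of compatibility. *)
Lemma lift_through k l m (P : @local_param R k X) (Q : @local_param R l X)
    (C : set (@local_param R m X)) :
  tame_param P -> tame_param Q ->
  (forall x, exists2 S, C S & lp_img S x) ->
  (forall S, C S -> [/\ open (lp_img S), compatible P S & compatible S Q]) ->
  exists F, analytic_on (lp_dom P `&` P @^-1` lp_img Q) F /\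
    forall a, (lp_dom P `&` P @^-1` lp_img Q) a -> lp_dom Q (F a) /\ Q (F a) = P a.
Proof.
move=> tP tQ cov cC; apply: lift_glue.
- have [/withinP Pc _ _ _] := tP; apply/withinP => a [Pa Qa] V nV.
  by apply: filterS (Pc a Pa V nV) => x h [/h].
- by case: tQ.
move=> a [Pa Qa]; have [S CS Sa] := cov (P a).
have [oS [g [gd gE]] [h [hd hE]]] := cC S CS.
have [[gB _ _] gA _] := gd; have [[hB _ _] hA _] := hd.
have gdom b : lp_dom P b -> lp_img Q (P b) -> lp_img S (P b) ->
    (lp_dom S `&` S @^-1` lp_img Q) (g b).
  move=> Pb Qb Sb; have Db : (lp_dom P `&` P @^-1` lp_img S) b by [].
  by split; [case: (gB _ Db)|rewrite /preimage /= gE].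
exists (lp_img S), (h \o g); split.
- by apply: open_nbhs_nbhs; split.
- apply: (analytic_on_comp _ hA).
    by apply: analytic_on_subset gA => b [[? _] ?].
  by move=> b [[Pb Qb] Sb]; exact: gdom.
- move=> b [Pb Qb] Sb; have gb := gdom b Pb Qb Sb.
  by split=> /=; [case: (hB _ gb)|rewrite hE // gE].
Qed.

Lemma compatible_through k l m (P : @local_param R k X) (Q : @local_param R l X)
    (C : set (@local_param R m X)) :
  tame_param P -> tame_param Q ->
  (forall x, exists2 S, C S & lp_img S x) ->
  (forall S, C S -> [/\ open (lp_img S), compatible P S & compatible S Q]) ->
  compatible P Q.
Proof.
move=> tP tQ cov cC; have [F [FA FE]] := lift_through tP tQ cov cC.
have [|F' [FA' FE']] := lift_through tQ tP cov _; last exact: compatible_of_lifts FE FE'.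
by move=> S /cC[oS PS SQ]; split=> //; exact: compatible_sym.
Qed.

End Gluing.

(** * Coordinates on the cone and the cylinder in dimension two *)

Section Coordinates.
Context {R : realType}.

Definition e0 : 'I_3 := @Ordinal 3 0 isT.
Definition e1 : 'I_3 := @Ordinal 3 1 isT.
Definition e2 : 'I_3 := @Ordinal 3 2 isT.

Lemma I3P (P : 'I_3 -> Prop) : P e0 -> P e1 -> P e2 -> forall j, P j.
Proof.
move=> h0 h1 h2 [[|[|[|//]]] j3].
- by rewrite (_ : Ordinal j3 = e0) //; apply: val_inj.
- by rewrite (_ : Ordinal j3 = e1) //; apply: val_inj.
- by rewrite (_ : Ordinal j3 = e2) //; apply: val_inj.
Qed.

Lemma vec3E (t x y : R) :
  ((vec3 t x y 0 e0 = t) * (vec3 t x y 0 e1 = x) * (vec3 t x y 0 e2 = y))%type.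
Proof. by rewrite !mxE. Qed.

Lemma rV3P (a b : 'rV[R]_3) :
  a 0 e0 = b 0 e0 -> a 0 e1 = b 0 e1 -> a 0 e2 = b 0 e2 -> a = b.
Proof. by move=> h0 h1 h2; apply/rowP; apply: I3P. Qed.

Lemma sum3 (F : 'I_3 -> R) : \sum_i F i = F e0 + F e1 + F e2.
Proof.
rewrite !big_ord_recl big_ord0 addr0 addrA.
by congr (F _ + F _ + F _); apply: val_inj.
Qed.

Lemma axisE (a : 'rV[R]_(2 + 1)) : axis a = a 0 e2.
Proof. by rewrite /axis mxE; congr (a _ _); apply: val_inj. Qed.

Lemma lsub0 (a : 'rV[R]_(2 + 1)) : lsubmx a 0 0 = a 0 e0.
Proof. by rewrite mxE; congr (a _ _); apply: val_inj. Qed.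

Lemma lsub1 (a : 'rV[R]_(2 + 1)) : lsubmx a 0 1 = a 0 e1.
Proof. by rewrite mxE; congr (a _ _); apply: val_inj. Qed.

Lemma sum2 (F : 'I_2 -> R) : \sum_i F i = F 0 + F 1.
Proof.
by rewrite !big_ord_recl big_ord0 addr0; congr (F _ + F _); apply: val_inj.
Qed.

Lemma coneE (a : 'rV[R]_(2 + 1)) :
  cone 2 a <-> a 0 e0 ^+ 2 + a 0 e1 ^+ 2 = a 0 e2 ^+ 2.
Proof. by rewrite /cone /= sum2 lsub0 lsub1 axisE. Qed.

Lemma cylinderE (a : 'rV[R]_(2 + 1)) :
  cylinder 2 a <-> a 0 e0 ^+ 2 + a 0 e1 ^+ 2 = 1.
Proof. by rewrite /cylinder /= sum2 lsub0 lsub1. Qed.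

Lemma cone_projE (a : 'rV[R]_(2 + 1)) :
  cone_proj a = vec3 (a 0 e2 * a 0 e0) (a 0 e2 * a 0 e1) (a 0 e2).
Proof.
rewrite /cone_proj axisE; set A := a 0 e2 *: lsubmx a; set B := rsubmx a.
apply: rV3P; rewrite !vec3E.
- rewrite (_ : e0 = @lshift 2 1 0); last exact: val_inj.
  by apply: (etrans (row_mxEl A B 0 0)); rewrite /A !mxE.
- rewrite (_ : e1 = @lshift 2 1 1); last exact: val_inj.
  by apply: (etrans (row_mxEl A B 0 1)); rewrite /A !mxE.
- apply: (etrans (_ : _ = row_mx A B 0 (rshift 2 0))).
    by congr (row_mx A B _ _); apply: val_inj.
  apply: (etrans (row_mxEr A B 0 0)); rewrite /B mxE.
  by congr (a _ _); apply: val_inj.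
Qed.

Lemma cone_projP (a : 'rV[R]_(2 + 1)) : cylinder 2 a -> cone 2 (cone_proj a).
Proof.
by move=> /cylinderE h; apply/coneE; rewrite cone_projE !vec3E !exprMn -mulrDr h mulr1.
Qed.

Lemma cone_proj_inj (a b : 'rV[R]_(2 + 1)) : cone_proj a = cone_proj b ->
  a 0 e2 != 0 -> a = b.
Proof.
rewrite !cone_projE => e a0.
have h2 : a 0 e2 = b 0 e2 by have := congr1 (fun x : 'rV[R]_3 => x 0 e2) e; rewrite !vec3E.
apply: rV3P => //; apply: (mulfI a0).
  by have := congr1 (fun x : 'rV[R]_3 => x 0 e0) e; rewrite !vec3E -h2.
by have := congr1 (fun x : 'rV[R]_3 => x 0 e1) e; rewrite !vec3E -h2.
Qed.

Lemma cone_proj0 (a : 'rV[R]_(2 + 1)) : a 0 e2 = 0 -> cone_proj a = 0.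
Proof. by move=> h; rewrite cone_projE h !mul0r; apply: rV3P; rewrite vec3E mxE. Qed.

Lemma cone_vertex (x : 'rV[R]_(2 + 1)) : cone 2 x -> x 0 e2 = 0 -> x = 0.
Proof.
move=> /coneE h x2; rewrite x2 in h.
have [h0 h1] : x 0 e0 = 0 /\ x 0 e1 = 0.
  have := sqr_ge0 (x 0 e0); have := sqr_ge0 (x 0 e1) => p q.
  split; apply/eqP; rewrite -sqrf_eq0; apply/eqP; move: h; rewrite expr0n /=; lra.
by apply: rV3P; rewrite mxE.
Qed.

Lemma cone_proj_surj (x : 'rV[R]_(2 + 1)) : cone 2 x ->
  exists2 a, cylinder 2 a & cone_proj a = x.
Proof.
move=> cx; have [x2|x2] := eqVneq (x 0 e2) 0.
  exists (vec3 1 0 0); first by apply/cylinderE; rewrite !vec3E; ring.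
  by rewrite (cone_vertex cx x2) cone_proj0 // vec3E.
exists (vec3 (x 0 e0 / x 0 e2) (x 0 e1 / x 0 e2) (x 0 e2)).
  apply/cylinderE; rewrite !vec3E !expr_div_n -mulrDl.
  by move/coneE: cx => ->; rewrite divff // expf_neq0.
by rewrite cone_projE !vec3E; apply: rV3P; rewrite vec3E // mulrC divfK.
Qed.

Lemma analytic_vec3 k (f g h : 'rV[R]_k -> R) p :
  analytic_at f p -> analytic_at g p -> analytic_at h p ->
  forall j, analytic_at (fun x => vec3 (f x) (g x) (h x) 0 j) p.
Proof.
by move=> fA gA hA; apply: I3P; [move: fA|move: gA|move: hA];
  apply: analytic_near; near=> x; rewrite vec3E.
Unshelve. all: by end_near. Qed.

Lemma cone_proj_analytic p j : analytic_at (fun x : 'rV[R]_(2 + 1) => cone_proj x 0 j) p.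
Proof.
have := @analytic_vec3 _ (fun x : 'rV[R]_3 => x 0 e2 * x 0 e0)
  (fun x => x 0 e2 * x 0 e1) (fun x => x 0 e2) p.
move=> h; have {}h := h _ _ _ j; apply: analytic_near; last apply: h.
- by near=> x; rewrite cone_projE.
- by apply: analytic_mul; exact: analytic_coord.
- by apply: analytic_mul; exact: analytic_coord.
- exact: analytic_coord.
Unshelve. all: by end_near. Qed.

Lemma cone_proj_continuous : continuous (@cone_proj R 2).
Proof.
move=> p; apply: rV_continuous => j; apply: analytic_continuous.
exact: cone_proj_analytic.
Qed.

Lemma vec3_lim_axis (a b : R) (W : set 'rV[R]_3) : nbhs (vec3 a b 0) W ->
  exists2 t, t != 0 & W (vec3 a b t).
Proof.
move=> /near_normP[r r0 h]; exists (r / 2); first by rewrite gt_eqF // divr_gt0.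
apply: h; apply/rV_norm_ltP => //; apply: I3P; rewrite !mxE /= ?subrr ?normr0 //.
by rewrite subr0 gtr0_norm ?divr_gt0 //; lra.
Qed.

End Coordinates.

(** * DC-structures generated by a cover *)

Section DC.
Context {R : realType} {X : topologicalType}.
Notation dcp := (@local_param R (2 + 1) X).

Lemma inverse_dc_inj (P : dcp) : inverse_dc_coordinate P ->
  forall a b, lp_dom P a -> lp_dom P b -> P a = P b -> cone_proj a = cone_proj b.
Proof.
move=> [U [phi [oU [[fU phii _] _ _] _ dE PE]]] a b Pa Pb; rewrite !PE // => e.
by apply: phii => //; rewrite inE; move: Pa Pb; rewrite dE => -[_ ?] [_ ?].
Qed.

Lemma inverse_dc_dom (P : dcp) : inverse_dc_coordinate P ->
  exists W, open W /\ forall a, lp_dom P a <-> cylinder 2 a /\ W (cone_proj a).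
Proof.
move=> [U [phi [[W oW UE] _ _ dE _]]]; exists W; split=> // a; rewrite dE UE.
split=> [[ca [_ Wa]]|[ca Wa]]; split=> //; split=> //; exact: cone_projP.
Qed.

(** Off the circle of axis 0 the projection to the cone is injective, so the vertex gives the only
    exceptional point; a point of the circle is the limit of points (a, t) with t nonzero on the
    same line. *)
Lemma inverse_dc_tame (P : dcp) : inverse_dc_coordinate P -> tame_param P.
Proof.
move=> h; have inj := inverse_dc_inj h; have [W0 [oW0 dW]] := inverse_dc_dom h.
move: h => [U [phi [[W oW UE] [[fU phii _] phic _] [oI _] dE PE]]].
have dU a : lp_dom P a -> U (cone_proj a) by rewrite dE => -[].
have reg a b : lp_dom P a -> lp_dom P b -> P a = P b -> a 0 e2 != 0 -> a = b.
  by move=> Pa Pb /(inj _ _ Pa Pb); exact: cone_proj_inj.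
split.
- apply/withinP => a Pa V nV.
  have := (withinP _ _).1 phic _ (dU _ Pa) V; rewrite -PE // => /(_ nV) h.
  have h2 : \forall b \near a, U (cone_proj b) -> V (phi (cone_proj b)).
    exact: (@cone_proj_continuous R a _ h).
  near=> b => Pb; rewrite PE //; move: (dU _ Pb); near: b; exact: h2.
- rewrite (_ : lp_img P = phi @` U) //; apply/seteqP; split=> [_ [a Pa <-]|_ [x Ux <-]].
    by exists (cone_proj a); [exact: dU|rewrite PE].
  have [|a ca ax] := @cone_proj_surj _ x; first by move: Ux; rewrite UE => -[].
  by exists a; [rewrite dE; split=> //; rewrite /= ax|rewrite PE ?ax // dE; split=> //; rewrite /= ax].
- exists [set x | exists a, [/\ lp_dom P a, a 0 e2 = 0 & x = P a]]; split.
    move=> _ _ [a [Pa a0 ->]] [b [Pb b0 ->]]; rewrite !PE //.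
    by rewrite !cone_proj0.
  move=> a b Pa Pb e; have [a0|a0] := eqVneq (a 0 e2) 0.
    by right; exists a.
  by left; exact: reg.
- move=> a V Pa nV; have [a0|a0] := eqVneq (a 0 e2) 0; last first.
    exists a; split=> //; first exact: nbhs_singleton.
    by move=> b Pb /esym e; apply/esym; apply: reg.
  have [ca Wa] := (dW a).1 Pa.
  have nW : nbhs a (V `&` (@cone_proj R 2) @^-1` W0).
    apply: filterI => //; apply: cone_proj_continuous.
    by apply: open_nbhs_nbhs; split.
  have aE : a = vec3 (a 0 e0) (a 0 e1) 0 by apply: rV3P; rewrite vec3E.
  rewrite [in nbhs _ _]aE in nW; have [t t0 [Vt Wt]] := vec3_lim_axis nW.
  have Pt : lp_dom P (vec3 (a 0 e0) (a 0 e1) t).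
    apply/dW; split=> //; apply/cylinderE; rewrite !vec3E; exact/cylinderE.
  exists (vec3 (a 0 e0) (a 0 e1) t); split=> //.
  by move=> b Pb /esym e; apply/esym; apply: reg => //; rewrite vec3E.
Unshelve. all: by end_near. Qed.

Lemma inverse_dc_preimage_open (P : dcp) (V : set X) : inverse_dc_coordinate P ->
  open V -> rel_open (@cylinder R 2) (lp_dom P `&` P @^-1` V).
Proof.
move=> iP oV; have [W [oW dW]] := inverse_dc_dom iP.
have [/withinP Pc _ _ _] := inverse_dc_tame iP.
exists (\bigcup_(O in [set O | open O /\ forall a, lp_dom P a -> O a -> V (P a)]) O
   `&` (@cone_proj R 2) @^-1` W).
  apply: openI; first by apply: bigcup_open => O [].
  by apply: open_comp => // x _; exact: cone_proj_continuous.
apply/seteqP; split=> [a [Pa Va]|a [ca [[B [oO hO] Oa] Wa]]].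
  have [ca Wa] := (dW a).1 Pa; split=> //; split=> //.
  have : nbhs a [set b | lp_dom P b -> V (P b)].
    exact: Pc a Pa V (open_nbhs_nbhs (conj oV Va)).
  rewrite nbhsE => -[B [oO Oa] hO]; exists B => //; split=> // b Pb Ob.
  exact: hO.
have Pa : lp_dom P a by apply/dW.
by split=> //; exact: hO.
Qed.

Hypothesis X2 : hausdorff_space X.

(** [C] is the reference atlas, whose charts may start from another dimension, and [S] is a set of
    DC-charts of the structure that still covers [X]. A chart of a larger compatible family is
    compatible with [S], hence with [C] through [S], which gives maximality. [Ax] is a side
    condition that has to be inherited from [S]. *)
Lemma dc_manifold_of_cover l (C : set (@local_param R l X)) (S A : set dcp)
    (Ax : dcp -> Prop) :
  @second_countable X ->
  (forall Q, C Q -> tame_param Q) -> (forall x, exists2 Q, C Q & lp_img Q x) ->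
  (forall P, A P <-> [/\ inverse_dc_coordinate P, Ax P &
     forall Q, C Q -> compatible P Q]) ->
  S `<=` A -> (forall x, exists2 Q, S Q & lp_img Q x) ->
  (forall P, inverse_dc_coordinate P -> (forall Q, S Q -> compatible P Q) -> Ax P) ->
  dc_manifold A.
Proof.
move=> X1 tC covC AE SA covS hAx; split.
  split=> // x; have [Q /SA AQ [a Qa ax]] := covS x.
  have [[U [phi [oU hphi [op _] dE QE]]] _ _] := (AE Q).1 AQ.
  exists (phi @` U), U, phi; split=> //; apply: open_nbhs_nbhs; split=> //.
  by exists (cone_proj a); [move: Qa; rewrite dE => -[]|rewrite -QE].
have Adc P : A P -> inverse_dc_coordinate P by move=> /AE[].
split.
- split=> // P Q AP AQ _.
  apply: (compatible_through X2 (C := C)) => //; try exact/inverse_dc_tame/Adc.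
  move=> T CT; split; first by have [] := tC T CT.
    by case/AE: AP => _ _; apply.
  by apply: compatible_sym; case/AE: AQ => _ _; apply.
- by move=> x; have [Q /SA AQ Qx] := covS x; exists Q.
move=> B AB [Bdc Bc]; apply/seteqP; split=> // P BP.
have PS Q : S Q -> compatible P Q.
  move=> SQ; case: (pselect (lp_img P `&` lp_img Q !=set0)) => h.
    by apply: Bc => //; apply: AB; exact: SA.
  exact: compatible_disjoint.
apply/AE; split; [exact: Bdc|by apply: hAx => //; exact: Bdc|].
move=> Q CQ; apply: (compatible_through X2 (C := S)) => //.
- exact/inverse_dc_tame/Bdc.
- exact: tC.
move=> T ST; have AT := SA _ ST; split; last by case/AE: AT => _ _; apply.
  by have [] := inverse_dc_tame (Adc _ AT).
exact: PS.
Qed.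

(** If the axis vanished at a, then [P] would identify a with its antipode on the circle. A chart
    with nonzero axis is injective, so the transition map, itself injective, would force the two
    antipodes to coincide. *)
Lemma axis_neq0_transfer (P : dcp) (S : set dcp) : inverse_dc_coordinate P ->
  (forall x, exists2 Q, S Q & lp_img Q x) ->
  (forall Q, S Q -> inverse_dc_coordinate Q /\ forall a, lp_dom Q a -> axis a != 0) ->
  (forall Q, S Q -> compatible P Q) -> forall a, lp_dom P a -> axis a != 0.
Proof.
move=> iP cov hS PS a Pa; apply/eqP; rewrite axisE => a0.
have [Q SQ Qx] := cov (P a); have [iQ Qax] := hS Q SQ.
have [g [[[gB ginj _] _ _] gE]] := PS Q SQ.
have [W [oW dW]] := inverse_dc_dom iP; have [ca Wa] := (dW a).1 Pa.
pose a' : 'rV[R]_(2 + 1) := vec3 (- a 0 e0) (- a 0 e1) 0.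
have pa' : cone_proj a' = cone_proj a by rewrite !cone_proj0 // vec3E.
have Pa' : lp_dom P a'.
  apply/dW; rewrite pa'; split=> //; apply/cylinderE.
  by move/cylinderE: ca; rewrite !vec3E !sqrrN.
have PE : P a' = P a.
  move: iP => [U [phi [_ _ _ _ PE]]]; by rewrite !PE // pa'.
have Da : (lp_dom P `&` P @^-1` lp_img Q) a by [].
have Da' : (lp_dom P `&` P @^-1` lp_img Q) a' by split=> //; rewrite /preimage /= PE.
have e : g a = g a'.
  have [Ga _] := gB _ Da; have [Ga' _] := gB _ Da'.
  have := Qax _ Ga; rewrite axisE => n0; apply: cone_proj_inj n0.
  by apply: (inverse_dc_inj iQ) => //; rewrite !gE.
have aa' : a = a' by apply: ginj => //; exact/mem_set.
have h0 : a 0 e0 = 0 by have := congr1 (fun x : 'rV[R]_3 => x 0 e0) aa'; rewrite vec3E; lra.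
have h1 : a 0 e1 = 0 by have := congr1 (fun x : 'rV[R]_3 => x 0 e1) aa'; rewrite vec3E; lra.
by move/cylinderE: ca; rewrite h0 h1 expr0n /= addr0 => /eqP; rewrite eq_sym oner_eq0.
Qed.

End DC.

Section DCMap.
Context {R : realType} {X Y : topologicalType}.
Hypothesis Y2 : hausdorff_space Y.

(** Each lift is asked over the whole preimage of a chart of [Y], since [lift_glue] needs
    neighbourhoods in the target. Composed with the transition to [Q], the lifts become local lifts
    through [Q]. *)
Lemma dc_map_of_lifts (A : set (@local_param R (2 + 1) X))
    (B CY : set (@local_param R (2 + 1) Y)) (f : X -> Y) :
  continuous f ->
  A `<=` @inverse_dc_coordinate R 2 X -> B `<=` @inverse_dc_coordinate R 2 Y ->
  (forall Q S, B Q -> CY S -> compatible S Q /\ open (lp_img S)) ->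
  (forall P, A P -> forall x, exists T L, [/\ CY T, lp_img T (f x),
     analytic_on (lp_dom P `&` (f \o P) @^-1` lp_img T) L &
     forall b, lp_dom P b -> lp_img T (f (P b)) ->
       lp_dom T (L b) /\ T (L b) = f (P b)]) ->
  dc_map A B f.
Proof.
move=> fc AX BY cY loc P Q AP BQ D.
have iP := AX _ AP; have iQ := BY _ BQ.
have tP := inverse_dc_tame iP; have tQ := inverse_dc_tame iQ.
have oQ : open (lp_img Q) by case: tQ.
split.
  apply: inverse_dc_preimage_open => //; apply: open_comp => // x _; exact: fc.
have [F [FA FE]] : exists F, analytic_on D F /\
    forall a, D a -> lp_dom Q (F a) /\ Q (F a) = (f \o P) a.
  apply: (lift_glue Y2).
  - have [/withinP Pc _ _ _] := tP; apply/withinP => a [Pa _] V nV.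
    have := Pc a Pa (f @^-1` V) (fc _ _ nV).
    by apply: filterS => b h [/h].
  - by case: tQ.
  - move=> a [Pa Qa]; have [T [L [CT Tx LA LE]]] := loc P AP (P a).
    have [[h [[[hB _ _] hA _] hE]] oT] := cY Q T BQ CT.
    have Ldom b : D b -> lp_img T (f (P b)) -> (lp_dom T `&` T @^-1` lp_img Q) (L b).
      by move=> [Pb Qb] Tb; have [d1 q1] := LE b Pb Tb; split=> //; rewrite /preimage /= q1.
    exists (lp_img T), (h \o L); split.
    + by apply: open_nbhs_nbhs; split.
    + apply: (analytic_on_comp _ hA); last by move=> b [Db Tb]; exact: Ldom.
      by apply: analytic_on_subset LA => b [[]].
    + move=> b Db Tb; have Lb := Ldom b Db Tb; have [d1 q1] := LE b Db.1 Tb.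
      by split=> /=; [case: (hB _ Lb)|rewrite hE].
exists F; split=> //; last by move=> a Da; case: (FE a Da).
by move=> _ [a Da <-]; case: (FE a Da).
Qed.

End DCMap.

(** * Local diffeomorphisms mapping the cone into itself *)

Section ConeDiffeo.
Context {R : realType}.
Notation V3 := 'rV[R]_3.

Lemma analytic_on_open_at k l (A : set 'rV[R]_k) (f : 'rV[R]_k -> 'rV[R]_l) p :
  open A -> analytic_on A f -> A p -> forall j, analytic_at (fun x => f x 0 j) p.
Proof.
move=> oA fA Ap j; have [g [gA gf]] := fA p Ap.
apply: analytic_near (gA j); have nA : nbhs p A by apply: open_nbhs_nbhs.
by near=> x; rewrite (near gf x) //; near: x.
Unshelve. all: by end_near. Qed.

(** The substitute for differentiation: an identity between t f(t) and t g(t) is divided by t off 0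
    and then passed to the limit. *)
Lemma punctured_eq (f g : R -> R) : {for 0, continuous f} -> {for 0, continuous g} ->
  (\forall t \near 0, t != 0 -> f t = g t) -> f 0 = g 0.
Proof.
move=> fc gc fg; have fg' : f x @[x --> 0^'] --> f 0 by apply: cvg_trans fc; apply: cvg_app; exact: cvg_within.
have gg' : g x @[x --> 0^'] --> g 0 by apply: cvg_trans gc; apply: cvg_app; exact: cvg_within.
apply: (@cvg_unique _ (@Rhausdorff R) _ _ _ _ fg'); apply: cvg_trans gg'; apply: near_eq_cvg.
by rewrite near_withinE; near=> t => t0; rewrite (near fg t).
Unshelve. all: by end_near. Qed.

Definition quad (y : V3) : R := y 0 e0 ^+ 2 + y 0 e1 ^+ 2 - y 0 e2 ^+ 2.

Lemma quadE (y : 'rV[R]_(2 + 1)) : cone 2 y <-> quad y = 0.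
Proof. by rewrite coneE /quad; split=> [->|/eqP]; [rewrite subrr|rewrite subr_eq0 => /eqP]. Qed.

Lemma quadZ c y : quad (c *: y) = c ^+ 2 * quad y.
Proof. by rewrite /quad !mxE; ring. Qed.

(** A form of signature (2,1) has no totally isotropic plane: the combination of A and B with last
    coordinate 0 is isotropic in a plane where the form is definite. Isotropy of A + B makes the
    polar form of A and B vanish. *)
Lemma isotropic_dependent (A B : V3) : quad A = 0 -> quad B = 0 -> quad (A + B) = 0 ->
  exists al be, (al != 0) || (be != 0) /\ al *: A + be *: B = 0.
Proof.
move=> qA qB qAB.
have vz (V : V3) : quad V = 0 -> V 0 e2 = 0 -> V = 0.
  by move=> qV; apply: cone_vertex; exact/quadE.
have [A2|A2] := eqVneq (A 0 e2) 0.
  exists 1, 0; rewrite oner_eq0; split=> //.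
  by rewrite (vz A) // scaler0 scale0r addr0.
exists (B 0 e2), (- A 0 e2); rewrite oppr_eq0 A2 orbT; split=> //.
apply: vz; last by rewrite !mxE; ring.
move: qA qB qAB; rewrite /quad !mxE => qA qB qAB.
have qAB' : A 0 e0 * B 0 e0 + A 0 e1 * B 0 e1 - A 0 e2 * B 0 e2 = 0 by lra.
transitivity (B 0 e2 ^+ 2 * (A 0 e0 ^+ 2 + A 0 e1 ^+ 2 - A 0 e2 ^+ 2) +
  A 0 e2 ^+ 2 * (B 0 e0 ^+ 2 + B 0 e1 ^+ 2 - B 0 e2 ^+ 2) -
  2 * A 0 e2 * B 0 e2 * (A 0 e0 * B 0 e0 + A 0 e1 * B 0 e1 - A 0 e2 * B 0 e2)).
  by ring.
by rewrite qA qB qAB'; ring.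
Qed.

(** A germ of analytic diffeomorphism. A left inverse already makes the Jacobian, a square matrix,
    invertible. *)
Definition local_diffeo (p : V3) (H : V3 -> V3) :=
  exists K : V3 -> V3, [/\ forall j, analytic_at (fun x => H x 0 j) p,
    forall j, analytic_at (fun y => K y 0 j) (H p) & \forall x \near p, K (H x) = x].

Lemma line_cont0 k (p d : 'rV[R]_k) : {for 0, continuous (fun t : R => p + t *: d)}.
Proof.
apply: (@rV_continuous _ _ _ (fun t : R => p + t *: d)) => j.
rewrite (_ : (fun x : R => _) = (fun t => p 0 j + t * d 0 j)); last first.
  by apply/funext => t; rewrite !mxE.
by rewrite [X in _ --> X]mxE [X in _ + X]mxE; apply: cvgD; [exact: cvg_cst|apply: cvgM; [exact: cvg_id|exact: cvg_cst]].
Qed.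

Lemma line_continuous k (p d : 'rV[R]_k) (f : 'rV[R]_k -> R) : {for p, continuous f} ->
  {for 0, continuous (fun t : R => f (p + t *: d))}.
Proof.
move=> fc; apply: (@continuous_comp _ _ _ (fun t : R => p + t *: d) f).
  exact: line_cont0.
by rewrite scale0r addr0.
Qed.

Lemma line_continuous_ext k (p d : 'rV[R]_k) (F : 'rV[R]_k -> R) (f : R -> R) :
  (forall t, f t = F (p + t *: d)) -> {for p, continuous F} -> {for 0, continuous f}.
Proof. by move=> /funext ->; exact: line_continuous. Qed.

Lemma nbhs_comp0 (c : R -> V3) (p : V3) (P : set V3) : {for 0, continuous c} -> c 0 = p ->
  nbhs p P -> \forall t \near 0, P (c t).
Proof. by move=> cc c0 nP; apply: cc; rewrite c0. Qed.

Lemma line_near (p d : V3) (r : R) : 0 < r ->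
  \forall t \near 0, `|(p + t *: d) - p| < r.
Proof.
move=> r0; have n : nbhs p [set x | `|x - p| < r] by apply/near_normP; exists r.
by apply: (nbhs_comp0 (@line_cont0 _ p d) _ n); rewrite scale0r addr0.
Qed.

Lemma dot_cont0 (a b : 'I_3 -> R -> R) :
  (forall i, a i @ 0 --> a i 0) -> (forall i, b i @ 0 --> b i 0) ->
  (fun t => \sum_i a i t * b i t) @ 0 --> \sum_i a i 0 * b i 0.
Proof.
move=> ac bc; have m i : (fun t => a i t * b i t) @ 0 --> a i 0 * b i 0.
  exact: cvgM (ac i) (bc i).
rewrite (_ : (fun t => _) = (fun t => a e0 t * b e0 t + a e1 t * b e1 t + a e2 t * b e2 t)).
  by rewrite sum3; exact: cvgD (cvgD (m e0) (m e1)) (m e2).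
by apply/funext => t; rewrite sum3.
Qed.

Lemma quad_cont0 (w : R -> 'I_3 -> R) : (forall i, w^~ i @ 0 --> w 0 i) ->
  (fun t => w t e0 ^+ 2 + w t e1 ^+ 2 - w t e2 ^+ 2) @ 0 -->
    w 0 e0 ^+ 2 + w 0 e1 ^+ 2 - w 0 e2 ^+ 2.
Proof.
move=> wc; have m i : (fun t => w t i ^+ 2) @ 0 --> w 0 i ^+ 2.
  exact: cvgM (wc i) (wc i).
exact: cvgB (cvgD (m e0) (m e1)) (m e2).
Qed.

Lemma analytic_quad k (f : 'I_3 -> 'rV[R]_k -> R) p : (forall i, analytic_at (f i) p) ->
  analytic_at (fun x => f e0 x ^+ 2 + f e1 x ^+ 2 - f e2 x ^+ 2) p.
Proof.
move=> fA; have m i : analytic_at (fun x => f i x ^+ 2) p by exact: analytic_exp.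
exact: analytic_sub (analytic_add (m e0) (m e1)) (m e2).
Qed.

Section AtPoint.
Variables (p : V3) (H : V3 -> V3).
Hypothesis Hp : local_diffeo p H.

(** [M] is the transposed Jacobian at p, acting on row vectors from the right, read off from
    Hadamard slopes. *)
Lemma diffeo_slopes : exists (h : 'I_3 -> 'I_3 -> V3 -> R) (M : 'M[R]_3),
  [/\ forall j i, analytic_at (h j i) p,
      \forall x \near p, forall j, H x 0 j - H p 0 j =
         \sum_i (x 0 i - p 0 i) * h j i x,
      M = \matrix_(i, j) h j i p & M \in unitmx].
Proof.
have [K [HA KA KH]] := Hp.
have /choice[h hP] := fun j => analytic_hadamard (HA j).
have /choice[k kP] := fun j => analytic_hadamard (KA j).
pose M := \matrix_(i, j) h j i p; pose N := \matrix_(i, j) k j i (H p).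
exists h, M.
have near_all (P : 'I_3 -> V3 -> Prop) (a : V3) :
    (forall j, \forall x \near a, P j x) -> \forall x \near a, forall j, P j x.
  move=> hh; have [h0 h1 h2] := And3 (hh e0) (hh e1) (hh e2).
  by near=> x; apply: I3P; near: x.
have hE := near_all _ p (fun j => (hP j).2).
have kE := near_all _ (H p) (fun j => (kP j).2).
split=> //; first by move=> j; exact: (hP j).1.
have Hc : H @ p --> H p by apply: rV_continuous => j; exact: analytic_continuous.
have Kp : K (H p) = p by exact: nbhs_singleton KH.
suff /mulmx1_unit[] : M *m N = 1%:M by [].
apply/matrixP => i j; rewrite !mxE.
pose u : V3 := delta_mx 0 i.
pose phi x := \sum_l h l i x * k j l (H x).
have phic : {for p, continuous phi}.
  apply: analytic_continuous; apply: analytic_sum => l.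
  apply: analytic_mul; first by case: (hP l).
  by apply: (@analytic_comp _ _ _ (k j l) H) => //; case: (kP j).
rewrite (eq_bigr (fun l => h l i p * k j l (H p))); last first.
  by move=> l _; rewrite !mxE.
(* Along the i-th coordinate line the identity K (H x) = x reads t delta_ij = t phi(x); at t = 0
   this becomes the (i, j) entry of M N = 1. *)
have := @punctured_eq (fun t => phi (p + t *: u)) (fun=> (i == j)%:R)
  (@line_continuous _ p u phi phic) (@cst_continuous _ _ _ _).
rewrite scale0r addr0; apply.
have n1 := nbhs_comp0 (@line_cont0 _ p u) (etrans (congr1 (+%R p) (scale0r u)) (addr0 p)) KH.
have n2 := nbhs_comp0 (@line_cont0 _ p u) (etrans (congr1 (+%R p) (scale0r u)) (addr0 p)) hE.
have n3 := nbhs_comp0 (@line_cont0 _ p u) (etrans (congr1 (+%R p) (scale0r u)) (addr0 p)) (Hc _ kE).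
near=> t => t0.
have xK : K (H (p + t *: u)) = p + t *: u by near: t; exact: n1.
have xh : forall j, H (p + t *: u) 0 j - H p 0 j =
    \sum_i ((p + t *: u) 0 i - p 0 i) * h j i (p + t *: u) by near: t; exact: n2.
have xk : forall j, K (H (p + t *: u)) 0 j - K (H p) 0 j =
    \sum_l (H (p + t *: u) 0 l - H p 0 l) * k j l (H (p + t *: u)).
  by near: t; exact: n3.
set x := p + t *: u in xK xh xk *.
have xu l : x 0 l - p 0 l = t * (l == i)%:R.
  by rewrite !mxE addrAC subrr add0r eqxx.
have E := xk j; rewrite xK Kp xu [j == i]eq_sym in E.
apply: (mulfI t0); rewrite E /phi mulr_sumr.
apply: eq_bigr => l _; rewrite xh (bigD1 i) //= big1 ?addr0.
  by rewrite xu eqxx mulr1 mulrA.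
by move=> l' li; rewrite xu (negbTE li) mulr0 mul0r.
Unshelve. all: by end_near. Qed.


(** Velocity of a curve on the cone, given by a continuous quotient [d] of the curve instead of a
    derivative. *)
Definition cone_tangent (v : V3) := exists c d : R -> V3,
  [/\ {for 0, continuous c}, {for 0, continuous d}, c 0 = p /\ d 0 = v,
      forall t, cone 2 (c t) & forall t, c t - p = t *: d t].

Lemma coord_cont0 (c : R -> V3) i : {for 0, continuous c} ->
  (fun t => c t 0 i) @ 0 --> c 0 0 i.
Proof.
move=> cc; apply: (@continuous_comp _ _ _ c (fun x : V3 => x 0 i)) => //.
exact: coord_continuous.
Qed.

Lemma vec3_cont0 (f g h : R -> R) : f @ 0 --> f 0 -> g @ 0 --> g 0 -> h @ 0 --> h 0 ->
  {for 0, continuous (fun t => vec3 (f t) (g t) (h t))}.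
Proof.
move=> fc gc hc; apply: (@rV_continuous _ _ _ (fun t => vec3 (f t) (g t) (h t))).
apply: I3P; rewrite vec3E.
- by rewrite (_ : (fun x => _) = f) //; apply/funext => t; rewrite vec3E.
- by rewrite (_ : (fun x => _) = g) //; apply/funext => t; rewrite vec3E.
- by rewrite (_ : (fun x => _) = h) //; apply/funext => t; rewrite vec3E.
Qed.

Definition cubic (a b c d t : R) := a + t * (b + t * (c + t * d)).

Lemma cubic_cont0 a b c d : cubic a b c d @ 0 --> cubic a b c d 0.
Proof.
have lin (f : R -> R) (e : R) : f @ 0 --> f 0 -> (fun t => e + t * f t) @ 0 --> e + 0 * f 0.
  by move=> fc; apply: cvgD; [exact: cvg_cst|apply: cvgM => //; exact: cvg_id].
exact: lin (lin _ _ (lin (fun=> d) c (cvg_cst _))).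
Qed.

(** In complex notation the curve is (1 + al t) (1 + i be t)^2 (p0 + i p1), with height (1 + al t)
    (1 + be^2 t^2) p2: a dilation times a rotation scaled to be polynomial. For p nonzero these
    velocities fill the tangent plane. *)
Lemma cone_tangent_general al be : cone 2 p ->
  cone_tangent (al *: p + be *: vec3 (- 2 * p 0 e1) (2 * p 0 e0) 0).
Proof.
move=> /coneE cp.
set p0 := p 0 e0 in cp *; set p1 := p 0 e1 in cp *; set p2 := p 0 e2 in cp *.
pose b := be ^+ 2.
exists (fun t => vec3
  (cubic p0 (al * p0 - 2 * be * p1) (- b * p0 - 2 * al * be * p1) (- al * b * p0) t)
  (cubic p1 (al * p1 + 2 * be * p0) (- b * p1 + 2 * al * be * p0) (- al * b * p1) t)
  (cubic p2 (al * p2) (b * p2) (al * b * p2) t)).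
exists (fun t => vec3
  (cubic (al * p0 - 2 * be * p1) (- b * p0 - 2 * al * be * p1) (- al * b * p0) 0 t)
  (cubic (al * p1 + 2 * be * p0) (- b * p1 + 2 * al * be * p0) (- al * b * p1) 0 t)
  (cubic (al * p2) (b * p2) (al * b * p2) 0 t)).
split.
- by apply: vec3_cont0; exact: cubic_cont0.
- by apply: vec3_cont0; exact: cubic_cont0.
- by rewrite /cubic; split; apply: rV3P; rewrite !mxE /= -?/p0 -?/p1 -?/p2 /b; ring.
- move=> t; apply/coneE; rewrite !vec3E /cubic /b.
  transitivity ((1 + al * t) ^+ 2 * (1 + be ^+ 2 * t ^+ 2) ^+ 2 * (p0 ^+ 2 + p1 ^+ 2)); first by ring.
  by rewrite cp; ring.
- by move=> t; apply: rV3P; rewrite !mxE /= /cubic -?/p0 -?/p1 -?/p2; ring.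
Qed.

Lemma cone_tangent_vertex v : p = 0 -> cone 2 v -> cone_tangent v.
Proof.
move=> p00 /quadE qv; exists (fun t => p + t *: v), (fun=> v); split.
- exact: line_cont0.
- exact: cst_continuous.
- by rewrite scale0r addr0.
- by move=> t; apply/quadE; rewrite p00 add0r quadZ qv mulr0.
- by move=> t; rewrite addrAC subrr add0r.
Qed.

Section Slopes.
Variables (h : 'I_3 -> 'I_3 -> V3 -> R) (M : 'M[R]_3).
Hypothesis hA : forall j i, analytic_at (h j i) p.
Hypothesis hE : \forall x \near p, forall j, H x 0 j - H p 0 j =
         \sum_i (x 0 i - p 0 i) * h j i x.
Hypothesis ME : M = \matrix_(i, j) h j i p.
Hypothesis Mu : M \in unitmx.
Hypothesis conep : cone 2 p.
Hypothesis HC : \forall x \near p, cone 2 x -> cone 2 (H x).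

(** The image of the curve is t w(t) with w(0) = v M. It lies on the cone, and the homogeneity of
    the form allows t^2 to be cancelled. *)
Lemma tangent_quad v : H p = 0 -> cone_tangent v -> quad (v *m M) = 0.
Proof.
move=> Hp0 [c [d [cc dc [c0 d0] cC cd]]].
pose w t j := \sum_i d t 0 i * h j i (c t).
have wc j : w^~ j @ 0 --> w 0 j.
  have hc i : (fun t => h j i (c t)) @ 0 --> h j i (c 0).
    apply: (@continuous_comp _ _ _ c (h j i)) => //; rewrite c0.
    exact: analytic_continuous.
  by apply: (dot_cont0 (a := fun i t => d t 0 i)) => // i; exact: coord_cont0.
have -> : v *m M = vec3 (w 0 e0) (w 0 e1) (w 0 e2).
  have vM j : (v *m M) 0 j = w 0 j.
    by rewrite mxE /w c0 d0 ME; apply: eq_bigr => i _; rewrite mxE.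
  by apply: rV3P; rewrite vec3E vM.
rewrite /quad !vec3E.
apply: (@punctured_eq (fun t => w t e0 ^+ 2 + w t e1 ^+ 2 - w t e2 ^+ 2) (fun=> 0)).
- exact: quad_cont0.
- exact: cst_continuous.
have n1 := nbhs_comp0 cc c0 hE; have n2 := nbhs_comp0 cc c0 HC.
near=> t => t0.
have tE : forall j, H (c t) 0 j - H p 0 j =
   \sum_i (c t 0 i - p 0 i) * h j i (c t) by near: t; exact: n1.
have tC : cone 2 (c t) -> cone 2 (H (c t)) by near: t; exact: n2.
have HE j : H (c t) 0 j = t * w t j.
  have := tE j; rewrite Hp0 mxE subr0 => ->; rewrite /w mulr_sumr.
  apply: eq_bigr => i _; have := congr1 (fun x : V3 => x 0 i) (cd t).
  by rewrite !mxE => ->; rewrite mulrA.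
have /quadE := tC (cC t); rewrite /quad !HE.
have t20 : t ^+ 2 != 0 by rewrite expf_neq0.
by move=> q; apply: (mulfI t20); rewrite mulr0 -[RHS]q; ring.
Unshelve. all: by end_near. Qed.

(** A Hadamard slope of [quad \o H], from a^2 - b^2 = (a + b)(a - b); at p it is the i-th partial
    derivative. *)
Definition grad i x := (H x 0 e0 + H p 0 e0) * h e0 i x +
  (H x 0 e1 + H p 0 e1) * h e1 i x - (H x 0 e2 + H p 0 e2) * h e2 i x.

Lemma grad_analytic i : analytic_at (grad i) p.
Proof.
have [K [HA _ _]] := Hp.
have m j : analytic_at (fun x => (H x 0 j + H p 0 j) * h j i x) p.
  by apply: analytic_mul => //; apply: analytic_add; [exact: HA|exact: analytic_cst].
exact: analytic_sub (analytic_add (m e0) (m e1)) (m e2).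
Qed.

Lemma gradE : \forall x \near p, quad (H x) - quad (H p) =
  \sum_i (x 0 i - p 0 i) * grad i x.
Proof.
near=> x; have xE : forall j, H x 0 j - H p 0 j =
   \sum_i (x 0 i - p 0 i) * h j i x by near: x.
transitivity ((H x 0 e0 + H p 0 e0) * (H x 0 e0 - H p 0 e0) +
  (H x 0 e1 + H p 0 e1) * (H x 0 e1 - H p 0 e1) -
  (H x 0 e2 + H p 0 e2) * (H x 0 e2 - H p 0 e2)); first by rewrite /quad; ring.
by rewrite !xE !sum3 /grad; ring.
Unshelve. all: by end_near. Qed.

Lemma quadHp : quad (H p) = 0.
Proof. by apply/quadE; apply: (nbhs_singleton HC). Qed.

Lemma tangent_grad v : cone_tangent v -> \sum_i v 0 i * grad i p = 0.
Proof.
move=> [c [d [cc dc [c0 d0] cC cd]]].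
rewrite -[in LHS]c0 -d0.
apply: (@punctured_eq (fun t => \sum_i d t 0 i * grad i (c t)) (fun=> 0)).
- have hc i : (fun t => grad i (c t)) @ 0 --> grad i (c 0).
    apply: (@continuous_comp _ _ _ c (grad i)) => //; rewrite c0.
    exact: analytic_continuous (grad_analytic i).
  by apply: (dot_cont0 (a := fun i t => d t 0 i)) => // i; exact: coord_cont0.
- exact: cst_continuous.
have n1 := nbhs_comp0 cc c0 gradE; have n2 := nbhs_comp0 cc c0 HC.
near=> t => t0.
have tE : quad (H (c t)) - quad (H p) =
   \sum_i (c t 0 i - p 0 i) * grad i (c t) by near: t; exact: n1.
have tC : cone 2 (c t) -> cone 2 (H (c t)) by near: t; exact: n2.
have /quadE q := tC (cC t); rewrite q quadHp subrr in tE.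
apply: (mulfI t0); rewrite mulr0 [RHS]tE mulr_sumr; apply: eq_bigr => i _.
have := congr1 (fun x : V3 => x 0 i) (cd t).
by rewrite !mxE => ->; rewrite mulrA.
Unshelve. all: by end_near. Qed.

Lemma M_inj (v : V3) : v *m M = 0 -> v = 0.
Proof. by move=> /(congr1 (mulmx^~ (invmx M))); rewrite mulmxK // mul0mx. Qed.

(* If p <> 0 is mapped to the vertex, the differential of H sends the tangent
   plane of the cone at p into the null cone, which contains no plane. *)
Lemma diffeo_vertex : H p = 0 -> p = 0.
Proof.
move=> Hp0; pose r : V3 := vec3 (- 2 * p 0 e1) (2 * p 0 e0) 0.
have tq al be : quad ((al *: p + be *: r) *m M) = 0.
  by apply: tangent_quad => //; exact: cone_tangent_general.
have [al [be [nz]]] := @isotropic_dependent (p *m M) (r *m M)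
  ltac:(by have := tq 1 0; rewrite scale1r scale0r addr0)
  ltac:(by have := tq 0 1; rewrite scale1r scale0r add0r)
  ltac:(by have := tq 1 1; rewrite !scale1r mulmxDl).
rewrite !scalemxAl -mulmxDl => /M_inj e.
have f i := congr1 (fun x : V3 => x 0 i) e.
apply: cone_vertex => //; apply/eqP/negPn/negP => p2.
have al0 : al = 0.
  have := f e2; rewrite !mxE /= mulr0 addr0 => /eqP.
  by rewrite mulf_eq0 (negbTE p2) orbF => /eqP.
have be0 : be != 0 by move: nz; rewrite al0 eqxx.
have p22 : p 0 e2 ^+ 2 != 0 by rewrite expf_neq0.
have h0 : p 0 e0 = 0.
  have := f e1; rewrite al0 !mxE /= mul0r add0r => /eqP.
  by rewrite mulf_eq0 (negbTE be0) /= mulf_eq0 pnatr_eq0 /= => /eqP.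
have h1 : p 0 e1 = 0.
  have := f e0; rewrite al0 !mxE /= mul0r add0r => /eqP.
  by rewrite mulf_eq0 (negbTE be0) /= mulNr oppr_eq0 mulf_eq0 pnatr_eq0 /= => /eqP.
by move: p22; move/coneE: conep => <-; rewrite h0 h1 expr0n /= addr0 eqxx.
Qed.

Notation u0 := (delta_mx 0 e0 : V3).
Notation u2 := (delta_mx 0 e2 : V3).

Lemma add_delta t : (p + t *: u2) 0 e2 = p 0 e2 + t.
Proof. by rewrite !mxE eqxx mulr1. Qed.

Lemma upd_add_delta t : upd (p + t *: u2) e2 (p 0 e2) = p.
Proof. by apply: rV3P; rewrite !mxE /= ?mulr0 ?addr0. Qed.

Lemma quadH_analytic : analytic_at (fun x => quad (H x)) p.
Proof.
have [K [HA _ _]] := Hp.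
exact: (analytic_quad HA).
Qed.

Lemma row_mx_line k (q d : 'rV[R]_k) (s t : R) :
  row_mx (q + t *: d) s%:M = row_mx q s%:M + t *: row_mx d (0 : 'M[R]_1) :> 'rV[R]_(k + 1).
Proof. by rewrite scale_row_mx add_row_mx scaler0 addr0. Qed.

Lemma row_mx_norm_lt k (x q : 'rV[R]_k) (s w r : R) : 0 < r ->
  `|x - q| < r -> `|s - w| < r -> `|row_mx x s%:M - row_mx q w%:M| < r.
Proof.
move=> r0 xq sw; apply/rV_norm_ltP => // j; rewrite -[j](@fintype.splitK _ _ j).
case: (fintype.split j) => j' /=.
  rewrite mxE row_mxEl [X in _ + X]mxE row_mxEl.
  by have := (rV_norm_ltP _ r0).2 xq j'; rewrite !mxE.
by rewrite mxE row_mxEr [X in _ + X]mxE row_mxEr !mxE !ord1 eqxx !mulr1n.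
Qed.

Lemma upd_norm_lt k (x q : 'rV[R]_k) i (s r : R) : 0 < r ->
  `|x - q| < r -> `|s - q 0 i| < r -> `|upd x i s - q| < r.
Proof.
move=> r0 xq sq; apply/rV_norm_ltP => // j; rewrite !mxE.
case: eqP => [->//|_]; by have := (rV_norm_ltP _ r0).2 xq j; rewrite !mxE.
Qed.

(** On the diagonal the difference quotient is the partial derivative. Both sides are compared along
    the vertical line through p. *)
Lemma slope_at_center K1 r : 0 < r -> analytic_at K1 (row_mx p (p 0 e2)%:M) ->
  (forall x s, `|x - p| < r -> `|s - p 0 e2| < r ->
      quad (H x) - quad (H (upd x e2 s)) = (x 0 e2 - s) * K1 (row_mx x s%:M)) ->
  K1 (row_mx p (p 0 e2)%:M) = grad e2 p.
Proof.
move=> r0 K1A K1E.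
have := @punctured_eq (fun t => K1 (row_mx (p + t *: u2) (p 0 e2)%:M))
  (fun t => grad e2 (p + t *: u2)).
rewrite scale0r addr0; apply.
- apply: (@line_continuous_ext _ (row_mx p (p 0 e2)%:M) (row_mx u2 0) K1).
    by move=> t; rewrite row_mx_line.
  exact: analytic_continuous.
- by apply: line_continuous; exact: analytic_continuous (grad_analytic e2).
have c0 : p + 0 *: u2 = p by rewrite scale0r addr0.
have n1 := nbhs_comp0 (@line_cont0 _ p u2) c0 gradE.
have n2 := @line_near p u2 r r0.
near=> t => t0; have xr : `|(p + t *: u2) - p| < r by near: t.
have E : quad (H (p + t *: u2)) - quad (H p) =
  \sum_i ((p + t *: u2) 0 i - p 0 i) * grad i (p + t *: u2) by near: t; exact: n1.
have := K1E _ (p 0 e2) xr; rewrite subrr normr0 => /(_ r0).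
rewrite upd_add_delta E sum3 add_delta.
have z0 : (p + t *: u2) 0 e0 - p 0 e0 = 0 by rewrite !mxE /= mulr0 addr0 subrr.
have z1 : (p + t *: u2) 0 e1 - p 0 e1 = 0 by rewrite !mxE /= mulr0 addr0 subrr.
rewrite z0 z1 !mul0r !add0r [p 0 e2 + t]addrC addrK => e.
by apply: (mulfI t0).
Unshelve. all: by end_near. Qed.

Lemma slope_neq0_near k (q : 'rV[R]_k) (w : R) (K : 'rV[R]_(k + 1) -> R) :
  analytic_at K (row_mx q w%:M) -> K (row_mx q w%:M) != 0 ->
  exists2 r, 0 < r & forall x s, `|x - q| < r -> `|s - w| < r -> K (row_mx x s%:M) != 0.
Proof.
move=> KA K0; have := analytic_continuous KA; move=> Kc.
have nK : nbhs (K (row_mx q w%:M)) [set y | y != 0].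
  by apply: open_nbhs_nbhs; split=> //; exact: open_neq.
have /near_normP[r r0 hr] : \forall z \near row_mx q w%:M, K z != 0 by exact: (Kc _ nK).
exists r => // x s xq sw.
by apply: hr; exact: row_mx_norm_lt.
Qed.

Definition rad (x : V3) : R := Num.sqrt (x 0 e0 ^+ 2 + x 0 e1 ^+ 2).

Lemma radius_continuous (sg : R) :
  (fun x => sg * rad x) @ p -->
   sg * rad p.
Proof.
have c1 : {for p, continuous (fun x : V3 => x 0 e0 ^+ 2 + x 0 e1 ^+ 2)}.
  apply: analytic_continuous.
  by apply: analytic_add; apply: analytic_exp; exact: analytic_coord.
have c2 := continuous_comp c1 (@sqrt_continuous R _).
exact: (@cvgM _ _ _ _ _ _ _ _ (cvg_cst sg) c2).
Qed.

Lemma radius_near sg r : 0 < r -> sg * rad p = p 0 e2 ->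
  \forall x \near p, `|sg * rad x - p 0 e2| < r.
Proof.
move=> r0 e; have := @radius_continuous sg; rewrite e => /cvgrPdist_lt /(_ r r0).
by move=> h1; near=> x; rewrite distrC; near: x.
Unshelve. all: by end_near. Qed.

Lemma radius_cone (sg : R) (x : V3) : sg ^+ 2 = 1 ->
  cone 2 (upd x e2 (sg * rad x)).
Proof.
move=> sg1; apply/coneE; rewrite !mxE /= exprMn sg1 mul1r /rad sqr_sqrtr //.
by rewrite addr_ge0 ?sqr_ge0.
Qed.

Lemma cone_of_radius (sg : R) (x : V3) : sg ^+ 2 = 1 ->
  x 0 e2 = sg * rad x -> cone 2 x.
Proof.
move=> sg1 e; apply/coneE; rewrite e exprMn sg1 mul1r /rad sqr_sqrtr //.
by rewrite addr_ge0 ?sqr_ge0.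
Qed.

(** [quad \o H] vanishes on the cone, so its gradient kills the tangent plane. If the vertical
    component vanished too, the tangents p and its rotation would force the whole gradient to
    vanish. The gradient is twice [M] applied to the conormal [n] at H p, so H p would be the
    vertex, against [diffeo_vertex]. *)
Lemma grad2_neq0 : p <> 0 -> grad e2 p != 0.
Proof.
move=> pn0; apply/eqP => g2.
have p2 : p 0 e2 != 0 by apply/eqP => /(cone_vertex conep).
have t1 := tangent_grad (cone_tangent_general 1 0 conep).
have t2 := tangent_grad (cone_tangent_general 0 1 conep).
rewrite !sum3 g2 !mxE /= in t1 t2.
have E1 : p 0 e0 * grad e0 p + p 0 e1 * grad e1 p = 0 by rewrite -[RHS]t1; ring.
have E2 : p 0 e0 * grad e1 p - p 0 e1 * grad e0 p = 0.
  by have : 2 * (p 0 e0 * grad e1 p - p 0 e1 * grad e0 p) = 0; [rewrite -[RHS]t2; ring|lra].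
have s0 : p 0 e0 ^+ 2 + p 0 e1 ^+ 2 != 0 by move/coneE: conep => ->; rewrite expf_neq0.
have g0 : grad e0 p = 0.
  apply: (mulfI s0); rewrite mulr0.
  transitivity (p 0 e0 * (p 0 e0 * grad e0 p + p 0 e1 * grad e1 p) -
    p 0 e1 * (p 0 e0 * grad e1 p - p 0 e1 * grad e0 p)); first by ring.
  by rewrite E1 E2; ring.
have g1 : grad e1 p = 0.
  apply: (mulfI s0); rewrite mulr0.
  transitivity (p 0 e1 * (p 0 e0 * grad e0 p + p 0 e1 * grad e1 p) +
    p 0 e0 * (p 0 e0 * grad e1 p - p 0 e1 * grad e0 p)); first by ring.
  by rewrite E1 E2; ring.
have gz : forall i, grad i p = 0 by apply: I3P.
pose n : V3 := vec3 (H p 0 e0) (H p 0 e1) (- H p 0 e2).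
have Mn : M *m n^T = 0.
  apply/matrixP => i j; rewrite mxE sum3 ME !mxE /= ; have := gz i.
  rewrite /grad => gi; lra.
have n0 : n = 0.
  have := congr1 (mulmx (invmx M)) Mn; rewrite mulKmx // mulmx0 => nT.
  by rewrite -[n]trmxK nT trmx0.
apply: pn0; apply: diffeo_vertex; have f i := congr1 (fun x : V3 => x 0 i) n0.
apply: rV3P; rewrite [RHS]mxE.
- by have := f e0; rewrite vec3E mxE.
- by have := f e1; rewrite vec3E mxE.
- by have := f e2; rewrite vec3E mxE; lra.
Qed.

(* On the vertical line through x, the function quad o H vanishes at the point of
   the cone next to x, and its difference quotient there is nonzero near p. *)
Lemma diffeo_cone_inv_regular : p <> 0 -> \forall x \near p, cone 2 (H x) -> cone 2 x.
Proof.
move=> pn0; have [K1 [K1A [r [r0 K1E]]]] := analytic_slope e2 quadH_analytic.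
have K1p := slope_at_center r0 K1A K1E.
have [r1 r10 K1n] : exists2 r, 0 < r & forall x s, `|x - p| < r ->
    `|s - p 0 e2| < r -> K1 (row_mx x s%:M) != 0.
  by apply: slope_neq0_near => //; rewrite K1p; exact: grad2_neq0.
have [r2 r20 HC2] := (near_normP _ _).1 HC.
(* The sign of the nappe through p: [sg * rad x] is the height of that nappe over x. *)
pose sg : R := if 0 <= p 0 e2 then 1 else -1.
have sg1 : sg ^+ 2 = 1 by rewrite /sg; case: ifP => _; rewrite ?sqrrN expr1n.
have sgp : sg * rad p = p 0 e2.
  rewrite /rad; move/coneE: conep => ->; rewrite sqrtr_sqr /sg; case: ifP => [p2|/negbT].
    by rewrite mul1r ger0_norm.
  by rewrite -ltNge => p2; rewrite ltr0_norm // mulN1r opprK.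
pose r3 := Num.min r (Num.min r1 r2).
have r30 : 0 < r3 by rewrite !lt_min r0 r10.
have near_r := radius_near r30 sgp.
have near_x : \forall x \near p, `|x - p| < r3 by apply/near_normP; exists r3.
near=> x => Hx.
have xr3 : `|x - p| < r3 by near: x.
set s := sg * rad x.
have sr3 : `|s - p 0 e2| < r3 by rewrite /s; near: x.
move: (xr3) (sr3); rewrite !lt_min => /and3P[xr xr1 xr2] /and3P[sr sr1 sr2].
have q1 : quad (H (upd x e2 s)) = 0.
  by apply/quadE; apply: HC2; [exact: upd_norm_lt|exact: radius_cone].
have := K1E x s xr sr; rewrite q1 (quadE _).1 // subrr => /esym/eqP.
rewrite mulf_eq0 (negbTE (K1n x s xr1 sr1)) orbF subr_eq0 => /eqP.
exact: cone_of_radius.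
Unshelve. all: by end_near. Qed.

(** Isotropy of the images of u0 + u2 and -u0 + u2, with that of u2, would by the parallelogram law
    make the image of u0 isotropic, hence an isotropic plane. *)
Lemma vertex_normal_quad : p = 0 -> H p = 0 -> quad (u2 *m M) != 0.
Proof.
move=> p00 Hp0; apply/eqP => qB.
have tq (e : R) : e ^+ 2 = 1 -> quad ((e *: u0 + u2) *m M) = 0.
  move=> e1; apply: tangent_quad => //; apply: cone_tangent_vertex => //.
  by apply/quadE; rewrite /quad !mxE /=; lra.
have q1 := tq 1 (expr1n _ _); have q2 := tq (-1) (etrans (sqrrN 1) (expr1n _ _)).
rewrite scale1r mulmxDl in q1; rewrite scaleN1r mulmxDl mulNmx in q2.
have qA : quad (u0 *m M) = 0.
  by move: q1 q2 qB; set A := u0 *m M; set B := u2 *m M; rewrite /quad !mxE; lra.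
have [al [be [nz]]] := isotropic_dependent qA qB q1.
rewrite !scalemxAl -mulmxDl => /M_inj e.
have f i := congr1 (fun x : V3 => x 0 i) e.
have := f e0; have := f e2; rewrite !mxE /= !mulr1 !mulr0 addr0 add0r => b0 a0.
by move: nz; rewrite a0 b0 eqxx.
Qed.

(* Near the vertex a vertical line meets the cone twice, hence the second
   difference quotient of quad o H. *)
Lemma diffeo_cone_inv_vertex : p = 0 -> H p = 0 ->
  \forall x \near p, cone 2 (H x) -> cone 2 x.
Proof.
move=> p00 Hp0; have [K1 [K1A [r [r0 K1E]]]] := analytic_slope e2 quadH_analytic.
have K1p := slope_at_center r0 K1A K1E.
have K1z : K1 (row_mx p (p 0 e2)%:M) = 0.
  by rewrite K1p /grad Hp0 !mxE; ring.
have [K2 [K2A [r' [r'0 K2E]]]] := analytic_slope (lshift 1 e2) K1A.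
have PE : (row_mx p (p 0 e2)%:M : 'rV[R]_(3 + 1)) 0 (lshift 1 e2) = p 0 e2.
  by rewrite row_mxEl.
rewrite PE in K2A K2E.
have updl (x : V3) (s w : R) : upd (row_mx x s%:M : 'rV[R]_(3 + 1)) (lshift 1 e2) w =
    row_mx (upd x e2 w) s%:M.
  apply/rowP => j; rewrite -[j](@fintype.splitK _ _ j) mxE; case: (fintype.split j) => j' /=.
    by rewrite !row_mxEl !mxE (inj_eq (@lshift_inj _ _)).
  by rewrite !row_mxEr.
(* On the axis H_j = t h_j, so quad (H x) is t^2 times the form at the slopes; taking two difference
   quotients expresses it as t^2 K2. *)
have K2n : K2 (row_mx (row_mx p (p 0 e2)%:M) (p 0 e2)%:M) = quad (u2 *m M).
  have -> : u2 *m M = vec3 (h e0 e2 p) (h e1 e2 p) (h e2 e2 p).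
    by apply: rV3P; rewrite vec3E -rowE mxE ME mxE.
  have := @punctured_eq (fun t => K2 (row_mx (row_mx (p + t *: u2) (p 0 e2)%:M) (p 0 e2)%:M))
    (fun t => (fun x => h e0 e2 x ^+ 2 + h e1 e2 x ^+ 2 - h e2 e2 x ^+ 2) (p + t *: u2)).
  rewrite scale0r addr0 /quad !vec3E; apply.
  - apply: (@line_continuous_ext _ (row_mx (row_mx p (p 0 e2)%:M) (p 0 e2)%:M)
      (row_mx (row_mx u2 0) 0) K2).
      by move=> t; rewrite !row_mx_line.
    exact: analytic_continuous.
  - apply: (@line_continuous_ext _ p u2
      (fun x => h e0 e2 x ^+ 2 + h e1 e2 x ^+ 2 - h e2 e2 x ^+ 2)) => //.
    apply: (@analytic_continuous _ _ _ p); exact: (analytic_quad (fun i => hA i e2)).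
  have c0 : p + 0 *: u2 = p by rewrite scale0r addr0.
  have n1 := nbhs_comp0 (@line_cont0 _ p u2) c0 hE.
  pose r2 := Num.min r r'; have r20 : 0 < r2 by rewrite lt_min r0.
  have n2 := @line_near p u2 r2 r20.
  near=> t => t0.
  have : `|(p + t *: u2) - p| < r2 by near: t.
  rewrite lt_min => /andP[xr xr'].
  have E : forall j, H (p + t *: u2) 0 j - H p 0 j =
    \sum_i ((p + t *: u2) 0 i - p 0 i) * h j i (p + t *: u2) by near: t; exact: n1.
  have HE j : H (p + t *: u2) 0 j = t * h j e2 (p + t *: u2).
    have := E j; rewrite Hp0 mxE subr0 => ->; rewrite sum3 add_delta.
    have z0 : (p + t *: u2) 0 e0 - p 0 e0 = 0 by rewrite !mxE /= mulr0 addr0 subrr.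
    have z1 : (p + t *: u2) 0 e1 - p 0 e1 = 0 by rewrite !mxE /= mulr0 addr0 subrr.
    by rewrite z0 z1 !mul0r !add0r [p 0 e2 + t]addrC addrK.
  have := K1E _ (p 0 e2) xr; rewrite subrr normr0 => /(_ r0).
  rewrite upd_add_delta quadHp subr0 add_delta [p 0 e2 + t]addrC addrK => E1.
  have Z2 : `|p 0 e2 - p 0 e2| < r' by rewrite subrr normr0.
  have Z1 := row_mx_norm_lt r'0 xr' Z2.
  have := K2E _ _ Z1 Z2.
  rewrite updl upd_add_delta K1z subr0 row_mxEl add_delta [p 0 e2 + t]addrC addrK => E2.
  have t20 : t ^+ 2 != 0 by rewrite expf_neq0.
  apply: (mulfI t20).
  transitivity (quad (H (p + t *: u2))); first by rewrite E1 E2 mulrA.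
  by rewrite /quad !HE; ring.
have [r1 r10 K2n0] : exists2 r, 0 < r & forall x s, `|x - row_mx p (p 0 e2)%:M| < r ->
    `|s - p 0 e2| < r -> K2 (row_mx x s%:M) != 0.
  by apply: slope_neq0_near => //; rewrite K2n; exact: vertex_normal_quad.
have [r2 r20 HC2] := (near_normP _ _).1 HC.
have p2 : p 0 e2 = 0 by rewrite p00 mxE.
have rad0 (sg : R) : sg * rad p = p 0 e2.
  by rewrite /rad p00 !mxE expr0n /= addr0 sqrtr0 mulr0.
pose r3 := Num.min (Num.min r r') (Num.min r1 r2).
have r30 : 0 < r3 by rewrite !lt_min r0 r'0 r10.
have near_r := radius_near r30 (rad0 1).
have near_x : \forall x \near p, `|x - p| < r3 by apply/near_normP; exists r3.
near=> x => Hx.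
have xr3 : `|x - p| < r3 by near: x.
have sr3 : `|1 * rad x - p 0 e2| < r3 by near: x.
set s := rad x in sr3.
have sN3 : `|- s - p 0 e2| < r3 by move: sr3; rewrite p2 mul1r !subr0 normrN.
rewrite mul1r in sr3.
move: (xr3) (sr3) (sN3); rewrite !lt_min.
move=> /andP[/andP[xr xr'] /andP[xr1 xr2]] /andP[/andP[sr sr'] /andP[sr1 sr2]].
move=> /andP[/andP[nr nr'] /andP[nr1 nr2]].
have q1 : quad (H (upd x e2 s)) = 0.
  apply/quadE; apply: HC2; first exact: upd_norm_lt.
  by have := @radius_cone 1 x (expr1n _ _); rewrite mul1r.
have q2 : quad (H (upd x e2 (- s))) = 0.
  apply/quadE; apply: HC2; first exact: upd_norm_lt.
  by have := @radius_cone (-1) x (etrans (sqrrN 1) (expr1n _ _)); rewrite mulN1r.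
(* The form vanishes at both cone points s and -s over x, so the quotient between them is 0; if they
   coincide, x is on the axis and the pair is the vertex taken twice. Hence quad (H x) = (x2 - s)
   (x2 + s) K2. *)
have K1y : K1 (row_mx (upd x e2 (- s)) s%:M) = 0.
  have [s0|s0] := eqVneq s 0.
    have [x0 x1] : x 0 e0 = 0 /\ x 0 e1 = 0.
      have := cone_vertex (@radius_cone 1 x (expr1n _ _)).
      rewrite mxE /= mul1r -/s s0 => /(_ erefl) e.
      by split; [have := congr1 (fun y : V3 => y 0 e0) e|have := congr1 (fun y : V3 => y 0 e1) e];
         rewrite !mxE.
    rewrite -K1z s0; congr (K1 (row_mx _ _%:M)); last by rewrite p2.
    by rewrite p00; apply: rV3P; rewrite !mxE /= ?x0 ?x1 ?oppr0.
  have := K1E (upd x e2 (- s)) s _ sr => /(_ (upd_norm_lt r0 xr nr)).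
  have -> : upd (upd x e2 (- s)) e2 s = upd x e2 s.
    by apply: rV3P; rewrite !mxE.
  rewrite q1 q2 subrr mxE eqxx => /esym/eqP.
  rewrite mulf_eq0 => /orP[/eqP e|/eqP //]; exfalso; move/eqP: s0; apply; lra.
have := K1E x s xr sr; rewrite q1 (quadE _).1 // subrr.
have := K2E (row_mx x s%:M) (- s) _ nr' => /(_ (row_mx_norm_lt r'0 xr' sr')).
rewrite updl K1y subr0 row_mxEl => -> /esym/eqP; rewrite mulrA mulf_eq0.
rewrite (negbTE (K2n0 _ _ (row_mx_norm_lt r10 xr1 sr1) nr1)) orbF mulf_eq0.
case/orP => /eqP e.
  by apply: (@cone_of_radius 1); rewrite ?expr1n // mul1r -/s; lra.
by apply: (@cone_of_radius (-1)); rewrite ?sqrrN ?expr1n // mulN1r -/s; lra.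
Unshelve. all: by end_near. Qed.

(* sg j (a, t) = H_j (t a, t) / t: H lifts to the cylinder as
   (a, t) |-> ((sg 0, sg 1) / sg 2, t sg 2). *)
Lemma diffeo_blowup : p = 0 -> H p = 0 -> exists sg : 'I_3 -> V3 -> R,
  forall a, cylinder 2 a -> a 0 e2 = 0 -> [/\ forall j, analytic_at (sg j) a,
    \forall x \near a, forall j, H (@cone_proj R 2 x) 0 j = x 0 e2 * sg j x,
    sg e0 a ^+ 2 + sg e1 a ^+ 2 = sg e2 a ^+ 2 & sg e2 a != 0].
Proof.
move=> p00 Hp0.
pose sg (j : 'I_3) (x : V3) : R := x 0 e0 * h j e0 (@cone_proj R 2 x) + x 0 e1 * h j e1 (@cone_proj R 2 x) +
  h j e2 (@cone_proj R 2 x).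
exists sg => a ca a2; have cp0 : cone_proj a = 0 by exact: cone_proj0.
have hpA j i : analytic_at (fun x : V3 => h j i (@cone_proj R 2 x)) a.
  apply: (@analytic_comp _ _ _ (h j i) (@cone_proj R 2)).
    by move=> j'; exact: cone_proj_analytic.
  by rewrite cp0 -p00.
pose d : V3 := vec3 (a 0 e0) (a 0 e1) 1.
have cd : cone 2 d by apply/coneE; rewrite !vec3E expr1n; exact/cylinderE.
have sgd j : sg j a = (d *m M) 0 j.
  by rewrite mxE sum3 ME !mxE /= /sg cp0 p00 mul1r.
have qd := tangent_quad Hp0 (cone_tangent_vertex p00 cd).
split.
- move=> j; apply: analytic_add => //.
  by apply: analytic_add; apply: analytic_mul => //; exact: analytic_coord.
- have : \forall x \near a, forall j, H (@cone_proj R 2 x) 0 j - H p 0 j =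
      \sum_i (@cone_proj R 2 x 0 i - p 0 i) * h j i (@cone_proj R 2 x).
    have hE' : nbhs (@cone_proj R 2 a) [set x | forall j, H x 0 j - H p 0 j =
      \sum_i (x 0 i - p 0 i) * h j i x] by rewrite cp0 -p00; exact: hE.
    exact: (@cone_proj_continuous R a _ hE').
  move=> hh; near=> x.
  have xE : forall j, H (@cone_proj R 2 x) 0 j - H p 0 j =
      \sum_i (@cone_proj R 2 x 0 i - p 0 i) * h j i (@cone_proj R 2 x) by near: x.
  move=> j; have := xE j; rewrite [H p]Hp0 [X in _ - X = _]mxE subr0 => ->.
  by rewrite sum3 p00 cone_projE !vec3E !mxE /sg cone_projE; ring.
- by rewrite !sgd; apply/coneE; apply/quadE.
- rewrite sgd; apply/eqP => z; have dM : d *m M = 0 by apply: cone_vertex => //; exact/quadE.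
  have := congr1 (fun x : V3 => x 0 e2) (M_inj dM); rewrite vec3E mxE => /eqP.
  by rewrite oner_eq0.
Unshelve. all: by end_near. Qed.

End Slopes.
End AtPoint.
End ConeDiffeo.

(** * Surfaces covered by cone charts *)

Section SubspaceTopology.
Context {T : topologicalType} (Z : set T).

Lemma set_type_nbhs (z : set_type Z) (W : set T) :
  nbhs (set_val z) W -> nbhs z (set_val @^-1` W).
Proof. exact: (@initial_continuous _ _ (set_val : set_type Z -> T) z). Qed.

Lemma set_type_nbhsE (z : set_type Z) (V : set (set_type Z)) : nbhs z V ->
  exists2 W, nbhs (set_val z) W & set_val @^-1` W `<=` V.
Proof.
rewrite nbhsE => -[B [[W oW <-] Wz] BV]; exists W => //.
by exists W.
Qed.

Lemma set_type_within (Y : topologicalType) (A : set Y) (f : Y -> set_type Z) :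
  {within A, continuous (fun y => set_val (f y))} -> {within A, continuous f}.
Proof.
move=> /withinP h; apply/withinP => y Ay V /set_type_nbhsE[W nW WV].
by have := h y Ay W nW; apply: filterS => y' hy /hy /WV.
Qed.

Lemma set_val_inj : injective (set_val : set_type Z -> T).
Proof. exact: val_inj. Qed.

Lemma set_valZ (z : set_type Z) : Z (set_val z).
Proof. exact: set_valP. Qed.

Lemma set_type_hausdorff : hausdorff_space T -> hausdorff_space (set_type Z).
Proof.
move=> hT p q pq; apply: set_val_inj; apply: hT => A B nA nB.
have [x [Ax Bx]] := pq _ _ (set_type_nbhs nA) (set_type_nbhs nB).
by exists (set_val x).
Qed.

End SubspaceTopology.

Section Charts.
Context {R : realType}.
Notation V3 := 'rV[R]_3.

Lemma open_image k l (A A' : set 'rV[R]_k) (B : set 'rV[R]_l) f :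
  analytic_diffeo A f B -> open B -> open A' -> A' `<=` A -> open (f @` A').
Proof.
move=> fd oB oA' AA; have [g [[[gB _ _] gA _] gf fg]] := analytic_diffeo_sym fd.
have [[fB _ _] _ _] := fd.
rewrite openE => _ [x A'x <-].
have Bfx : B (f x) by apply: fB; exact: AA.
have nA : nbhs (g (f x)) A' by rewrite gf; [apply: open_nbhs_nbhs|exact: AA].
have h := analytic_on_continuous gA Bfx nA.
have nB : nbhs (f x) B by apply: open_nbhs_nbhs.
rewrite /interior; near=> y.
have By : B y by near: y.
exists (g y); last exact: fg.
by move: By; near: y.
Unshelve. all: by end_near. Qed.

Lemma open_preimage k l (A : set 'rV[R]_k) (f : 'rV[R]_k -> 'rV[R]_l) (B : set 'rV[R]_l) :
  open A -> analytic_on A f -> open B -> open (A `&` f @^-1` B).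
Proof.
move=> oA fA oB; rewrite openE => x [Ax Bx].
have h := analytic_on_continuous fA Ax (open_nbhs_nbhs (conj oB Bx)).
have nA : nbhs x A by apply: open_nbhs_nbhs.
rewrite /interior; near=> y; have Ay : A y by near: y.
by split=> //; move: Ay; near: y.
Unshelve. all: by end_near. Qed.

Lemma transition (A B : set V3) (f g : V3 -> V3) :
  open A -> open B -> open (f @` A) -> open (g @` B) ->
  analytic_diffeo A f (f @` A) ->
  analytic_diffeo B g (g @` B) ->
  exists H : V3 -> V3, [/\ forall x, (g @` B) (f x) -> B (H x) /\ g (H x) = f x,
    forall y, B y -> A y -> f y = g y -> H y = y &
    forall x, A x -> (g @` B) (f x) -> local_diffeo x H].
Proof.
move=> oA oB ofA ogB fd gd; have [gi [[[gigB _ _] giA _] gig ggi]] := analytic_diffeo_sym gd.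
have [[fAA _ _] fA [fi [fif fiA]]] := fd; have [_ gA _] := gd.
exists (gi \o f); split.
- by move=> x xB; split=> /=; [exact: gigB|exact: ggi].
- by move=> y By Ay /= ->; exact: gig.
move=> x Ax Bx; exists (fi \o g).
have oO := open_preimage oA fA ogB.
have fAO : analytic_on (A `&` f @^-1` (g @` B)) (gi \o f).
  apply: (analytic_on_comp _ giA); last by move=> y [].
  by apply: analytic_on_subset fA => y [].
split.
- exact: (analytic_on_open_at oO fAO).
- have gfx : B (gi (f x)) by exact: gigB.
  have fgx : (f @` A) (g (gi (f x))) by rewrite ggi //; exact: fAA.
  have oO' := open_preimage oB gA ofA.
  apply: (analytic_on_open_at oO') => //.
  apply: (analytic_on_comp _ fiA); last by move=> y [].
  by apply: analytic_on_subset gA => y [].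
- have nO : nbhs x (A `&` f @^-1` (g @` B)) by apply: open_nbhs_nbhs.
  near=> y; have [Ay By] : (A `&` f @^-1` (g @` B)) y by near: y.
  by rewrite /= ggi // fif.
Unshelve. all: by end_near. Qed.

(** As the first equivalence describes [Z] on all of [Om], a transition map between two charts
    preserves the cone in both directions; the second one makes it preserve the vertex. *)
Definition ambient_chart (Z Sing Om : set V3) (G : V3 -> V3) :=
  [/\ open Om, open (G @` Om), analytic_diffeo Om G (G @` Om),
      connected (G @` (@cone R 2 `&` Om)) &
      (forall x, Om x -> (cone 2 x <-> Z (G x))) /\
      (forall x, Om x -> cone 2 x -> (x = 0 <-> Sing (G x)))].

Section Lifts.
Variables (Z Sing : set V3) (z0 : set_type Z).

Definition to_sub (y : V3) : set_type Z := insubd z0 y.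

Lemma to_subE y : Z y -> set_val (to_sub y) = y.
Proof. by move=> Zy; rewrite /to_sub -[set_val _]/(val _) val_insubd mem_set. Qed.

Lemma to_subK (z : set_type Z) : to_sub (set_val z) = z.
Proof. by apply: set_val_inj; rewrite to_subE //; exact: set_valZ. Qed.

Definition chart_param (Om : set V3) (G : V3 -> V3) :
    @local_param R (2 + 1) (set_type Z) :=
  LocalParam (@cylinder R 2 `&` @cone_proj R 2 @^-1` Om)
             (fun a => to_sub (G (cone_proj a))).

Section OneChart.
Variables (Om : set V3) (G : V3 -> V3).
Hypothesis cG : ambient_chart Z Sing Om G.

Lemma chart_val a : lp_dom (chart_param Om G) a ->
  set_val (chart_param Om G a) = G (cone_proj a).
Proof.
move=> [ca Oa]; have [_ _ _ _ [ZG _]] := cG; rewrite /chart_param /= to_subE //.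
by apply/ZG => //; exact: cone_projP.
Qed.

Lemma chart_img (z : set_type Z) :
  lp_img (chart_param Om G) z <-> (G @` Om) (set_val z).
Proof.
have [_ _ _ _ [ZG _]] := cG.
split=> [[a aD <-]|[x Ox e]].
  by rewrite chart_val //; case: aD => ca Oa; exists (cone_proj a).
have cx : cone 2 x by apply/ZG => //; rewrite e; exact: set_valZ.
have [a ca ax] := cone_proj_surj cx.
exists a; first by split=> //; rewrite /= ax.
by rewrite /chart_param /= ax e to_subK.
Qed.

Lemma chart_inverse_dc : inverse_dc_coordinate (chart_param Om G).
Proof.
have [oO oG [[GB Ginj _] GA [gi [giG giA]]] cn [ZG _]] := cG.
have GZ x : cone 2 x -> Om x -> set_val (to_sub (G x)) = G x.
  by move=> cx Ox; apply: to_subE; apply/ZG.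
exists (@cone R 2 `&` Om), (fun x => to_sub (G x)).
have wc : {within @cone R 2 `&` Om, continuous (fun x => to_sub (G x))}.
  apply: set_type_within; apply/withinP => x [cx Ox] V nV.
  rewrite /= GZ // in nV; have := analytic_on_continuous GA Ox nV.
  by apply: filterS => y hy [cy Oy]; rewrite GZ //; exact: hy.
split=> //.
- by exists Om.
- split=> //.
    split=> [x xU|x y /set_mem[cx Ox] /set_mem[cy Oy] /(congr1 set_val)|//].
      by exists x.
    by rewrite !GZ // => e; apply: Ginj => //; exact/mem_set.
  exists (fun z => gi (set_val z)); split=> [x [cx Ox]|].
    by rewrite GZ // giG.
  apply/withinP => _ [x [cx Ox] <-] V; rewrite GZ // => nV.
  have := analytic_on_continuous giA (GB _ Ox) nV; rewrite -{1}(GZ x cx Ox).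
  move=> /set_type_nbhs; apply: filterS => z hz [y [cy Oy] yz].
  by apply: hz; rewrite -yz GZ //; exact: GB.
- split.
    rewrite (_ : _ @` _ = set_val @^-1` (G @` Om)).
      by exists (G @` Om).
    apply/seteqP; split=> [_ [x [cx Ox] <-]|z [x Ox e]]; first by rewrite /= GZ //; exact: GB.
    exists x; last by rewrite e to_subK.
    by split=> //; apply/ZG => //; rewrite e; exact: set_valZ.
  rewrite (_ : _ @` _ = to_sub @` (G @` (@cone R 2 `&` Om))); last first.
    apply/seteqP; split=> [_ [x xU <-]|_ [_ [x xU <-] <-]]; last by exists x.
    by exists (G x) => //; exists x.
  apply: connected_continuous_connected => //.
  apply: set_type_within; apply/withinP => _ [x [cx Ox] <-] V; rewrite GZ // => nV.
  by apply: filterS nV => y Vy [x' [cx' Ox'] e]; rewrite -e GZ // e.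
- by apply/seteqP; split=> [a [ca Oa]|a [ca [_ Oa]]]; split=> //; split=> //; exact: cone_projP.
Qed.

End OneChart.

Lemma chart_lift (Om Om' : set V3) (G G' : V3 -> V3) :
  ambient_chart Z Sing Om G -> ambient_chart Z Sing Om' G' ->
  let P := chart_param Om G in let Q := chart_param Om' G' in
  let D := lp_dom P `&` P @^-1` lp_img Q in
  exists F, analytic_on D F /\ forall a, D a -> lp_dom Q (F a) /\ Q (F a) = P a.
Proof.
move=> cG cG' P Q D; have [oO oG Gd _ [ZG SG]] := cG.
have [oO' oG' Gd' _ [ZG' SG']] := cG'.
have [H [HE _ Hd]] := transition oO oO' oG oG' Gd Gd'.
have DP a : D a -> [/\ cylinder 2 a, Om (cone_proj a), cone 2 (cone_proj a),
    (G' @` Om') (G (cone_proj a)) & cone 2 (H (cone_proj a))].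
  move=> [[ca Oa] Qa]; have GO : (G' @` Om') (G (cone_proj a)).
    by move/(chart_img cG'): Qa; rewrite chart_val.
  have [BH GH] := HE _ GO; split=> //; first exact: cone_projP.
  by apply/ZG' => //; rewrite GH; apply/ZG => //; exact: cone_projP.
(* Both charts detect the vertex by the same set [Sing]. *)
have vert a : D a -> (a 0 e2 = 0 <-> H (cone_proj a) = 0).
  move=> Da; have [ca Oa cca GO cH] := DP a Da; have [BH GH] := HE _ GO.
  split=> [/cone_proj0 a0|h0].
    by apply/(SG' _ BH cH); rewrite GH; apply/SG.
  have /(SG _ Oa cca) e : Sing (G (cone_proj a)) by rewrite -GH; apply/(SG' _ BH cH).
  by have := congr1 (fun x : V3 => x 0 e2) e; rewrite cone_projE vec3E mxE.
have [sg sgP] : exists sg : 'I_3 -> V3 -> R, forall a, D a -> a 0 e2 = 0 ->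
  [/\ forall j, analytic_at (sg j) a,
    \forall x \near a, forall j, H (@cone_proj R 2 x) 0 j = x 0 e2 * sg j x,
    sg e0 a ^+ 2 + sg e1 a ^+ 2 = sg e2 a ^+ 2 & sg e2 a != 0].
  case: (pselect (exists2 a, D a & a 0 e2 = 0)) => [[a Da a0]|n]; last first.
    by exists (fun _ _ => 0) => a Da a0; exfalso; apply: n; exists a.
  have [ca Oa cca GO cH] := DP a Da.
  have H0 := (vert a Da).1 a0; rewrite (cone_proj0 a0) in H0 Oa GO.
  have ld := Hd _ Oa GO; have [h [M [hA hE ME Mu]]] := diffeo_slopes ld.
  have c0 : @cone R 2 0 by apply/coneE; rewrite !mxE; ring.
  have HC : \forall x \near (0 : V3), cone 2 x -> cone 2 (H x).
    have oD := open_preimage oO (let: And3 _ h _ := Gd in h) oG'.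
    have n0 := open_nbhs_nbhs (conj oD (conj Oa GO)).
    apply: filterS n0 => x [Ox Gx] cx; have [Bx Hx] := HE _ Gx.
    by apply/ZG' => //; rewrite Hx; apply/ZG.
  have [sg sgP] := diffeo_blowup hA hE ME Mu HC erefl H0.
  by exists sg => b Db b0; apply: sgP => //; have [] := DP b Db.
(* Off the vertex the lift divides by the last coordinate; over the vertex it takes the limit of
   these quotients, which depends on the point of the circle. *)
pose F (a : V3) : V3 := let y := H (@cone_proj R 2 a) in
  if y 0 e2 != 0 then vec3 (y 0 e0 / y 0 e2) (y 0 e1 / y 0 e2) (y 0 e2)
  else vec3 (sg e0 a / sg e2 a) (sg e1 a / sg e2 a) 0.
exists F; split; last first.
  move=> a Da; have [ca Oa cca GO cH] := DP a Da; have [BH GH] := HE _ GO.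
  suff [cF pF] : cylinder 2 (F a) /\ @cone_proj R 2 (F a) = H (@cone_proj R 2 a).
    have dF : lp_dom Q (F a) by split=> //; rewrite /= pF.
    by split=> //; apply: set_val_inj; rewrite (chart_val cG' dF) (chart_val cG Da.1) pF.
  rewrite /F; case: ifPn => [y2|]; last first.
    rewrite negbK => /eqP y2; have y0 := cone_vertex cH y2.
    have a0 := (vert a Da).2 y0; have [_ _ q s2] := sgP a Da a0.
    split; last by rewrite cone_proj0 ?vec3E // y0.
    apply/cylinderE; rewrite !vec3E !expr_div_n -mulrDl q divff //.
    by rewrite expf_neq0.
  split; first by apply/cylinderE; rewrite !vec3E !expr_div_n -mulrDl;
    move/coneE: cH => ->; rewrite divff // expf_neq0.
  by rewrite cone_projE !vec3E; apply: rV3P; rewrite vec3E // mulrC divfK.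
move=> a Da; have [ca Oa cca GO cH] := DP a Da; have [BH GH] := HE _ GO.
have [K [HA _ _]] := Hd _ Oa GO.
have HcA j : analytic_at (fun x : V3 => H (@cone_proj R 2 x) 0 j) a.
  apply: (@analytic_comp _ _ _ (fun y => H y 0 j) (@cone_proj R 2)) => //.
  by move=> j'; exact: cone_proj_analytic.
have [a0|a0] := eqVneq (a 0 e2) 0; last first.
  have y2 : H (@cone_proj R 2 a) 0 e2 != 0.
    apply/eqP => y2; have y0 := cone_vertex cH y2.
    by rewrite (vert a Da).2 // eqxx in a0.
  exists (fun x => vec3 (H (@cone_proj R 2 x) 0 e0 / H (@cone_proj R 2 x) 0 e2)
    (H (@cone_proj R 2 x) 0 e1 / H (@cone_proj R 2 x) 0 e2) (H (@cone_proj R 2 x) 0 e2)).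
  split; first by apply: analytic_vec3 => //; exact: analytic_div.
  have nK : nbhs (H (@cone_proj R 2 a) 0 e2) [set y | y != 0].
    by apply: open_nbhs_nbhs; split=> //; exact: open_neq.
  have h := analytic_continuous (HcA e2) nK.
  near=> x => Dx; have x2 : H (@cone_proj R 2 x) 0 e2 != 0 by near: x; exact: h.
  by rewrite /F x2.
have [sA sE q s2] := sgP a Da a0.
(* The factor x 0 e2 cancels in the quotients, so near the circle one analytic formula gives both
   branches of [F]. *)
exists (fun x => vec3 (sg e0 x / sg e2 x) (sg e1 x / sg e2 x) (x 0 e2 * sg e2 x)).
split.
  apply: analytic_vec3; try exact: analytic_div.
  by apply: analytic_mul => //; exact: analytic_coord.
have nK : nbhs (sg e2 a) [set y | y != 0].
  by apply: open_nbhs_nbhs; split=> //; exact: open_neq.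
have h := analytic_continuous (sA e2) nK.
near=> x => Dx; have x2 : sg e2 x != 0 by near: x; exact: h.
have xE : forall j, H (@cone_proj R 2 x) 0 j = x 0 e2 * sg j x by near: x.
rewrite /F !xE mulf_eq0 (negbTE x2) orbF; case: eqVneq => [->|x0] /=.
  by rewrite mul0r.
by apply: rV3P; rewrite !vec3E //; field; rewrite x2 x0.
Unshelve. all: by end_near. Qed.

Lemma chart_compatible (Om Om' : set V3) (G G' : V3 -> V3) :
  ambient_chart Z Sing Om G -> ambient_chart Z Sing Om' G' ->
  compatible (chart_param Om G) (chart_param Om' G').
Proof.
move=> cG cG'; have [F [FA FE]] := chart_lift cG cG'.
have [F' [FA' FE']] := chart_lift cG' cG.
apply: (compatible_of_lifts _ _ FA FA' FE FE'); apply: inverse_dc_tame.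
  exact: chart_inverse_dc cG.
exact: chart_inverse_dc cG'.
Qed.

End Lifts.
End Charts.

Section FlatCone.
Context {R : realType}.
Notation V3 := 'rV[R]_3.

Lemma lsub_flat (x : 'rV[R]_(2 + 1 + 0)) : lsubmx x = x :> V3.
Proof. by apply/rowP => j; rewrite mxE; congr (x _ _); apply: val_inj. Qed.

Lemma flat_coneE (x : 'rV[R]_(2 + 1 + 0)) : @flat_cone R 2 0 x <-> cone 2 (x : V3).
Proof.
rewrite /flat_cone /= lsub_flat; split=> [[]//|cx]; split=> //.
by apply/rowP => -[].
Qed.

Lemma flat_cone_projE (a : 'rV[R]_(2 + 1)) :
  flat_cone_proj 0 a = @cone_proj R 2 a :> V3.
Proof. by rewrite -(lsub_flat (flat_cone_proj 0 a)); exact: row_mxKl. Qed.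

End FlatCone.

(** * Sets locally equivalent to the cone in the ambient space *)

Section ChartedSets.
Context {R : realType}.
Notation V3 := 'rV[R]_3.

(** [Sing] collects the vertices of the charts; being made of isolated points, it can serve as a
    pre-residual set. *)
Definition charted (Z Sing : set V3) (C : set (set V3 * (V3 -> V3))) :=
  [/\ forall c, C c -> ambient_chart Z Sing c.1 c.2,
      forall z, Z z -> exists2 c, C c & (c.2 @` c.1) z,
      Sing `<=` Z & Sing `<=` isolated Sing].

(* Straightening of the cone along the generator opposite to (e, 0, 1), e = +-1:
   in the null coordinates s = y2 + e y0 and s' = y2 - e y0 the cone is s s' = y1^2. *)
Definition flatten (e : R) (y : V3) : V3 :=
  vec3 (y 0 e2 + e * y 0 e0) (y 0 e1)
    ((y 0 e2 - e * y 0 e0) * (y 0 e2 + e * y 0 e0) - y 0 e1 ^+ 2).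

Definition unflatten (e : R) (z : V3) : V3 :=
  let s := z 0 e0 in let s' := (z 0 e2 + z 0 e1 ^+ 2) / s in
  vec3 (e * ((s - s') / 2)) (z 0 e1) ((s + s') / 2).

Lemma flattenE (e : R) (y : V3) : e ^+ 2 = 1 -> flatten e y 0 e2 = - quad y.
Proof.
move=> e1'; rewrite vec3E /quad.
transitivity (y 0 e2 ^+ 2 - e ^+ 2 * y 0 e0 ^+ 2 - y 0 e1 ^+ 2); first by ring.
by rewrite e1'; ring.
Qed.

Lemma open_analytic_neq0 (f : V3 -> R) :
  (forall p, analytic_at f p) -> open [set y | f y != 0].
Proof.
move=> fA; rewrite (_ : [set y | _] = f @^-1` [set x | x != 0]) //.
apply: open_comp; last exact: open_neq.
by move=> y _; exact: analytic_continuous.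
Qed.

Lemma flatten_diffeo (e : R) : e ^+ 2 = 1 ->
  [/\ open [set y : V3 | y 0 e2 + e * y 0 e0 != 0], open [set z : V3 | z 0 e0 != 0],
  analytic_diffeo [set y : V3 | y 0 e2 + e * y 0 e0 != 0] (flatten e) [set z : V3 | z 0 e0 != 0]
  & forall y : V3, y 0 e2 + e * y 0 e0 != 0 -> unflatten e (flatten e y) = y].
Proof.
move=> e1'.
have sA p : analytic_at (fun y : V3 => y 0 e2 + e * y 0 e0) p.
  by apply: analytic_add; [|apply: analytic_mul; [exact: analytic_cst|]]; exact: analytic_coord.
have K (y : V3) : y 0 e2 + e * y 0 e0 != 0 -> unflatten e (flatten e y) = y.
  move=> s0; apply: rV3P; rewrite !vec3E //.
  - transitivity (e ^+ 2 * y 0 e0); first by field.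
    by rewrite e1' mul1r.
  - by field.
split=> //.
- exact: open_analytic_neq0.
- by apply: open_analytic_neq0 => p; exact: analytic_coord.
apply: (@analytic_diffeo_of _ _ _ _ _ _ (unflatten e)) => //.
- apply: analytic_on_at => p _; apply: analytic_vec3 => //; first exact: analytic_coord.
  apply: analytic_sub; last by apply: analytic_exp; exact: analytic_coord.
  apply: analytic_mul => //; apply: analytic_sub; first exact: analytic_coord.
  by apply: analytic_mul; [exact: analytic_cst|exact: analytic_coord].
- apply: analytic_on_at => p /= p0.
  have s'A : analytic_at (fun z : V3 => (z 0 e2 + z 0 e1 ^+ 2) / z 0 e0) p.
    apply: analytic_div => //; last exact: analytic_coord.
    by apply: analytic_add; [|apply: analytic_exp]; exact: analytic_coord.
  apply: analytic_vec3; last 1 first.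
  + apply: analytic_mul; last exact: analytic_cst.
    by apply: analytic_add => //; exact: analytic_coord.
  + apply: analytic_mul; first exact: analytic_cst.
    apply: analytic_mul; last exact: analytic_cst.
    by apply: analytic_sub => //; exact: analytic_coord.
  + exact: analytic_coord.
- by move=> x /= h; rewrite vec3E.
- move=> z /= z0; rewrite !vec3E mulrA -expr2 e1' mul1r.
  by rewrite (_ : _ + _ = z 0 e0) //; field.
- move=> z /= z0; apply: rV3P; rewrite !vec3E //.
    by rewrite mulrA -expr2 e1' mul1r; field.
  by rewrite mulrA -expr2 e1' mul1r; field.
Qed.

Lemma analytic_diffeo_restrict k l (A A' : set 'rV[R]_k) (B : set 'rV[R]_l) f :
  analytic_diffeo A f B -> A' `<=` A -> analytic_diffeo A' f (f @` A').
Proof.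
move=> [[fB finj _] fA [g [gf gA]]] AA; split.
- split=> [x A'x|x y /set_mem A'x /set_mem A'y|//]; first by exists x.
  by apply: finj; apply/mem_set; exact: AA.
- exact: analytic_on_subset fA.
- exists g; split=> [x /AA|]; first exact: gf.
  by apply: analytic_on_subset gA => _ [x /AA Ax <-]; exact: fB.
Qed.

Lemma analytic_diffeo_comp k l m (A : set 'rV[R]_k) (B : set 'rV[R]_l)
    (D : set 'rV[R]_m) f g :
  analytic_diffeo A f B -> analytic_diffeo B g D -> analytic_diffeo A (g \o f) D.
Proof.
move=> fd gd; have [f' [[[fA' _ _] f'A _] ff' f'f]] := analytic_diffeo_sym fd.
have [g' [[[gA' _ _] g'A _] gg' g'g]] := analytic_diffeo_sym gd.
have [[fB _ _] fA _] := fd; have [[gD _ _] gA _] := gd.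
apply: (@analytic_diffeo_of _ _ _ _ _ _ (f' \o g')).
- exact: analytic_on_comp fA gA fB.
- exact: analytic_on_comp g'A f'A gA'.
- by move=> x /fB /gD.
- by move=> x /gA' /fA'.
- by move=> x Ax; rewrite /= gg' ?ff' //; exact: fB.
- by move=> x Dx; rewrite /= f'f ?g'g //; exact: gA'.
Qed.

Lemma charted_regular_part Z Sing C : charted Z Sing C ->
  analytic_submanifold 2 (Z `\` Sing).
Proof.
move=> [chC covC _ _] p [Zp nSp]; have [[Om G] /chC cG [x /= Ox Gx]] := covC p Zp.
have [oO oG Gd _ [ZG SG]] := cG; rewrite /= in oO oG Gd ZG SG.
have cx : cone 2 x by apply/ZG => //; rewrite Gx.
(* Both null coordinates vanish on the cone only at the vertex, which is excluded. *)
have [e e1' se] : exists2 e : R, e ^+ 2 = 1 & x 0 e2 + e * x 0 e0 != 0.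
  have [s0|s0] := eqVneq (x 0 e2 + 1 * x 0 e0) 0; last by exists 1; rewrite ?expr1n.
  have [s1|s1] := eqVneq (x 0 e2 + -1 * x 0 e0) 0; last by exists (-1); rewrite ?sqrrN ?expr1n.
  exfalso; apply: nSp; rewrite -Gx; apply/SG => //; apply: cone_vertex => //; lra.
have [oA oB Td TK] := flatten_diffeo e1'.
pose A := Om `&` [set y : V3 | y 0 e2 + e * y 0 e0 != 0].
have oOA : open A by exact: openI.
have oGA : open (G @` A) by apply: (open_image Gd) => // y [].
have GdA := analytic_diffeo_restrict Gd (@subIsetl _ Om [set y : V3 | y 0 e2 + e * y 0 e0 != 0]).
rewrite -/A in GdA.
have [gi [gid giG Ggi]] := analytic_diffeo_sym GdA.
have TdA := analytic_diffeo_restrict Td (@subIsetr _ Om [set y : V3 | y 0 e2 + e * y 0 e0 != 0]).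
rewrite -/A in TdA.
have hE : (flatten e \o gi) @` (G @` A) = flatten e @` A.
  apply/seteqP; split=> [_ [_ [y Ay <-] <-]|_ [y Ay <-]].
    by exists y => //=; rewrite giG.
  by exists (G y); [exists y|rewrite /= giG].
exists (G @` A), (flatten e \o gi); split=> //.
- by exists x.
- by rewrite hE; apply: (open_image Td) => // y [].
- by rewrite hE; exact: analytic_diffeo_comp gid TdA.
have zero3 (w : V3) : (forall j : 'I_3, (2 <= j)%N -> w 0 j = 0) <-> w 0 e2 = 0.
  by split=> [h|h]; [exact: h|apply: I3P].
apply/seteqP; split=> [_ [z [[Zz nSz] [y Ay e']] <-]|w [[_ [y Ay <-] <-] /zero3]].
  rewrite -e' in Zz *; split; first by exists (G y) => //; exists y.
  apply/zero3; rewrite /= giG // flattenE // (quadE _).1 ?oppr0 //.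
  by apply/ZG => //; case: Ay.
rewrite /= giG // flattenE // => /eqP; rewrite oppr_eq0 => /eqP /quadE cy.
have [Oy sy] := Ay; exists (G y); last by rewrite /= giG.
split; last by exists y.
split; first exact/ZG.
move=> /(SG _ Oy cy) y0; move: sy; rewrite /= y0 !mxE mulr0 addr0 eqxx //.
Qed.

(** This inclusion places the image of 0 under an extended parametrization in [Sing]. That no other
    cone point reaches [Sing] comes from the tangent argument of [diffeo_vertex]. *)
Lemma charted_residual Z Sing C : charted Z Sing C ->
  pre_residual 2 Z Sing /\ residual 2 Z `<=` Sing.
Proof.
move=> hC; have pre : pre_residual 2 Z Sing.
  by split; [case: hC|case: hC|exact: charted_regular_part hC].
by split=> // z; apply.
Qed.

(** Near F x the parametrization is compared with a chart G by H = G^-1 o F, which maps the cone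
    into itself. The study of such H shows that, near each point of the cone, F sends only cone
    points into Z. *)
Lemma extended_is_chart Z Sing C Om F : charted Z Sing C ->
  @extended_parametrization R 2 0 Z Om F ->
  exists Om', ambient_chart Z Sing Om' F /\
    forall x, cone 2 x -> (Om x <-> Om' x).
Proof.
move=> hC [[oO _] [oF Fd] [FZ Fcn] F0 _].
have [_ resS] := charted_residual hC; have [chC covC _ _] := hC.
have FZ' x : Om x -> cone 2 x -> Z (F x).
  by move=> Ox cx; apply: FZ; exists x => //; split=> //; exact/flat_coneE.
have loc x : Om x -> cone 2 x -> (Sing (F x) -> x = 0) /\
    \forall y \near x, Z (F y) -> cone 2 y.
  move=> Ox cx; have [[A G] /chC cG [x' /= Ax' Gx']] := covC _ (FZ' x Ox cx).
  have [oA oG Gd _ [ZG SG]] := cG; rewrite /= in oA oG Gd ZG SG.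
  have [H [HE _ Hd]] := transition oO oA oF oG Fd Gd.
  have GFx : (G @` A) (F x) by exists x'.
  have ld := Hd x Ox GFx; have [h [M [hA hE ME Mu]]] := diffeo_slopes ld.
  have oD := open_preimage oO (let: And3 _ h _ := Fd in h) oG.
  have nD := open_nbhs_nbhs (conj oD (conj Ox GFx)).
  have ZH y : Om y -> (G @` A) (F y) -> (Z (F y) <-> cone 2 (H y)).
    by move=> Oy /HE[AH <-]; rewrite ZG.
  have HC : \forall y \near x, cone 2 y -> cone 2 (H y).
    by apply: filterS nD => y [Oy Gy] cy; apply/ZH => //; exact: FZ'.
  have cHx : cone 2 (H x) by apply/ZH => //; exact: FZ'.
  have [AHx GHx] := HE _ GFx.
  have vert : H x = 0 -> x = 0 by exact: diffeo_vertex hA hE ME Mu cx HC.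
  have near_cone : \forall y \near x, cone 2 (H y) -> cone 2 y.
    case: (pselect (x = 0)) => x0; last first.
      exact: (diffeo_cone_inv_regular ld hA hE ME Mu cx HC x0).
    apply: (diffeo_cone_inv_vertex ld hA hE ME Mu cx HC x0).
    apply/(SG _ AHx cHx); rewrite GHx x0; apply: resS; apply: F0.
    by split; [apply/flat_coneE|]; rewrite -x0.
  split=> [Sx|]; first by apply: vert; apply/(SG _ AHx cHx); rewrite GHx.
  near=> y => Zy; have [Oy Gy] : (Om `&` F @^-1` (G @` A)) y by near: y.
  have : cone 2 (H y) -> cone 2 y by near: y.
  by apply; apply/ZH.
(* Shrinking [Om] discards points off the cone that [F] sends into Z; no cone point is lost, so the
   parametrized piece of the surface is the same. *)
pose Om' := (Om `&` [set y | Z (F y) -> cone 2 y])^°.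
have OmE x : cone 2 x -> (Om x <-> Om' x).
  move=> cx; split=> [Ox|/interior_subset[]//].
  apply: filterI; first exact: open_nbhs_nbhs.
  by have [] := loc x Ox cx.
have sub : Om' `<=` Om by move=> x /interior_subset[].
have UE : @cone R 2 `&` Om' = @flat_cone R 2 0 `&` Om.
  apply/seteqP; split=> [x [cx Ox]|x [/flat_coneE cx Ox]]; split=> //.
  - exact/flat_coneE.
  - exact: sub.
  - exact/OmE.
exists Om'; split=> //; have oO' : open Om' by exact: open_interior.
split=> //.
- exact: open_image Fd oF oO' sub.
- exact: analytic_diffeo_restrict Fd sub.
- by rewrite UE.
split=> x Ox; first by split=> [cx|]; [exact: FZ' (sub _ Ox) cx|case: (interior_subset Ox)].
move=> cx; split=> [x0|]; last by apply: (loc x _ cx).1; exact: sub.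
rewrite x0; apply: resS; apply: F0; rewrite -x0; split; [exact/flat_coneE|exact: sub].
Unshelve. all: by end_near. Qed.

Section Structure.
Variables (Z Sing : set V3) (C : set (set V3 * (V3 -> V3))) (z0 : set_type Z).
Hypothesis hC : charted Z Sing C.

Definition chart_params : set (@local_param R (2 + 1) (set_type Z)) :=
  [set chart_param z0 c.1 c.2 | c in C].

(** [True] fills the place of the side condition [Ax] of [dc_manifold_of_cover]. *)
Definition chart_structure : set (@local_param R (2 + 1) (set_type Z)) :=
  [set P | [/\ inverse_dc_coordinate P, True & forall Q, chart_params Q -> compatible P Q]].

Lemma chart_in_structure Om G : ambient_chart Z Sing Om G ->
  chart_structure (chart_param z0 Om G).
Proof.
move=> cG; split=> //; first exact: chart_inverse_dc cG.
move=> _ [c Cc <-]; apply: chart_compatible cG _.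
by have [chC _ _ _] := hC; exact: chC.
Qed.

Lemma chart_params_cover (z : set_type Z) : exists2 Q, chart_params Q & lp_img Q z.
Proof.
have [chC covC _ _] := hC; have [c Cc Gz] := covC _ (set_valZ z).
exists (chart_param z0 c.1 c.2); first by exists c.
by apply/(chart_img z0 (chC c Cc)).
Qed.

Lemma chart_params_sub : chart_params `<=` chart_structure.
Proof.
by move=> _ [c Cc <-]; apply: chart_in_structure; have [chC _ _ _] := hC; exact: chC.
Qed.

Lemma charted_dc_manifold : @second_countable (set_type Z) -> dc_manifold chart_structure.
Proof.
move=> Z1; apply: (@dc_manifold_of_cover _ _ _ _ chart_params chart_params _ (fun=> True)) => //.
- by apply: set_type_hausdorff; exact: norm_hausdorff.
- by move=> Q /chart_params_sub[iQ _ _]; exact: inverse_dc_tame.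
- exact: chart_params_cover.
- exact: chart_params_sub.
- exact: chart_params_cover.
Qed.

Lemma charted_dc_map_to_space : dc_map_to_space chart_structure (set_val : set_type Z -> V3).
Proof.
move=> P [iP _ cP]; have tP := inverse_dc_tame iP.
apply: analytic_on_local => a Pa; have [Q CQ Qa] := chart_params_cover (P a).
have [g [[[gB _ _] gA _] gE]] := cP Q CQ.
have [iQ _ _] := chart_params_sub CQ; have oQ : open (lp_img Q) by case: (inverse_dc_tame iQ).
have nQ := tame_preimage_near tP oQ Pa Qa.
move: CQ => [c Cc QE]; have [chC _ _ _] := hC; have cG := chC c Cc.
have [_ _ [_ GA _] _ _] := cG.
exists [set b | lp_dom P b -> lp_img Q (P b)], (c.2 \o (@cone_proj R 2 \o g)); split=> //.
- have D'E b : (lp_dom P `&` [set b | lp_dom P b -> lp_img Q (P b)]) b ->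
    (lp_dom P `&` P @^-1` lp_img Q) b by move=> [Pb /(_ Pb)].
  have gdom b : (lp_dom P `&` P @^-1` lp_img Q) b -> c.1 (@cone_proj R 2 (g b)).
    by move=> Db; have [+ _] := gB _ Db; rewrite -QE => -[].
  apply: (analytic_on_comp _ GA); last by move=> b /D'E /gdom.
  apply: (@analytic_on_comp _ _ _ _ _ setT) => //.
    exact: analytic_on_subset gA.
  by apply: analytic_on_at => p _ j; exact: cone_proj_analytic.
- move=> b Pb /(_ Pb) Qb; have Db : (lp_dom P `&` P @^-1` lp_img Q) b by [].
  have dg : lp_dom (chart_param z0 c.1 c.2) (g b) by rewrite QE; case: (gB _ Db).
  by rewrite /= -(gE b Db) -QE (chart_val cG dg).
Qed.

Lemma charted_dc_submanifold : @second_countable (set_type Z) ->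
  @dc_submanifold R 2 0 Z.
Proof.
move=> Z1; split; first by exists Sing; case: (charted_residual hC).
exists chart_structure; split; first exact: charted_dc_manifold.
move=> Om F ext; have [Om' [cF OE]] := extended_is_chart hC ext.
exists (chart_param z0 Om' F); split.
- exact: chart_in_structure.
- apply/seteqP; split=> a [ca /= Oa]; split=> //=.
    by rewrite flat_cone_projE; apply/OE => //; exact: cone_projP.
  by apply/OE; [exact: cone_projP|rewrite -flat_cone_projE].
- by move=> a Pa; rewrite (chart_val cF Pa) flat_cone_projE.
Qed.

End Structure.
End ChartedSets.

(** * The plane and the tube as DC-manifolds *)

Section SecondCountable.

Lemma second_countable_open_image (X Y : topologicalType) (q : X -> Y) :
  continuous q -> (forall U, open U -> open (q @` U)) -> (forall y, exists x, q x = y) ->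
  @second_countable X -> @second_countable Y.
Proof.
move=> qc qo qs [B cB [oB nB]]; exists [set q @` U | U in B].
  exact: sub_countable (card_image_le _ _) cB.
split=> [_ [U BU <-]|y V nV]; first by apply: qo; exact: oB.
have [x xy] := qs y; rewrite -xy in nV *.
have [U [BU Ux] UV] := nB x (q @^-1` V) (qc x V nV).
exists (q @` U); first by split; [exists U|exists x].
by move=> _ [z Uz <-]; exact: UV.
Qed.

Lemma second_countable_set_type (T : topologicalType) (Z : set T) :
  @second_countable T -> @second_countable (set_type Z).
Proof.
move=> [B cB [oB nB]]; exists [set set_val @^-1` U | U in B].
  exact: sub_countable (card_image_le _ _) cB.
split=> [_ [U BU <-]|z V /set_type_nbhsE[W nW WV]].
  by exists U => //; exact: oB.
have [U [BU Uz] UW] := nB _ W nW.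
by exists (set_val @^-1` U); [split=> //; exists U|move=> y Uy; exact/WV/UW].
Qed.

Lemma second_countable_rV (R : realType) k : @second_countable 'rV[R]_k.
Proof.
pose D (p : {ffun 'I_k -> rat} * rat) : set 'rV[R]_k :=
  [set x | `|x - \row_j ratr (p.1 j)| < ratr p.2].
exists (range D).
  by apply: sub_countable (card_image_le _ _) _; exact: countableP.
split=> [_ [p _ <-]|x V /near_normP[r r0 rV]].
  rewrite openE => x /= Dx; apply/near_normP.
  exists (ratr p.2 - `|x - \row_j ratr (p.1 j)|); first by rewrite subr_gt0.
  move=> y xy; rewrite /D /=; set c := \row_j _ in Dx xy *.
  by apply: le_lt_trans (ler_distD x _ _) _; rewrite -/c; lra.
have r2 : 0 < r / 2 by lra.
have [s /[!in_itv] /= /andP[s0 sr]] := rat_in_itvoo r2.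
have [c hc] : exists c : {ffun 'I_k -> rat}, forall j, `|x 0 j - ratr (c j)| < ratr s.
  have h j : exists q : rat, `|x 0 j - ratr q| < ratr s.
    have xs : x 0 j - ratr s < x 0 j + ratr s by lra.
    have [q /[!in_itv] /= /andP[q1 q2]] := rat_in_itvoo xs.
    by exists q; rewrite ltr_distl; apply/andP; split; lra.
  have [c hc] := choice h; exists [ffun j => c j] => j; by rewrite ffunE.
have xc : `|x - \row_j ratr (c j)| < ratr s.
  by apply/rV_norm_ltP => // j; rewrite !mxE.
exists (D (c, s)) => //; first by split=> //; exists (c, s).
move=> y /= yc; apply: rV; apply: le_lt_trans (ler_distD (\row_j ratr (c j)) _ _) _.
by rewrite [X in _ + X]distrC; move: yc xc; rewrite /D /=; lra.
Qed.

End SecondCountable.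

Section Connected.
Context {R : realType}.

Lemma connected_paths (X : topologicalType) (A : set X) (x0 : X) :
  (forall y, A y -> exists g : R -> X, [/\ {within `[0, 1], continuous g},
     g 0 = x0, g 1 = y & forall t, t \in `[0, 1] -> A (g t)]) -> connected A.
Proof.
move=> h.
have -> : A = \bigcup_(B in [set B | [/\ connected B, B x0 & B `<=` A]]) B.
  apply/seteqP; split=> [y Ay|y [B [_ _ BA] /BA //]].
  have [g [gc g0 g1 gA]] := h y Ay; exists (g @` `[0, 1]).
    split.
    - by apply: connected_continuous_connected gc; exact: segment_connected.
    - by exists 0 => //; rewrite /= in_itv /= lexx ler01.
    - by move=> _ [t t01 <-]; exact: gA.
  by exists 1 => //; rewrite /= in_itv /= lexx ler01.
apply: bigcup_connected; first by exists x0 => B [].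
by move=> B [].
Qed.

Lemma continuous_within (X Y : topologicalType) (A : set X) (f : X -> Y) :
  (forall x, A x -> f @ x --> f x) -> {within A, continuous f}.
Proof.
move=> h; apply/withinP => x Ax V nV; have h' : nbhs x (f @^-1` V) by exact: h.
by apply: filterS h'.
Qed.

Lemma segment_path_continuous k (x y : 'rV[R]_k) : continuous (fun t : R => x + t *: (y - x)).
Proof.
move=> t; have h : u *: (y - x) @[u --> t] --> t *: (y - x).
  by apply: (@cvgZr_tmp _ _ _ _ _ id); exact: cvg_id.
exact: (cvgD (cvg_cst x) h). Qed.

Lemma connected_star_image k (X : topologicalType) (A : set 'rV[R]_k) (f : 'rV[R]_k -> X) x0 :
  {within A, continuous f} -> A x0 ->
  (forall y t, A y -> t \in `[0, 1] -> A (x0 + t *: (y - x0))) -> connected (f @` A).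
Proof.
move=> /withinP fc A0 As; apply: (@connected_paths _ _ (f x0)) => _ [y Ay <-].
exists (fun t => f (x0 + t *: (y - x0))); split.
- apply/withinP => t t01 V nV; have hV := fc _ (As _ _ Ay t01) V nV.
  have hT : nbhs t [set u : R | A (x0 + u *: (y - x0)) -> V (f (x0 + u *: (y - x0)))].
    exact: (@segment_path_continuous _ x0 y t _ hV).
  apply: filterS hT => u hu u01.
  by apply: hu; exact: As.
- by rewrite scale0r addr0.
- by rewrite scale1r addrC subrK.
- by move=> t t01; exists (x0 + t *: (y - x0)) => //; exact: As.
Qed.

End Connected.

(** * Null coordinates on a half cone *)

Section NullCoordinates.
Context {R : realType}.
Notation V2 := 'rV[R]_2.
Notation V3 := 'rV[R]_3.

Definition vec2 (a b : R) : V2 := \row_j (if j == 0 then a else b).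

Lemma vec2E (a b : R) : ((vec2 a b 0 0 = a) * (vec2 a b 0 1 = b))%type.
Proof. by rewrite !mxE. Qed.

Lemma rV2P (a b : V2) : a 0 0 = b 0 0 -> a 0 1 = b 0 1 -> a = b.
Proof.
move=> h0 h1; apply/rowP => -[[|[|//]] j2].
- by rewrite (_ : Ordinal j2 = 0) //; apply: val_inj.
- by rewrite (_ : Ordinal j2 = 1) //; apply: val_inj.
Qed.

Lemma vec2K (w : V2) : vec2 (w 0 0) (w 0 1) = w.
Proof. by apply: rV2P; rewrite vec2E. Qed.

Lemma analytic_vec2 k (f g : 'rV[R]_k -> R) p :
  analytic_at f p -> analytic_at g p ->
  forall j, analytic_at (fun x => vec2 (f x) (g x) 0 j) p.
Proof.
move=> fA gA j; have [j0|j0] := eqVneq j 0.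
  by apply: analytic_near fA; near=> x; rewrite mxE j0 eqxx.
by apply: analytic_near gA; near=> x; rewrite mxE (negbTE j0).
Unshelve. all: by end_near. Qed.

(* The half cone x2 + x0 > 0 is the graph of x2 - x0 = x1 ^ 2 / (x2 + x0);
   [half_coords c] maps it to the half plane w0 > c. *)
Definition half_coords (c : R) (x : V3) : V2 := vec2 (c + (x 0 e2 + x 0 e0)) (x 0 e1).

(** Third coordinate 0 before [unflatten] means that the point is on the cone. The shift [c] lets
    the half plane reach any given point. *)
Definition half_point (c : R) (w : V2) : V3 :=
  unflatten 1 (vec3 (w 0 0 - c) (w 0 1) 0).

Definition half_lift (c : R) (w : V2) : 'rV[R]_(2 + 1) :=
  let x := half_point c w in vec3 (x 0 e0 / x 0 e2) (x 0 e1 / x 0 e2) (x 0 e2).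

Lemma half_pointE c (w : V2) : half_point c w =
  vec3 (((w 0 0 - c) - w 0 1 ^+ 2 / (w 0 0 - c)) / 2) (w 0 1)
       (((w 0 0 - c) + w 0 1 ^+ 2 / (w 0 0 - c)) / 2).
Proof. by rewrite /half_point /unflatten !vec3E mul1r add0r. Qed.

Lemma half_pointK c (w : V2) : c < w 0 0 -> half_coords c (half_point c w) = w.
Proof.
move=> cw; have n0 : w 0 0 - c != 0 by rewrite subr_eq0 gt_eqF.
by rewrite half_pointE /half_coords !vec3E -[RHS]vec2K; congr vec2; field.
Qed.

Lemma half_point_cone c (w : V2) : c < w 0 0 -> @cone R 2 (half_point c w).
Proof.
move=> cw; have n0 : w 0 0 - c != 0 by rewrite subr_eq0 gt_eqF.
by apply/coneE; rewrite half_pointE !vec3E; field.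
Qed.

Lemma half_coordsK c (x : V3) : cone 2 x -> c < half_coords c x 0 0 ->
  half_point c (half_coords c x) = x.
Proof.
move=> /coneE cx; rewrite half_pointE /half_coords !vec2E ltrDl => s0.
have n0 : x 0 e2 + x 0 e0 != 0 by rewrite gt_eqF.
have -> : c + (x 0 e2 + x 0 e0) - c = x 0 e2 + x 0 e0 by ring.
have -> : x 0 e1 ^+ 2 / (x 0 e2 + x 0 e0) = x 0 e2 - x 0 e0.
  apply: (mulIf n0); rewrite divfK //; transitivity (x 0 e2 ^+ 2 - x 0 e0 ^+ 2); last by ring.
  by rewrite -cx; ring.
by apply: rV3P; rewrite !vec3E //; field.
Qed.

Lemma half_point_axis c (w : V2) : c < w 0 0 -> 0 < half_point c w 0 e2.
Proof.
move=> cw; have s0 : 0 < w 0 0 - c by rewrite subr_gt0.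
have : 0 <= w 0 1 ^+ 2 / (w 0 0 - c) by apply: mulr_ge0; rewrite ?sqr_ge0 ?invr_ge0 // ltW.
by rewrite half_pointE !vec3E; lra.
Qed.

Lemma half_liftP c (w : V2) : c < w 0 0 ->
  cylinder 2 (half_lift c w) /\ cone_proj (half_lift c w) = half_point c w.
Proof.
move=> cw; have := half_point_cone cw; have := half_point_axis cw.
rewrite /half_lift; move: (half_point c w) => x x2 /coneE cx.
have n0 : x 0 e2 != 0 by rewrite gt_eqF.
split; first by apply/cylinderE; rewrite !vec3E !expr_div_n -mulrDl cx divff // expf_neq0.
by rewrite cone_projE !vec3E; apply: rV3P; rewrite !vec3E //; field.
Qed.

Lemma half_point_analytic c (w : V2) : c < w 0 0 ->
  forall j, analytic_at (fun w : V2 => half_point c w 0 j) w.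
Proof.
move=> cw; have n0 : w 0 0 - c != 0 by rewrite subr_eq0 gt_eqF.
have sA : analytic_at (fun w : V2 => w 0 0 - c) w.
  by apply: analytic_sub; [exact: analytic_coord|exact: analytic_cst].
have tA : analytic_at (fun w : V2 => w 0 1 ^+ 2 / (w 0 0 - c)) w.
  by apply: analytic_div => //; apply: analytic_exp; exact: analytic_coord.
move=> j; have := @analytic_vec3 _ _
  (fun w : V2 => ((w 0 0 - c) - w 0 1 ^+ 2 / (w 0 0 - c)) / 2) (fun w => w 0 1)
  (fun w => ((w 0 0 - c) + w 0 1 ^+ 2 / (w 0 0 - c)) / 2) w.
move=> h; apply: analytic_near (h _ _ _ j).
- by near=> x; rewrite half_pointE.
- by apply: analytic_mul; [exact: analytic_sub|exact: analytic_cst].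
- exact: analytic_coord.
- by apply: analytic_mul; [exact: analytic_add|exact: analytic_cst].
Unshelve. all: by end_near. Qed.

Lemma half_lift_analytic c (w : V2) : c < w 0 0 ->
  forall j, analytic_at (fun w : V2 => half_lift c w 0 j) w.
Proof.
move=> cw; have hA := half_point_analytic cw.
have n0 : half_point c w 0 e2 != 0 by rewrite gt_eqF //; exact: half_point_axis.
apply: analytic_vec3; last exact: hA.
  by apply: analytic_div => //; exact: hA.
by apply: analytic_div => //; exact: hA.
Qed.

Lemma half_coords_analytic c (x : V3) : forall j, analytic_at (fun x : V3 => half_coords c x 0 j) x.
Proof.
apply: analytic_vec2; last exact: analytic_coord.
apply: analytic_add; first exact: analytic_cst.
by apply: analytic_add; exact: analytic_coord.
Qed.

Lemma analytic_cvg k l (f : 'rV[R]_k -> 'rV[R]_l) p :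
  (forall j, analytic_at (fun x => f x 0 j) p) -> f @ p --> f p.
Proof. by move=> fA; apply: rV_continuous => j; exact: analytic_continuous. Qed.

End NullCoordinates.

(** * Quotients of the plane by translations as DC-manifolds *)

Section Deck.
Context {R : realType} {X : topologicalType}.
Notation V2 := 'rV[R]_2.
Notation V3 := 'rV[R]_3.
Notation dcp := (@local_param R (2 + 1) X).
Hypothesis X2 : hausdorff_space X.
Variable q : V2 -> X.
Hypothesis qc : continuous q.
Hypothesis qo : forall U, open U -> open (q @` U).
Hypothesis deck : forall w w', q w = q w' -> forall x, q (x + (w' - w)) = q x.

Definition sheet (D : set V2) :=
  open D /\ forall w w', D w -> D w' -> q w = q w' -> w = w'.

(** An inverse DC-coordinate has to start from the cone, so an ordinary chart is read on a half
    cone, a copy of the half plane w0 > c that avoids the vertex. *)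
Definition half_sheet (c : R) (D : set V2) :=
  [/\ sheet D, connected D & forall w, D w -> c < w 0 0].

Definition half_param (c : R) (D : set V2) : dcp :=
  LocalParam (@cylinder R 2 `&` [set a | D (half_coords c (@cone_proj R 2 a))])
             (fun a => q (half_coords c (@cone_proj R 2 a))).

Lemma injective_tame k (Q : @local_param R k X) :
  {within lp_dom Q, continuous Q} -> open (lp_img Q) ->
  (forall b b', lp_dom Q b -> lp_dom Q b' -> Q b = Q b' -> b = b') -> tame_param Q.
Proof.
move=> Qc Qo Qi; split=> //.
  by exists set0; split=> // b b' Qb Qb' e; left; exact: Qi.
move=> a W Qa /nbhs_singleton Wa; exists a; split=> // b Qb e; exact: Qi.
Qed.

Lemma sheet_tame D : sheet D -> tame_param (LocalParam D q).
Proof.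
move=> [oD Dinj]; apply: injective_tame => //=; last exact: qo.
by apply: continuous_within => x _; exact: qc.
Qed.

Lemma half_coords_cont c (x : V3) : half_coords c @ x --> half_coords c x.
Proof. by apply: analytic_cvg; exact: half_coords_analytic. Qed.

Section HalfParam.
Variables (c : R) (D : set V2).
Hypothesis hD : half_sheet c D.
Let P := half_param c D.

Lemma half_param_lift w : D w ->
  lp_dom P (half_lift c w) /\ P (half_lift c w) = q w.
Proof.
have [_ _ Dc] := hD => Dw; have [cy pE] := half_liftP (Dc _ Dw).
by rewrite /P /= pE half_pointK //; exact: Dc.
Qed.

Lemma half_param_img : lp_img P = q @` D.
Proof.
apply/seteqP; split=> [_ [a [ca Da] <-]|_ [w Dw <-]].
  by exists (half_coords c (@cone_proj R 2 a)).
by have [Pw <-] := half_param_lift Dw; exists (half_lift c w).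
Qed.

Lemma half_param_axis a : lp_dom P a -> a 0 e2 != 0.
Proof.
have [_ _ Dc] := hD => -[ca /= /Dc]; rewrite /half_coords vec2E ltrDl.
by case: eqVneq => // a0; rewrite cone_proj0 // !mxE addr0 ltxx.
Qed.

Lemma half_param_inj a b : lp_dom P a -> lp_dom P b -> P a = P b -> a = b.
Proof.
have [[_ Dinj] _ Dc] := hD => Pa Pb /= e; have a0 := half_param_axis Pa.
have [ca Da] := Pa; have [cb Db] := Pb; have {}e := Dinj _ _ Da Db e.
apply: cone_proj_inj a0; rewrite -(half_coordsK (cone_projP ca) (Dc _ Da)) e.
by apply: (half_coordsK (cone_projP cb)); exact: Dc.
Qed.

Lemma half_param_inverse_dc : inverse_dc_coordinate P.
Proof.
have [[oD Dinj] cD Dc] := hD.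
pose U := @cone R 2 `&` [set x | D (half_coords c x)].
have imgE : (fun x => q (half_coords c x)) @` U = q @` D.
  apply/seteqP; split=> [_ [x [cx Dx] <-]|_ [w Dw <-]]; first by exists (half_coords c x).
  exists (half_point c w); last by rewrite half_pointK //; exact: Dc.
  by split; [apply: half_point_cone; exact: Dc|rewrite /= half_pointK //; exact: Dc].
exists U, (fun x => q (half_coords c x)); rewrite imgE; split=> //.
- exists [set x | D (half_coords c x)] => //.
  by apply: (open_comp _ oD) => x _; exact: half_coords_cont.
- split.
  + split=> [x [cx Dx]|x y /set_mem[cx Dx] /set_mem[cy Dy] e|_ [w Dw <-]].
    * by exists (half_coords c x).
    * by rewrite -(half_coordsK cx (Dc _ Dx)) (Dinj _ _ Dx Dy e) half_coordsK //; exact: Dc.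
    * by have : (q @` D) (q w); [exists w|rewrite -imgE].
  + apply: continuous_within => x _ V /qc h; exact: (half_coords_cont h).
  have sec y : exists w, (q @` D) y -> D w /\ q w = y.
    by case: (pselect ((q @` D) y)) => [[w Dw <-]|n]; [exists w|exists 0].
  have [s sE] := choice sec; have sq w : D w -> s (q w) = w.
    by move=> Dw; have [|Ds e] := sE (q w); [exists w|apply: Dinj].
  exists (half_point c \o s); split=> [x [cx Dx]|].
    by rewrite /= sq // half_coordsK //; exact: Dc.
  apply/withinP => _ [w Dw <-] V; rewrite /= sq // => nV.
  have nW : nbhs w (D `&` half_point c @^-1` V).
    apply: filterI; first exact: open_nbhs_nbhs.
    by apply: (analytic_cvg (half_point_analytic (Dc _ Dw))) nV.
  have := open_nbhs_nbhs (conj (qo (open_interior (D `&` half_point c @^-1` V))) _).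
  move=> /(_ (q w)) h; have {}h := h (ex_intro2 _ _ w nW erefl).
  apply: filterS h => _ [w' /interior_subset[Dw' Vw'] <-] _.
  by rewrite /= sq.
- split; first exact: qo.
  by apply: connected_continuous_connected => //; apply: continuous_within => x _; exact: qc.
- by apply/seteqP; split=> a [ca Da]; split=> //; [split=> //; exact: cone_projP|case: Da].
Qed.

(** Two sheets over the same point differ locally by a deck translation, so the transition is
    [half_coords] or [half_lift] combined with a translation. *)
Lemma half_param_compatible D' : sheet D' -> compatible P (LocalParam D' q).
Proof.
move=> hD'; have [oD' Dinj'] := hD'; have [[oD Dinj] cD Dc] := hD.
set Q := LocalParam D' q.
have pA (x : 'rV[R]_(2 + 1)) (d : V2) j :
    analytic_at (fun y => (half_coords c (@cone_proj R 2 y) + d) 0 j) x.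
  have h : analytic_at (fun y : 'rV[R]_(2 + 1) => half_coords c (@cone_proj R 2 y) 0 j + d 0 j) x.
    apply: analytic_add; last exact: analytic_cst.
    apply: (@analytic_comp _ _ _ (fun x : V3 => half_coords c x 0 j)).
      by move=> i; exact: cone_proj_analytic.
    exact: half_coords_analytic.
  by apply: analytic_near h; near=> y; rewrite [RHS]mxE.
have [F [FA FE]] : exists F, analytic_on (lp_dom P `&` P @^-1` lp_img Q) F /\
    forall a, (lp_dom P `&` P @^-1` lp_img Q) a -> lp_dom Q (F a) /\ Q (F a) = P a.
  apply: lift_glue_inj; first exact: Dinj'.
  move=> a [[ca Da] [w' Dw' /= e]].
  (* The translation taking the coordinates of a to the point w' of the other sheet over the same
     image. *)
  pose F b := half_coords c (@cone_proj R 2 b) + (w' - half_coords c (@cone_proj R 2 a)).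
  exists [set b | D' (F b)], F; split.
  - have Fa : F a = w' by rewrite /F addrC subrK.
    have nF : nbhs (F a) D' by apply: open_nbhs_nbhs; split; rewrite ?Fa.
    exact: (@analytic_cvg R _ _ F a (fun j => pA a _ j) _ nF).
  - by apply: analytic_on_at => b _; exact: pA.
  - by move=> b _ Fb; split=> //=; rewrite deck.
have [F' [F'A F'E]] : exists F, analytic_on (lp_dom Q `&` Q @^-1` lp_img P) F /\
    forall a, (lp_dom Q `&` Q @^-1` lp_img P) a -> lp_dom P (F a) /\ P (F a) = Q a.
  apply: lift_glue_inj; first exact: half_param_inj.
  rewrite half_param_img => b [Db [w Dw /= e]].
  have bA j (d x : V2) : analytic_at (fun x : V2 => (x + d) 0 j) x.
    have h : analytic_at (fun x : V2 => x 0 j + d 0 j) x.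
      by apply: analytic_add; [exact: analytic_coord|exact: analytic_cst].
    by apply: analytic_near h; near=> y; rewrite [RHS]mxE.
  exists [set b' | D (b' + (w - b))], (fun b' => half_lift c (b' + (w - b))); split.
  - have nF : nbhs (b + (w - b)) D by apply: open_nbhs_nbhs; split=> //; rewrite addrC subrK.
    exact: (@analytic_cvg R _ _ (fun x => x + (w - b)) b (fun j => bA j _ b) _ nF).
  - apply: analytic_on_at => b' [_ /= Db'] j.
    apply: (@analytic_comp _ _ _ (fun w : V2 => half_lift c w 0 j)) => //.
    by apply: half_lift_analytic; exact: Dc.
  - move=> b' _ Db'; have [h e'] := half_param_lift Db'; split=> //.
    by apply: (etrans e'); rewrite deck.
apply: (compatible_of_lifts _ _ FA F'A FE F'E); last exact: sheet_tame.
apply: inverse_dc_tame; exact: half_param_inverse_dc.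
Unshelve. all: by end_near. Qed.

End HalfParam.

Variable C : set (@local_param R 2 X).
Hypothesis CE : forall Q, C Q -> exists2 D, sheet D & Q = LocalParam D q.
Hypothesis covC : forall x, exists2 Q, C Q & lp_img Q x.
Hypothesis covH : forall x, exists c D, half_sheet c D /\ (q @` D) x.

Lemma atlas_tame Q : C Q -> tame_param Q.
Proof. by move=> /CE[D hD ->]; exact: sheet_tame. Qed.

Lemma atlas_dc_manifold : @second_countable X -> dc_manifold (@dc_of_atlas R 2 X C).
Proof.
move=> X1; pose S := [set P | exists c D, half_sheet c D /\ P = half_param c D].
have SA : S `<=` @dc_of_atlas R 2 X C.
  move=> _ [c [D [hD ->]]]; split; first exact: half_param_inverse_dc.
  - by move=> a Pa; rewrite axisE; exact: half_param_axis Pa.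
  - by move=> _ /CE[D' hD' ->]; exact: half_param_compatible.
have covS x : exists2 Q, S Q & lp_img Q x.
  have [c [D [hD Dx]]] := covH x; exists (half_param c D); first by exists c, D.
  by rewrite half_param_img.
apply: (@dc_manifold_of_cover _ _ _ _ C S _ (fun P => forall a, lp_dom P a -> axis a != 0)) => //.
  exact: atlas_tame.
move=> P iP cP; apply: (axis_neq0_transfer iP covS _ cP) => Q SQ.
by have [] := SA Q SQ.
Qed.

Lemma atlas_analytic l (P : dcp) (V : set X) (lam : X -> 'rV[R]_l) : open V ->
  dc_of_atlas C P -> analytic_on (q @^-1` V) (lam \o q) ->
  analytic_on (lp_dom P `&` P @^-1` V) (lam \o P).
Proof.
move=> oV [iP _ cP] lA; have tP := inverse_dc_tame iP.
apply: analytic_on_local => a [Pa Va]; have [Q CQ Qa] := covC (P a).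
have [g [[[gB _ _] gA _] gE]] := cP Q CQ; have [_ oQ _ _] := atlas_tame CQ.
have nQ := tame_preimage_near tP oQ Pa Qa.
exists [set b | lp_dom P b -> lp_img Q (P b)], ((lam \o q) \o g); split=> //.
- apply: (analytic_on_comp _ lA).
    by apply: analytic_on_subset gA => b [[Pb _] /(_ Pb)].
  move=> b [[Pb Vb] /(_ Pb) Qb]; rewrite /preimage /=.
  by have := gE b (conj Pb Qb); have [D _ ->] := CE CQ => /= ->.
- move=> b [Pb _] /(_ Pb) Qb /=.
  by have := gE b (conj Pb Qb); have [D _ ->] := CE CQ => /= ->.
Qed.

Lemma atlas_dc_map_to_space n (f : X -> 'rV[R]_n) :
  analytic_on setT (f \o q) -> dc_map_to_space (dc_of_atlas C) f.
Proof.
move=> fA P AP; have := @atlas_analytic _ P setT f openT AP.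
by rewrite preimage_setT setIT; apply.
Qed.

End Deck.

Section Models.
Context {R : realType}.
Notation V2 := 'rV[R]_2.
Notation V3 := 'rV[R]_3.

Lemma hausdorff_inj (X Y : topologicalType) (f : X -> Y) :
  continuous f -> injective f -> hausdorff_space Y -> hausdorff_space X.
Proof.
move=> fc fi hY x y xy; apply: fi; apply: hY => A B nA nB.
have [z [Az Bz]] := xy _ _ (fc _ _ nA) (fc _ _ nB); by exists (f z).
Qed.

Lemma segment_gt (c x y t : R) : c < x -> c < y -> t \in `[0, 1] -> c < x + t * (y - x).
Proof.
rewrite in_itv /= => cx cy /andP[t0 t1]; have [xy|yx] := lerP x y.
  have h : 0 <= t * (y - x) by apply: mulr_ge0; rewrite ?subr_ge0.
  by move: h; move: (t * (y - x)) => z; lra.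
have h : 0 <= (1 - t) * (x - y) by apply: mulr_ge0; rewrite subr_ge0 // ltW.
have -> : x + t * (y - x) = y + (1 - t) * (x - y) by ring.
by move: h; move: ((1 - t) * (x - y)) => z; lra.
Qed.

Lemma connected_star k (A : set 'rV[R]_k) x0 : A x0 ->
  (forall y t, A y -> t \in `[0, 1] -> A (x0 + t *: (y - x0))) -> connected A.
Proof.
move=> A0 As; rewrite -(image_id A); apply: (connected_star_image _ A0 As).
by apply: continuous_within => x _; exact: cvg_id.
Qed.

Lemma rV_coord_continuous k (j : 'I_k) : continuous (fun w : 'rV[R]_k => w 0 j).
Proof. by move=> w; apply: analytic_continuous; exact: analytic_coord. Qed.

Lemma half_space_gt_open k (j : 'I_k) (c : R) : open [set w : 'rV[R]_k | c < w 0 j].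
Proof.
apply: (@open_comp _ _ (fun w : 'rV[R]_k => w 0 j) [set x | c < x]); last exact: open_gt.
by move=> w _; exact: rV_coord_continuous.
Qed.

Lemma half_space_lt_open k (j : 'I_k) (c : R) : open [set w : 'rV[R]_k | w 0 j < c].
Proof.
apply: (@open_comp _ _ (fun w : 'rV[R]_k => w 0 j) [set x | x < c]); last exact: open_lt.
by move=> w _; exact: rV_coord_continuous.
Qed.

Definition plane_map (w : V2) : R * R := (w 0 0, w 0 1).
Definition tube_map (w : V2) : R * T1 R := (w 0 0, to_T1 (w 0 1)).

Lemma plane_map_continuous : continuous plane_map.
Proof. by move=> w; exact: (cvg_pair (@rV_coord_continuous 2 0 w) (@rV_coord_continuous 2 1 w)). Qed.

Lemma to_T1_continuous : continuous (@to_T1 R).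
Proof. exact: pi_continuous. Qed.

Lemma tube_map_continuous : continuous tube_map.
Proof.
move=> w; have h : (fun w : V2 => to_T1 (w 0 1)) @ w --> to_T1 (w 0 1).
  exact: (continuous_comp (@rV_coord_continuous 2 1 w) (@to_T1_continuous _)).
exact: (cvg_pair (@rV_coord_continuous 2 0 w) h).
Qed.

Lemma to_T1P (a b : R) : to_T1 a = to_T1 b <-> exists k : int, b = a + k%:~R * (2 * pi).
Proof.
split=> [/(@eqmodP _ (circle_equiv R)) /asboolP //|h].
by apply/(@eqmodP _ (circle_equiv R))/asboolP.
Qed.

Lemma of_T1K : cancel (@of_T1 R) (@to_T1 R).
Proof. by move=> t; exact: reprK. Qed.

Lemma plane_map_open U : open U -> open (plane_map @` U).
Proof.
move=> oU; rewrite (_ : _ @` _ = (fun p : R * R => vec2 p.1 p.2) @^-1` U); last first.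
  apply/seteqP; split=> [_ [w Uw <-]|[a b] Uab]; first by rewrite /preimage /= vec2K.
  by exists (vec2 a b) => //; rewrite /plane_map !vec2E.
apply: (open_comp _ oU) => p _; apply: rV_continuous => j.
have [->|j0] := eqVneq j 0.
  rewrite (_ : (fun x : R * R => _) = fst); last by apply/funext => x; rewrite vec2E.
  by rewrite vec2E; exact: cvg_fst.
rewrite (_ : (fun x : R * R => _) = snd); last by apply/funext => x; rewrite mxE (negbTE j0).
by rewrite mxE (negbTE j0); exact: cvg_snd.
Qed.

Lemma to_T1_open (V : set R) : open V -> open (@to_T1 R @` V).
Proof.
move=> oV; rewrite /open /= /quotient_open.
rewrite (_ : _ @^-1` _ = \bigcup_(k in [set: int]) (fun x => x + k%:~R * (2 * pi)) @^-1` V).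
  apply: bigcup_open => k _; apply: (open_comp _ oV) => x _.
  exact: (cvgD cvg_id (cvg_cst _)).
apply/seteqP; split=> [x [y Vy /esym e]|x [k _ Vx]].
  have /to_T1P[k yE] : to_T1 x = to_T1 y by exact: e.
  by exists k => //; rewrite /preimage /= -yE.
exists (x + k%:~R * (2 * pi)) => //.
by apply/esym; apply/to_T1P; exists k.
Qed.

Lemma tube_map_open U : open U -> open (tube_map @` U).
Proof.
move=> oU; rewrite openE => _ [w Uw <-]; have /near_normP[r r0 rU] := open_nbhs_nbhs (conj oU Uw).
have oB (a : R) : open [set x : R | `|x - a| < r].
  rewrite openE => x /= xa; apply/nbhs_ballP; exists (r - `|x - a|); first by rewrite /= subr_gt0.
  move=> y; rewrite -ball_normE /= => yx.
  by apply: le_lt_trans (ler_distD x _ _) _; rewrite (distrC y); lra.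
have n1 : nbhs (w 0 0) [set x : R | `|x - w 0 0| < r].
  by apply: open_nbhs_nbhs; split=> //=; rewrite subrr normr0.
have n2 : nbhs (to_T1 (w 0 1)) (@to_T1 R @` [set x | `|x - w 0 1| < r]).
  apply: open_nbhs_nbhs; split; first exact: to_T1_open.
  by exists (w 0 1) => //=; rewrite subrr normr0.
exists ([set x : R | `|x - w 0 0| < r], @to_T1 R @` [set x | `|x - w 0 1| < r]) => //.
move=> [a _] [/= ar [b br <-]]; exists (vec2 a b); last by rewrite /tube_map !vec2E.
apply: rU; apply/rV_norm_ltP => // -[[|[|//]] h]; rewrite !mxE /=.
- by rewrite (_ : Ordinal h = 0) //; exact: val_inj.
- by rewrite (_ : Ordinal h = 1) //; exact: val_inj.
Qed.

Lemma sin_periodz (k : int) (x : R) : sin (x + k%:~R * (2 * pi)) = sin x.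
Proof.
have nat n y : sin (y + n%:R * (2 * pi)) = sin y :> R.
  by rewrite mulr_natl [2 * pi]mulr_natl (periodicn (@sinD2pi R)).
case: k => n; first exact: nat.
by rewrite -(nat n.+1) -addrA NegzE mulrNz mulNr addNr addr0.
Qed.

Lemma cos_periodz (k : int) (x : R) : cos (x + k%:~R * (2 * pi)) = cos x.
Proof.
have nat n y : cos (y + n%:R * (2 * pi)) = cos y :> R.
  by rewrite mulr_natl [2 * pi]mulr_natl (periodicn (@cosD2pi R)).
case: k => n; first exact: nat.
by rewrite -(nat n.+1) -addrA NegzE mulrNz mulNr addNr addr0.
Qed.

Lemma sin_of_T1 (v : R) : sin (of_T1 (to_T1 v)) = sin v.
Proof.
have /to_T1P[k {2}->] : to_T1 (of_T1 (to_T1 v)) = to_T1 v by exact: of_T1K.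
by rewrite sin_periodz.
Qed.

Lemma cos_of_T1 (v : R) : cos (of_T1 (to_T1 v)) = cos v.
Proof.
have /to_T1P[k {2}->] : to_T1 (of_T1 (to_T1 v)) = to_T1 v by exact: of_T1K.
by rewrite cos_periodz.
Qed.

(** The difference is reduced modulo 2 pi to e in [0, 2 pi) with cosine 1 and sine 0; the sign of
    the sine on (0, pi) and (pi, 2 pi) leaves e = 0 or pi, and the cosine excludes pi. *)
Lemma circle_inj (a b : R) : cos a = cos b -> sin a = sin b ->
  exists k : int, b = a + k%:~R * (2 * pi).
Proof.
move=> ec es; have pi0 := pi_gt0 R; have p20 : 0 < 2 * pi :> R by lra.
pose k := Num.floor ((b - a) / (2 * pi)).
pose e := b - a - k%:~R * (2 * pi).
have e0 : 0 <= e by rewrite subr_ge0 -ler_pdivlMr //; exact: floor_le.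
have e2 : e < 2 * pi.
  rewrite ltrBlDr -{1}[2 * pi]mul1r -mulrDl -ltr_pdivrMr // (addrC 1).
  by have := floorD1_gt ((b - a) / (2 * pi)); rewrite intrD.
have eE : e = b - a + (- k)%:~R * (2 * pi) by rewrite mulrNz mulNr.
have ce : cos e = 1 by rewrite eE cos_periodz cosB ec es -!expr2 cos2Dsin2.
have se : sin e = 0 by rewrite eE sin_periodz sinB ec es mulrC subrr.
exists k; suff : e = 0 by rewrite /e; lra.
have [ep|ep|ep] := ltgtP e pi.
- have [//|e1] : e = 0 \/ 0 < e by case: (ltgtP e 0) e0 => //; [right|left].
  by have := @sin_gt0_pi R e; rewrite e1 ep se ltxx => /(_ isT).
- have := @sin_gt0_pi R (e - pi).
  have -> : 0 < e - pi < pi by apply/andP; split; lra.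
  by rewrite sinB cospi sinpi se mul0r mulr0 subr0 ltxx => /(_ isT).
- by move: ce; rewrite ep cospi; lra.
Qed.

(** The tube injects continuously into R^3 as the round cylinder. *)
Lemma tube_hausdorff : hausdorff_space (R * T1 R)%type.
Proof.
pose f (p : R * T1 R) : V3 := vec3 p.1 (cos (of_T1 p.2)) (sin (of_T1 p.2)).
apply: (@hausdorff_inj _ V3 f); last exact: norm_hausdorff.
- have Tc (g : R -> R) : continuous g -> (forall (k : int) x, g (x + k%:~R * (2 * pi)) = g x) ->
      continuous (fun p : R * T1 R => g (of_T1 p.2)).
    move=> gc gp p; have h : continuous (g \o @of_T1 R).
      apply: repr_comp_continuous => // a b /eqP /to_T1P[k ->].
      by rewrite gp.
    have h2 : (fun p : R * T1 R => p.2) @ p --> p.2 by exact: cvg_snd.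
    exact: (@continuous_comp _ _ _ snd (g \o @of_T1 R) p h2 (h p.2)).
  move=> p; apply: rV_continuous; apply: I3P.
  + rewrite (_ : (fun x => _) = fst); last by apply/funext => x; rewrite vec3E.
    by rewrite vec3E; exact: cvg_fst.
  + rewrite (_ : (fun x => _) = fun p => cos (of_T1 p.2)); last by apply/funext => x; rewrite vec3E.
    by rewrite vec3E; apply: Tc; [exact: continuous_cos|exact: cos_periodz].
  + rewrite (_ : (fun x => _) = fun p => sin (of_T1 p.2)); last by apply/funext => x; rewrite vec3E.
    by rewrite vec3E; apply: Tc; [exact: continuous_sin|exact: sin_periodz].
- move=> [a s] [b t] e.
  have h j := congr1 (fun x : V3 => x 0 j) e.
  have := h e0; have := h e1; have := h e2; rewrite !vec3E /= => es ec ->.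
  by rewrite -(of_T1K s) -(of_T1K t); congr pair; apply/to_T1P; exact: circle_inj.
Qed.

End Models.

Lemma open_surj_continuous (X Y Z : topologicalType) (q : X -> Y) (f : Y -> Z) :
  (forall U, open U -> open (q @` U)) -> (forall y, exists x, q x = y) ->
  continuous (f \o q) -> continuous f.
Proof.
move=> qo qs fqc; apply/continuousP => A oA.
rewrite (_ : _ @^-1` _ = q @` ((f \o q) @^-1` A)).
  by apply: qo; move/continuousP: fqc; exact.
apply/seteqP; split=> [y Ay|_ [x Ax <-] //].
by have [x xy] := qs y; exists x => //; rewrite /preimage /= xy.
Qed.

Section Atlases.
Context {R : realType}.
Notation V2 := 'rV[R]_2.
Local Notation plane_map := (@plane_map R).
Local Notation tube_map := (@tube_map R).

Lemma plane_map_inj : injective plane_map.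
Proof. by move=> w w' [h0 h1]; exact: rV2P. Qed.

Lemma plane_map_surj y : exists w, plane_map w = y.
Proof. by case: y => a b; exists (vec2 a b); rewrite /plane_map !vec2E. Qed.

Lemma tube_map_surj y : exists w, tube_map w = y.
Proof. by case: y => a t; exists (vec2 a (of_T1 t)); rewrite /tube_map !vec2E of_T1K. Qed.

Lemma plane_sheet (D : set V2) : open D -> sheet plane_map D.
Proof. by move=> oD; split=> // w w' _ _ /plane_map_inj. Qed.

Lemma plane_deck w w' : plane_map w = plane_map w' ->
  forall x, plane_map (x + (w' - w)) = plane_map x.
Proof. by move=> /plane_map_inj -> x; rewrite subrr addr0. Qed.

Lemma plane_hausdorff : hausdorff_space (R * R)%type.
Proof. exact: norm_hausdorff. Qed.

Lemma plane_atlasE (Q : local_param 2 (R * R)) : @plane_atlas R Q ->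
  exists2 D, sheet plane_map D & Q = LocalParam D plane_map.
Proof. by move=> ->; exists setT => //; apply: plane_sheet; exact: openT. Qed.

Lemma plane_atlas_cover (x : R * R) : exists2 Q, @plane_atlas R Q & lp_img Q x.
Proof.
exists (LocalParam setT plane_map) => //.
by have [w <-] := plane_map_surj x; exists w.
Qed.

Lemma tube_map_deck w w' : tube_map w = tube_map w' ->
  forall x, tube_map (x + (w' - w)) = tube_map x.
Proof.
move=> [h0 /to_T1P[k h1]] x; rewrite /tube_map !mxE -h0 subrr addr0; congr pair.
by apply/esym/to_T1P; exists k; rewrite h1 [_ + _ - _]addrC addKr.
Qed.

Definition strip (a : R) : set V2 := [set w | w 0 1 \in `]a, a + 2 * pi[].

Lemma strip_sheet a (D : set V2) : open D -> D `<=` strip a -> sheet tube_map D.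
Proof.
move=> oD Da; split=> // w w' /Da wa /Da w'a [h0 /to_T1P[k h1]].
move: wa w'a; rewrite /strip /= !in_itv /= h1 => /andP[a1 a2] /andP[b1 b2].
have pi0 := pi_gt0 R; suff k0 : k = 0 by apply: rV2P => //; rewrite h1 k0 mul0r addr0.
have : -1 < k%:~R :> R by rewrite -(ltr_pM2r (_ : 0 < 2 * pi)) ?mulr_gt0 //; lra.
have : k%:~R < 1 :> R by rewrite -(ltr_pM2r (_ : 0 < 2 * pi)) ?mulr_gt0 //; lra.
rewrite (_ : -1 = (-1)%:~R) // (_ : 1 = 1%:~R :> R) // !ltr_int.
by clear; case: k => [[|n]|n].
Qed.

Lemma strip_open a : open (strip a).
Proof.
rewrite (_ : strip a = [set w | a < w 0 1] `&` [set w | w 0 1 < a + 2 * pi]).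
  by apply: openI; [exact: half_space_gt_open|exact: half_space_lt_open].
by apply/seteqP; split=> w; rewrite /strip /= in_itv /= => /andP.
Qed.

Lemma tube_atlasE (Q : local_param 2 (R * T1 R)) : @tube_atlas R Q ->
  exists2 D, sheet tube_map D & Q = LocalParam D tube_map.
Proof.
move=> [a ->]; exists (strip a) => //.
by apply: (@strip_sheet a) => //; exact: strip_open.
Qed.

Lemma strip_mid (b : R) : b \in `](b - pi), (b - pi + 2 * pi)[.
Proof. by have := pi_gt0 R; rewrite in_itv /= => p; apply/andP; split; lra. Qed.

Lemma tube_atlas_cover (x : R * T1 R) : exists2 Q, @tube_atlas R Q & lp_img Q x.
Proof.
have [w <-] := tube_map_surj x.
exists (LocalParam (strip (w 0 1 - pi)) tube_map); first by exists (w 0 1 - pi).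
by exists w => //; exact: strip_mid.
Qed.

Lemma segment_lt (c x y t : R) : x < c -> y < c -> t \in `[0, 1] -> x + t * (y - x) < c.
Proof.
move=> xc yc t01; have := @segment_gt R (- c) (- x) (- y) t.
rewrite !ltrN2 => /(_ xc yc t01); rewrite (_ : _ + _ = - (x + t * (y - x))) ?ltrN2 //; ring.
Qed.

Lemma plane_half_cover (x : R * R) : exists c D, half_sheet plane_map c D /\ (plane_map @` D) x.
Proof.
have [w <-] := plane_map_surj x; pose D := [set y : V2 | w 0 0 - 1 < y 0 0].
have Dw : D w by rewrite /D /=; lra.
exists (w 0 0 - 1), D; split; last by exists w.
split=> //; first by apply: plane_sheet; exact: half_space_gt_open.
apply: (connected_star Dw) => y t Dy t01.
by rewrite /D /= !mxE; exact: segment_gt.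
Qed.

Lemma tube_half_cover (x : R * T1 R) : exists c D, half_sheet tube_map c D /\ (tube_map @` D) x.
Proof.
have [w <-] := tube_map_surj x; set a := w 0 1 - pi.
pose D := [set y : V2 | w 0 0 - 1 < y 0 0] `&` strip a.
have wa : strip a w by exact: strip_mid.
have Dw : D w by split => //=; lra.
exists (w 0 0 - 1), D; split; last by exists w.
split; last by move=> y [].
  apply: (@strip_sheet a) => [|y []//].
  by apply: openI; [exact: half_space_gt_open|exact: strip_open].
apply: (connected_star Dw) => y t [Dy ya] t01.
split; first by rewrite /= !mxE; apply: segment_gt => //; case: Dw.
move: wa ya; rewrite /strip /= !in_itv /= !mxE => /andP[a1 a2] /andP[b1 b2].
by apply/andP; split; [exact: segment_gt|exact: segment_lt].
Qed.

Lemma plane_dc_manifold : dc_manifold (plane_dc R).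
Proof.
apply: (@atlas_dc_manifold _ _ plane_hausdorff _ (@plane_map_continuous R)
  (@plane_map_open R) plane_deck _ plane_atlasE plane_atlas_cover plane_half_cover).
exact: (second_countable_open_image (@plane_map_continuous R) (@plane_map_open R)
  plane_map_surj (second_countable_rV R 2)).
Qed.

Lemma tube_dc_manifold : dc_manifold (tube_dc R).
Proof.
apply: (@atlas_dc_manifold _ _ (@tube_hausdorff R) _ (@tube_map_continuous R)
  (@tube_map_open R) tube_map_deck _ tube_atlasE tube_atlas_cover tube_half_cover).
exact: (second_countable_open_image (@tube_map_continuous R) (@tube_map_open R)
  tube_map_surj (second_countable_rV R 2)).
Qed.

Lemma connected_surj_image k (X : topologicalType) (q : 'rV[R]_k -> X) :
  continuous q -> (forall y, exists w, q w = y) -> connected [set: X].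
Proof.
move=> qc qs; rewrite (_ : [set: X] = q @` setT).
  by apply: (@connected_star_image _ _ _ setT _ 0) => //; apply: continuous_within => x _; exact: qc.
by apply/seteqP; split=> // y _; have [w <-] := qs y; exists w.
Qed.

Lemma plane_connected : connected [set: R * R].
Proof. exact: connected_surj_image (@plane_map_continuous R) plane_map_surj. Qed.

Lemma tube_connected : connected [set: R * T1 R].
Proof. exact: connected_surj_image (@tube_map_continuous R) tube_map_surj. Qed.

End Atlases.

(** * The catenoids *)

Section Functions.
Context {R : realType}.

(** Analyticity in one real variable, phrased as stability under composition; real numbers need not
    be turned into row vectors. *)
Definition analytic_fun (phi : R -> R) := forall k (f : 'rV[R]_k -> R) p,
  analytic_at f p -> analytic_at (fun x => phi (f x)) p.

Lemma analytic_near_neq0 k (f : 'rV[R]_k -> R) p : analytic_at f p -> f p != 0 ->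
  \forall x \near p, f x != 0.
Proof.
move=> fA fp; have h : nbhs (f p) [set y | y != 0].
  by apply: open_nbhs_nbhs; split=> //; exact: open_neq.
exact: (analytic_continuous fA h).
Qed.

(** At a zero of f, Hadamard's division of phi at 0 supplies the expansion of phi(x) / x; elsewhere
    it is a quotient. The uses are sinh t / t and sin x / x. *)
Lemma slope_function (phi : R -> R) (d : R) :
  analytic_fun phi -> phi 0 = 0 -> is_derive (0 : R) (1 : R) phi d ->
  exists sg : R -> R, [/\ forall x, phi x = x * sg x, sg 0 = d & analytic_fun sg].
Proof.
move=> phiA phi0 dphi; pose sg (x : R) := if x == 0 then d else phi x / x.
have sgE x : phi x = x * sg x.
  rewrite /sg; case: eqP => [->|/eqP x0]; first by rewrite phi0 mul0r.
  by field.
exists sg; split=> // [|k f p fA]; first by rewrite /sg eqxx.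
have [fp|fp] := eqVneq (f p) 0; last first.
  have h : analytic_at (fun x => phi (f x) / f x) p by apply: analytic_div => //; exact: phiA.
  apply: analytic_near h; apply: filterS (analytic_near_neq0 fA fp) => x fx.
  by rewrite /sg (negbTE fx).
pose o : 'rV[R]_1 := const_mx 0.
have [g [gA gE]] : exists g : 'rV[R]_1 -> R, analytic_at g o /\
    \forall x \near o, phi ((x : 'rV[R]_1) 0 0) = x 0 0 * g x.
  have := phiA _ _ _ (analytic_coord o 0) => /analytic_hadamard[g [gA gE]].
  exists (g 0); split=> //; apply: filterS gE => x.
  by rewrite big_ord1 !mxE phi0 !subr0.
have rowc : (fun h : R => const_mx h : 'rV[R]_1) @ 0 --> o.
  apply: (@rV_continuous _ _ 1 (fun h : R => const_mx h) 0) => j.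
  rewrite (_ : (fun x : R => _) = id); last by apply/funext => x; rewrite mxE.
  by rewrite mxE; exact: cvg_id.
(* The Hadamard quotient at 0 is the limit of phi(t) / t, that is the derivative. *)
have go : g o = d.
  have c1 : (fun h : R => g (const_mx h)) @ 0^' --> g o.
    have c0 : (fun h : R => g (const_mx h)) @ (0 : R) --> g o.
      exact: (cvg_comp _ _ rowc (analytic_continuous gA)).
    by move=> V /c0 hV; exact: nbhs_dnbhs hV.
  have c2 : (fun h : R => g (const_mx h)) @ 0^' --> d.
    have [dd <-] := dphi; have h : cvg ((fun h : R => h^-1 *: (phi (h *: 1 + 0) - phi 0)) @ 0^') := dd.
    apply: cvg_trans (_ : (fun h : R => h^-1 *: (phi (h *: 1 + 0) - phi 0)) @ 0^' --> _).
      apply: near_eq_cvg.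
      have nE : \forall h \near (0 : R), phi h = h * g (const_mx h).
        have n0 : nbhs (0 : R) ((fun h : R => const_mx h : 'rV[R]_1) @^-1`
            [set x : 'rV[R]_1 | phi (x 0 0) = x 0 0 * g x]) by exact: (rowc _ gE).
        by apply: filterS n0 => u; rewrite /preimage /= mxE.
      near=> t; have t0 : t != 0 by near: t; exact: nbhs_dnbhs_neq.
      rewrite phi0 subr0 addr0 -[t *: 1]/(t * 1) mulr1 -[_ *: _]/(t^-1 * phi t).
      rewrite (_ : phi t = t * g (const_mx t)) ?mulKf //.
      by near: t; exact: nbhs_dnbhs nE.
    exact: h.
  exact: (cvg_unique _ c1 c2).
have sgA : analytic_at (fun x : 'rV[R]_1 => sg (x 0 0)) o.
  apply: analytic_near gA; apply: filterS gE => x; rewrite /sg.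
  case: eqP => [x0 _|/eqP x0 ->].
    by rewrite (_ : x = o) //; apply/rowP => j; rewrite ord1 x0 mxE.
  by rewrite mulrC mulKf.
have fo : const_mx (f p) = o by rewrite fp.
rewrite -fo in sgA; have HA (j : 'I_1) : analytic_at (fun x => (const_mx (f x) : 'rV[R]_1) 0 j) p.
  by apply: analytic_near fA; near=> x; rewrite mxE.
have := analytic_comp HA sgA; apply: analytic_near.
by near=> x; rewrite /= mxE.
Unshelve. all: by end_near. Qed.

Lemma analytic_sin : analytic_fun (@sin R).
Proof. by move=> k f p /analytic_sincos[]. Qed.

Lemma analytic_cos : analytic_fun (@cos R).
Proof. by move=> k f p /analytic_sincos[]. Qed.

Lemma analytic_sinh : analytic_fun (@sinh R).
Proof.
move=> k f p fA; apply: analytic_mul; last exact: analytic_cst.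
by apply: analytic_sub; apply: analytic_expR => //; exact: analytic_opp.
Qed.

Lemma analytic_cosh : analytic_fun (@cosh R).
Proof.
move=> k f p fA; apply: analytic_mul; last exact: analytic_cst.
by apply: analytic_add; apply: analytic_expR => //; exact: analytic_opp.
Qed.

Lemma cosh_gt0 (x : R) : 0 < cosh x.
Proof. by rewrite divr_gt0 // addr_gt0 // expR_gt0. Qed.

Lemma cosh2 (x : R) : cosh x ^+ 2 = 1 + sinh x ^+ 2.
Proof.
have h : expR x * expR (- x) = 1 by rewrite -expRD subrr expR0.
rewrite /cosh /sinh; transitivity (expR x * expR (- x) +
   ((expR x - expR (- x)) / 2) ^+ 2); first by field.
by rewrite h.
Qed.

Lemma sinh0 : sinh 0 = 0 :> R.
Proof. by rewrite /sinh oppr0 subrr mul0r. Qed.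

Lemma cosh0 : cosh 0 = 1 :> R.
Proof. by rewrite /cosh oppr0 expR0 -mulr2n -[_ *+ 2]mulr_natl mulr1 divff // pnatr_eq0. Qed.

Lemma sinh_eq0 (x : R) : (sinh x == 0) = (x == 0).
Proof.
rewrite /sinh mulf_eq0 invr_eq0 pnatr_eq0 orbF subr_eq0.
by rewrite (inj_eq (@expR_inj R)) -addr_eq0 -mulr2n mulrn_eq0.
Qed.

Lemma is_derive_sinh : is_derive (0 : R) 1 (@sinh R) 1.
Proof.
rewrite /sinh.
apply: is_derive_eq; rewrite ?oppr0 expR0.
by rewrite scaler0 scaler0 add0r -[_ *: _]/(2^-1 * _); field.
Qed.

End Functions.

Section Subspaces.
Context {T : topologicalType} (Z : set T).

Lemma set_type_continuous (X : topologicalType) (phi : X -> set_type Z) :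
  continuous (fun x => set_val (phi x)) -> continuous phi.
Proof.
move=> h x V /set_type_nbhsE[W nW WV].
have hW : nbhs x [set y | W (set_val (phi y))] := h x W nW.
by apply: filterS hW => y Wy; exact: WV.
Qed.

Lemma range_set_val : range (set_val : set_type Z -> T) = Z.
Proof.
apply/seteqP; split=> [_ [z _ <-]|z Zz]; first exact: set_valZ.
have zZ : z \in Z by exact/mem_set.
by exists (exist _ z zZ).
Qed.

End Subspaces.

(** * Extension of a parametrization by the inclusion of a charted set *)

Section Extension.
Context {R : realType}.
Notation V3 := 'rV[R]_3.
Variables (Z Sing : set V3) (C : set (set V3 * (V3 -> V3))) (z0 : set_type Z).

Lemma set_type_connected : connected Z -> connected [set: set_type Z].
Proof.
move=> cZ; rewrite (_ : [set: _] = to_sub z0 @` Z); last first.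
  apply/seteqP; split=> // z _; exists (set_val z); first exact: set_valZ.
  by rewrite to_subK.
apply: connected_continuous_connected => //; apply: set_type_within.
apply/withinP => x Zx V; rewrite to_subE // => nV; apply: filterS nV => y Vy Zy.
by rewrite to_subE.
Qed.

(** [lam] is a lift of f to the cylinder written as a function on [X], hence usable in all charts
    [P] at once. The point outside the range makes the inclusion of images strict. *)
Lemma charted_extension (X : topologicalType) (A : set (@local_param R (2 + 1) X)) (f : X -> V3) :
  dc_manifold A -> connected [set: X] -> dc_map_to_space A f -> continuous f ->
  charted Z Sing C -> connected Z -> (forall x, Z (f x)) ->
  (forall x, exists c lam, [/\ C c, (c.2 @` c.1) (f x),
     forall P, A P -> analytic_on (lp_dom P `&` P @^-1` (f @^-1` (c.2 @` c.1))) (lam \o P) &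
     forall y, (c.2 @` c.1) (f y) -> [/\ cylinder 2 (lam y),
       c.1 (@cone_proj R 2 (lam y)) & c.2 (@cone_proj R 2 (lam y)) = f y]]) ->
  (exists2 z, Z z & ~ range f z) ->
  analytic_extension A f (chart_structure C z0) (set_val : set_type Z -> V3).
Proof.
move=> mA cX fA fc hC cZ fZ lift [z Zz nz].
have Z1 : @second_countable (set_type Z) by apply: second_countable_set_type; exact: second_countable_rV.
have Z2 : hausdorff_space (set_type Z) by apply: set_type_hausdorff; exact: norm_hausdorff.
split=> //.
- split; [exact: (charted_dc_manifold _ hC Z1)|exact: set_type_connected|exact: charted_dc_map_to_space hC].
- exists (fun x => to_sub z0 (f x)); last by apply/funext => x /=; rewrite to_subE.
  apply: (@dc_map_of_lifts _ _ _ Z2 A _ (chart_params C z0)).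
  + apply: set_type_continuous; rewrite (_ : (fun x => _) = f) //.
    by apply/funext => x; rewrite to_subE.
  + by have [_ [[Adc _] _ _]] := mA.
  + by move=> P [].
  + move=> Q S [_ _ cQ] CS; split; first by apply: compatible_sym; exact: cQ.
    have [iS _ _] := chart_params_sub hC CS.
    by have [] := inverse_dc_tame iS.
  + move=> P AP x; have [[Om G] [lam [/= Cc Gx lA lE]]] := lift x.
    have [chC _ _ _] := hC; have cG := chC _ Cc; rewrite /= in cG.
    have imgE y : lp_img (chart_param z0 Om G) (to_sub z0 (f y)) <-> (G @` Om) (f y).
      by rewrite (chart_img z0 cG) to_subE.
    exists (chart_param z0 Om G), (lam \o P); split; first by exists (Om, G).
    * exact/imgE.
    * apply: analytic_on_subset (lA P AP) => a [Pa h].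
      by split=> //; apply/imgE.
    * move=> b Pb /imgE /lE[ca Oa Ga].
      split; first by split.
      by apply: set_val_inj; rewrite /= Ga.
- rewrite range_set_val; split; first by move=> _ [x _ <-].
  by move=> h; apply: nz; exact: h.
Qed.

End Extension.

(** * The elliptic catenoid and the completed parabolic one *)

Section EllipticParabolic.
Context {R : realType}.
Notation V2 := 'rV[R]_2.
Notation V3 := 'rV[R]_3.

Lemma cone_star (y : V3) (t : R) : cone 2 y -> @cone R 2 (0 + t *: (y - 0)).
Proof. by rewrite subr0 add0r => /coneE h; apply/coneE; rewrite !mxE !exprMn -mulrDr h. Qed.

Lemma cone0 : @cone R 2 0.
Proof. by apply/coneE; rewrite !mxE expr0n /= addr0. Qed.

Lemma analytic_fun_at k l (f : 'rV[R]_k -> 'rV[R]_l) :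
  (forall p j, analytic_at (fun x => f x 0 j) p) -> forall A, analytic_on A f.
Proof. by move=> fA A; apply: analytic_on_at => p _; exact: fA. Qed.

Section GlobalChart.
Variables (Z : set V3) (z1 : V3) (G Gi : V3 -> V3).
Hypothesis GA : forall p j, analytic_at (fun x => G x 0 j) p.
Hypothesis GiA : forall p j, analytic_at (fun x => Gi x 0 j) p.
Hypotheses (GK : cancel G Gi) (GiK : cancel Gi G).
Hypothesis G0 : G 0 = z1.
Hypothesis ZG : forall x, cone 2 x <-> Z (G x).

Lemma global_image : G @` @cone R 2 = Z.
Proof.
apply/seteqP; split=> [_ [x /ZG Zx <-] //|z Zz].
by exists (Gi z); [apply/ZG; rewrite GiK|rewrite GiK].
Qed.

Lemma global_connected : connected Z.
Proof.
rewrite -global_image; apply: (connected_star_image (x0 := 0)).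
- by apply: continuous_within => x _; apply: analytic_cvg; exact: GA.
- exact: cone0.
- by move=> y t cy _; exact: cone_star.
Qed.

Lemma global_charted : charted Z [set z1] [set (setT, G)].
Proof.
have GT : G @` setT = setT by apply/seteqP; split=> // z _; exists (Gi z).
have Zz1 : Z z1 by rewrite -G0; apply/ZG; exact: cone0.
split.
- move=> _ -> /=; split; rewrite ?GT; try exact: openT.
  + apply: (@analytic_diffeo_of _ _ _ _ _ _ Gi) => //; exact: analytic_fun_at.
  + by rewrite setIT global_image; exact: global_connected.
  + split=> x _; first exact: ZG.
    by move=> _; rewrite -G0 /=; split=> [->//|/(can_inj GK)].
- by move=> z _; exists (setT, G) => //=; exists (Gi z).
- by move=> _ ->.
- move=> _ ->; split; [exact/mem_set|exists setT; [exact: filterT|]].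
  by rewrite setTI.
Qed.

End GlobalChart.

Definition parabolic_set : set V3 :=
  [set p | 12 * (p 0 e1 ^+ 2 + p 0 e2 ^+ 2 - p 0 e0 ^+ 2) - (p 0 e0 + p 0 e1) ^+ 4 = 0].

Definition elliptic_set : set V3 :=
  [set p | p 0 e1 ^+ 2 + p 0 e2 ^+ 2 - sinh (p 0 e0) ^+ 2 = 0].

(* With s = t + x, d = x - t the surface is s (d - s ^ 3 / 12) + y ^ 2 = 0. *)
Definition parabolic_chart (x : V3) : V3 :=
  vec3 (x 0 e2 - (x 0 e0 + x 0 e2) ^+ 3 / 24) (x 0 e0 + (x 0 e0 + x 0 e2) ^+ 3 / 24) (x 0 e1).

Definition parabolic_chart_inv (p : V3) : V3 :=
  vec3 (p 0 e1 - (p 0 e0 + p 0 e1) ^+ 3 / 24) (p 0 e2) (p 0 e0 + (p 0 e0 + p 0 e1) ^+ 3 / 24).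

Lemma analytic_cubic k (f g h : 'rV[R]_k -> R) p :
  analytic_at f p -> analytic_at g p -> analytic_at h p ->
  analytic_at (fun x => f x - (g x + h x) ^+ 3 / 24) p /\
  analytic_at (fun x => f x + (g x + h x) ^+ 3 / 24) p.
Proof.
move=> fA gA hA.
have cA : analytic_at (fun x => (g x + h x) ^+ 3 / 24) p.
  by apply: analytic_mul; [apply: analytic_exp; exact: analytic_add|exact: analytic_cst].
by split; [exact: analytic_sub|exact: analytic_add].
Qed.

Lemma parabolic_chart_analytic p j : analytic_at (fun x => parabolic_chart x 0 j) p.
Proof.
have c i := analytic_coord p i.
apply: analytic_vec3; last exact: c.
- by have [] := analytic_cubic (c e2) (c e0) (c e2).
- by have [] := analytic_cubic (c e0) (c e0) (c e2).
Qed.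

Lemma parabolic_chart_inv_analytic p j : analytic_at (fun x => parabolic_chart_inv x 0 j) p.
Proof.
have c i := analytic_coord p i.
apply: analytic_vec3; first 1 last; first exact: c.
- by have [] := analytic_cubic (c e0) (c e0) (c e1).
- by have [] := analytic_cubic (c e1) (c e0) (c e1).
Qed.

Lemma parabolic_chartK : cancel parabolic_chart parabolic_chart_inv.
Proof.
move=> x; rewrite /parabolic_chart_inv /parabolic_chart; apply: rV3P; rewrite !vec3E //.
  by rewrite (_ : _ - _ + _ = x 0 e0 + x 0 e2); [rewrite addrK|ring].
by rewrite (_ : x 0 e2 - _ + (x 0 e0 + _) = x 0 e0 + x 0 e2); [rewrite subrK|ring].
Qed.

Lemma parabolic_chart_invK : cancel parabolic_chart_inv parabolic_chart.
Proof.
move=> x; rewrite /parabolic_chart_inv /parabolic_chart; apply: rV3P; rewrite !vec3E //.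
  by rewrite (_ : _ - _ + _ = x 0 e0 + x 0 e1); [rewrite addrK|ring].
by rewrite (_ : x 0 e1 - _ + (x 0 e0 + _) = x 0 e0 + x 0 e1); [rewrite subrK|ring].
Qed.

Lemma parabolic_chart0 : parabolic_chart 0 = 0.
Proof.
by apply: rV3P; rewrite /parabolic_chart vec3E !mxE; field.
Qed.

Lemma parabolic_chartP x : @cone R 2 x <-> parabolic_set (parabolic_chart x).
Proof.
rewrite coneE /parabolic_set /= /parabolic_chart !vec3E.
set a := x 0 e0; set b := x 0 e1; set c := x 0 e2.
rewrite (_ : 12 * _ - _ = 12 * (a ^+ 2 + b ^+ 2 - c ^+ 2)); last by field.
split=> [->|/eqP]; first by rewrite subrr mulr0.
by rewrite mulf_eq0 pnatr_eq0 /= subr_eq0 => /eqP.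
Qed.

Lemma parabolic_charted : charted parabolic_set [set 0] [set (setT, parabolic_chart)].
Proof.
exact: (global_charted parabolic_chart_analytic parabolic_chart_inv_analytic
  parabolic_chartK parabolic_chart_invK parabolic_chart0 parabolic_chartP).
Qed.

Lemma parabolic_connected : connected parabolic_set.
Proof.
exact: (global_connected parabolic_chart_analytic parabolic_chart_invK parabolic_chartP).
Qed.

Lemma parabolic_complete : analytically_complete parabolic_set.
Proof.
apply: zero_set_complete; last first.
  by exists 0; rewrite !mxE !expr0n /= !addr0 subrr mulr0 expr0n /= subrr.
move=> p; have c i := analytic_coord p i.
apply: analytic_sub; last by apply: analytic_exp; exact: analytic_add.
apply: analytic_mul; first exact: analytic_cst.
by apply: analytic_sub; [apply: analytic_add|]; exact: analytic_exp.
Qed.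

Lemma elliptic_charted : exists G : V3 -> V3,
  charted elliptic_set [set 0] [set (setT, G)].
Proof.
have [sg [sgE sg0 sgA]] := slope_function (@analytic_sinh R) sinh0 is_derive_sinh.
have sgn0 x : sg x != 0.
  have [->|x0] := eqVneq x 0; first by rewrite sg0 oner_neq0.
  by have := sinh_eq0 x; rewrite sgE mulf_eq0 (negbTE x0) /= => ->.
pose G (x : V3) : V3 := vec3 (x 0 e2) (sg (x 0 e2) * x 0 e0) (sg (x 0 e2) * x 0 e1).
pose Gi (p : V3) : V3 := vec3 (p 0 e1 / sg (p 0 e0)) (p 0 e2 / sg (p 0 e0)) (p 0 e0).
exists G; apply: (@global_charted _ _ _ Gi).
- move=> p; have c i := analytic_coord p i.
  by apply: analytic_vec3 => //; apply: analytic_mul => //; exact: sgA.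
- move=> p; have c i := analytic_coord p i.
  by apply: analytic_vec3 => //; apply: analytic_div => //; exact: sgA.
- by move=> x; rewrite /Gi /G; apply: rV3P; rewrite !vec3E // mulrC mulKf.
- by move=> x; rewrite /Gi /G; apply: rV3P; rewrite !vec3E // mulrC divfK.
- by apply: rV3P; rewrite /G vec3E !mxE ?mulr0.
- move=> x; rewrite coneE /elliptic_set /= /G !vec3E sgE !exprMn.
  rewrite (_ : _ - _ = sg (x 0 e2) ^+ 2 * (x 0 e0 ^+ 2 + x 0 e1 ^+ 2 - x 0 e2 ^+ 2)); last by ring.
  split=> [->|/eqP]; first by rewrite subrr mulr0.
  by rewrite mulf_eq0 expf_eq0 /= (negbTE (sgn0 _)) /= subr_eq0 => /eqP.
Qed.

Lemma elliptic_complete : analytically_complete elliptic_set.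
Proof.
apply: zero_set_complete; last first.
  by exists 0; rewrite !mxE sinh0 !expr0n /= !addr0 subrr.
move=> p; have c i := analytic_coord p i.
apply: analytic_sub; last by apply: analytic_exp; exact: analytic_sinh.
by apply: analytic_add; exact: analytic_exp.
Qed.

Lemma unit_circle (a b : R) : a ^+ 2 + b ^+ 2 = 1 -> exists v : R, cos v = a /\ sin v = b.
Proof.
move=> h; have a1 : -1 <= a <= 1.
  have : 0 <= b ^+ 2 by exact: sqr_ge0.
  by move=> b2; apply/andP; split; nra.
have ca := acosK a1; have sa : sin (acos a) ^+ 2 = b ^+ 2.
  by have := cos2Dsin2 (acos a); rewrite ca -h => /addrI.
have [e|e] := eqVneq (sin (acos a)) b; first by exists (acos a).
exists (- acos a); rewrite cosN sinN; split=> //.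
by move/eqP: sa; rewrite eqf_sqr (negbTE e) /= => /eqP ->; rewrite opprK.
Qed.

Lemma range_f_E : range (@f_E R) = elliptic_set.
Proof.
apply/seteqP; split=> [_ [[u t] _ <-]|p].
  rewrite /elliptic_set /= /f_E !vec3E /= !exprMn -mulrDr cos2Dsin2; ring.
move=> /eqP; rewrite subr_eq0 => /eqP h.
have [s0|s0] := eqVneq (sinh (p 0 e0)) 0.
  exists (p 0 e0, to_T1 0) => //; rewrite /f_E /= s0 !mul0r.
  move: h; rewrite s0 expr0n /=.
  move=> /eqP; rewrite paddr_eq0 ?sqr_ge0 // !sqrf_eq0 => /andP[/eqP h1 /eqP h2].
  by apply: rV3P; rewrite vec3E ?h1 ?h2.
have [|v [cv sv]] := @unit_circle (p 0 e1 / sinh (p 0 e0)) (p 0 e2 / sinh (p 0 e0)).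
  move: (sinh (p 0 e0)) s0 h => s s0 h.
  by rewrite !expr_div_n -mulrDl h divff // expf_neq0.
exists (p 0 e0, to_T1 v) => //; rewrite /f_E /= cos_of_T1 sin_of_T1 cv sv.
by apply: rV3P; rewrite vec3E // mulrC divfK.
Qed.

End EllipticParabolic.

Section PlaneTube.
Context {R : realType}.
Notation V2 := 'rV[R]_2.
Notation V3 := 'rV[R]_3.

Lemma plane_analytic_map (f : R * R -> V3) :
  (forall p j, analytic_at (fun w => f (plane_map w) 0 j) p) ->
  dc_map_to_space (plane_dc R) f /\ continuous f.
Proof.
move=> fA; split.
  apply: (@atlas_dc_map_to_space _ _ (@plane_map R) (@plane_map_continuous R)
    (@plane_map_open R) _ plane_atlasE plane_atlas_cover).
  exact: analytic_fun_at.
apply: (open_surj_continuous (@plane_map_open R) plane_map_surj) => p.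
exact: (@analytic_cvg _ _ _ (f \o @plane_map R) p (fA p)).
Qed.

Lemma plane_lift l P (V : set (R * R)) (lam : R * R -> 'rV[R]_l) : open V ->
  plane_dc R P -> analytic_on (@plane_map R @^-1` V) (lam \o @plane_map R) ->
  analytic_on (lp_dom P `&` P @^-1` V) (lam \o P).
Proof.
exact: (@atlas_analytic _ _ (@plane_map R) (@plane_map_continuous R)
  (@plane_map_open R) _ plane_atlasE plane_atlas_cover).
Qed.

Lemma tube_analytic_map (f : R * T1 R -> V3) :
  (forall p j, analytic_at (fun w => f (tube_map w) 0 j) p) ->
  dc_map_to_space (tube_dc R) f /\ continuous f.
Proof.
move=> fA; split.
  apply: (@atlas_dc_map_to_space _ _ (@tube_map R) (@tube_map_continuous R)
    (@tube_map_open R) _ tube_atlasE tube_atlas_cover).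
  exact: analytic_fun_at.
apply: (open_surj_continuous (@tube_map_open R) tube_map_surj) => p.
exact: (@analytic_cvg _ _ _ (f \o @tube_map R) p (fA p)).
Qed.

Lemma tube_lift l P (V : set (R * T1 R)) (lam : R * T1 R -> 'rV[R]_l) : open V ->
  tube_dc R P -> analytic_on (@tube_map R @^-1` V) (lam \o @tube_map R) ->
  analytic_on (lp_dom P `&` P @^-1` V) (lam \o P).
Proof.
exact: (@atlas_analytic _ _ (@tube_map R) (@tube_map_continuous R)
  (@tube_map_open R) _ tube_atlasE tube_atlas_cover).
Qed.

Lemma f_P_analytic p j : analytic_at (fun w : V2 => f_P (plane_map w) 0 j) p.
Proof.
have u := analytic_coord p 0; have v := analytic_coord p 1.
have v3 : analytic_at (fun w : V2 => w 0 1 ^+ 3 / 3) p.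
  by apply: analytic_mul; [exact: analytic_exp|exact: analytic_cst].
have u2 : analytic_at (fun w : V2 => w 0 0 ^+ 2 * w 0 1) p.
  by apply: analytic_mul => //; exact: analytic_exp.
apply: analytic_vec3.
- by apply: analytic_add => //; exact: analytic_sub.
- by apply: analytic_sub => //; exact: analytic_add.
- by apply: analytic_mul => //; apply: analytic_mul => //; exact: analytic_cst.
Qed.

(** Here s = t + x = 2 v and d = x - t = 2 (v^3 / 3 - u^2 v), so s (d - s^3 / 12) = - 4 u^2 v^2 = -
    y^2. *)
Lemma f_P_in p : parabolic_set (@f_P R p).
Proof. by rewrite /parabolic_set /f_P /= !vec3E; field. Qed.

(** In the straightened coordinates f_P is (v (1 - u^2), 2 u v, v (1 + u^2)). Dividing by the last
    entry cancels v and leaves the rational parametrization of the circle. *)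
Definition parabolic_lift (p : R * R) : 'rV[R]_(2 + 1) :=
  let u := p.1 in let v := p.2 in
  vec3 ((1 - u ^+ 2) / (1 + u ^+ 2)) (2 * u / (1 + u ^+ 2)) (v * (1 + u ^+ 2)).

Lemma one_sqr_neq0 (u : R) : 1 + u ^+ 2 != 0.
Proof. by rewrite gt_eqF // ltr_pwDl // sqr_ge0. Qed.

Lemma parabolic_liftP p : cylinder 2 (parabolic_lift p) /\
  parabolic_chart (@cone_proj R 2 (parabolic_lift p)) = f_P p.
Proof.
have n0 := one_sqr_neq0 p.1; split.
  by apply/cylinderE; rewrite /parabolic_lift !vec3E; field.
rewrite cone_projE /parabolic_lift !vec3E /parabolic_chart !vec3E.
by rewrite /f_P; apply: rV3P; rewrite !vec3E; field.
Qed.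

Lemma parabolic_lift_analytic p j :
  analytic_at (fun w : V2 => parabolic_lift (plane_map w) 0 j) p.
Proof.
have u := analytic_coord p 0; have v := analytic_coord p 1.
have u2 : analytic_at (fun w : V2 => w 0 0 ^+ 2) p by exact: analytic_exp.
have d1 : analytic_at (fun w : V2 => 1 + w 0 0 ^+ 2) p.
  by apply: analytic_add => //; exact: analytic_cst.
have n0 := one_sqr_neq0 (p 0 0).
apply: analytic_vec3.
- by apply: analytic_div => //; apply: analytic_sub => //; exact: analytic_cst.
- by apply: analytic_div => //; apply: analytic_mul => //; exact: analytic_cst.
- exact: analytic_mul.
Qed.

Lemma parabolic_extension :
  exists A, analytic_extension (plane_dc R) f_P A (set_val : set_type parabolic_set -> V3).
Proof.
have Z0 : (0 : V3) \in parabolic_set.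
  by apply/mem_set; rewrite -parabolic_chart0; apply/parabolic_chartP; exact: cone0.
exists (chart_structure [set (setT, parabolic_chart)] (exist _ 0 Z0)).
have [fA fc] := plane_analytic_map f_P_analytic.
apply: (charted_extension _ _ _ _ _ parabolic_charted) => //.
- exact: plane_dc_manifold.
- exact: plane_connected.
- exact: parabolic_connected.
- exact: f_P_in.
- move=> x; exists (setT, parabolic_chart), parabolic_lift; split=> //=.
  + by exists (parabolic_chart_inv (f_P x)) => //; exact: parabolic_chart_invK.
  + move=> P AP; have imgT : @parabolic_chart R @` setT = setT.
      by apply/seteqP; split=> // z _; exists (parabolic_chart_inv z) => //; exact: parabolic_chart_invK.
    rewrite imgT preimage_setT; apply: plane_lift => //; first exact: openT.
    by apply: analytic_fun_at; exact: parabolic_lift_analytic.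
  + by move=> y _; have [] := parabolic_liftP y.
(* On t + x = 0 the parameter v is 0, so f_P meets that plane only in the origin, while the
   completion contains the line t + x = y = 0. *)
- exists (vec3 1 (-1) 0); first by rewrite /parabolic_set /= !vec3E; ring.
  move=> [[u v] _] /(congr1 (fun x : V3 => (x 0 e0, x 0 e0 + x 0 e1))).
  rewrite /f_P !vec3E /= => -[h1 h2].
  have v0 : v = 0 by lra.
  by move: h1; rewrite v0 !mulr0 expr0n /=; lra.
Qed.

End PlaneTube.

(** * Charts and lifts for the hyperbolic catenoid *)

Section Hyperbolic.
Context {R : realType}.
Notation V2 := 'rV[R]_2.
Notation V3 := 'rV[R]_3.

Lemma sin_zpi (k : int) : sin (k%:~R * pi) = 0 :> R.
Proof.
have nat n : sin (n%:R * pi) = 0 :> R.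
  elim: n => [|n IH]; first by rewrite mul0r sin0.
  by rewrite -natr1 mulrDl mul1r sinDpi IH oppr0.
by case: k => n; [exact: nat|rewrite NegzE mulrNz mulNr sinN -pmulrn nat oppr0].
Qed.

(** The sign (-1)^k, in the form in which the addition theorem for the sine produces it. *)
Definition csgn (k : int) : R := cos (k%:~R * pi).

Lemma csgn2 k : csgn k ^+ 2 = 1.
Proof. by rewrite -(cos2Dsin2 (k%:~R * pi)) sin_zpi [0 ^+ 2]expr0n /= addr0. Qed.

Lemma sin_shift (k : int) (x : R) : sin (k%:~R * pi + x) = csgn k * sin x.
Proof. by rewrite sinD sin_zpi mul0r add0r. Qed.

Lemma sin_neq0 (x : R) : `|x| < pi -> x != 0 -> sin x != 0.
Proof.
rewrite ltr_norml => /andP[x1 x2] /lt_total /orP[x0|x0].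
  by rewrite -oppr_eq0 -sinN gt_eqF // sin_gt0_pi //; apply/andP; split; lra.
by rewrite gt_eqF // sin_gt0_pi // x0.
Qed.

Lemma near_zpi (x : R) : exists k : int, `|x - k%:~R * pi| < pi.
Proof.
have p0 := pi_gt0 R; exists (Num.floor (x / pi)).
have h1 : (Num.floor (x / pi))%:~R * pi <= x by rewrite -ler_pdivlMr //; exact: floor_le.
have h2 : x < (Num.floor (x / pi) + 1)%:~R * pi by rewrite -ltr_pdivrMr //; exact: floorD1_gt.
by rewrite ltr_norml; move: h2; rewrite intrD mulrDl mul1r => h2; apply/andP; split; lra.
Qed.

Lemma zpi_inj (k l : int) : `|k%:~R * pi - l%:~R * pi : R| < pi -> k = l.
Proof.
rewrite -mulrBl normrM (gtr0_norm (pi_gt0 R)) -{2}[pi]mul1r ltr_pM2r ?pi_gt0 //.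
rewrite -rmorphB -intr_norm (_ : 1 = 1%:~R :> R) // ltr_int => h.
by apply/eqP; rewrite -subr_eq0; move: h; case: (k - l) => [[|n]|n].
Qed.

Lemma open_band (i : 'I_3) (c : R) : open [set x : V3 | `|x 0 i - c| < pi].
Proof.
rewrite (_ : [set x : V3 | _] = [set x | c - pi < x 0 i] `&` [set x | x 0 i < c + pi]).
  by apply: openI; [exact: half_space_gt_open|exact: half_space_lt_open].
by apply/seteqP; split=> x /=; rewrite ltr_distl => /andP.
Qed.

Definition hyperbolic_set : set V3 :=
  [set p | p 0 e0 ^+ 2 - p 0 e2 ^+ 2 - sin (p 0 e1) ^+ 2 = 0].

Definition hyperbolic_sing : set V3 := [set vec3 0 (k%:~R * pi) 0 | k in [set: int]].

(** The region where sin x / x has no zero; the subtracted 0 makes it an instance of [open_band]. *)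
Definition band : set V3 := [set x | `|x 0 e0 - 0| < pi].

Section Charts.
Variable rho : R -> R.
Hypothesis rhoE : forall x, sin x = x * rho x.
Hypothesis rho1 : rho 0 = 1.
Hypothesis rhoA : analytic_fun rho.

Lemma rho_neq0 x : `|x| < pi -> rho x != 0.
Proof.
move=> xp; have [->|x0] := eqVneq x 0; first by rewrite rho1 oner_neq0.
by have := sin_neq0 xp x0; rewrite rhoE mulf_eq0 negb_or => /andP[].
Qed.

Definition hyperbolic_chart (k : int) (x : V3) : V3 :=
  vec3 (rho (x 0 e0) * x 0 e2) (k%:~R * pi + x 0 e0) (rho (x 0 e0) * x 0 e1).

Definition hyperbolic_chart_inv (k : int) (p : V3) : V3 :=
  let c := k%:~R * pi in
  vec3 (p 0 e1 - c) (p 0 e2 / rho (p 0 e1 - c)) (p 0 e0 / rho (p 0 e1 - c)).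

Lemma hyperbolic_chartK k x : band x -> hyperbolic_chart_inv k (hyperbolic_chart k x) = x.
Proof.
rewrite /band /= subr0 => /rho_neq0 r0; rewrite /hyperbolic_chart_inv /hyperbolic_chart.
have h : k%:~R * pi + x 0 e0 - k%:~R * pi = x 0 e0 by rewrite addrC addKr.
by apply: rV3P; rewrite !vec3E h // mulrC mulKf.
Qed.

Lemma hyperbolic_chart_invK k (p : V3) : `|p 0 e1 - k%:~R * pi| < pi ->
  hyperbolic_chart k (hyperbolic_chart_inv k p) = p.
Proof.
move=> /rho_neq0 r0; rewrite /hyperbolic_chart_inv /hyperbolic_chart.
by apply: rV3P; rewrite !vec3E ?[_ + (_ - _)]addrC ?subrK // mulrC divfK.
Qed.

Lemma hyperbolic_chart_img k :
  hyperbolic_chart k @` band = [set p : V3 | `|p 0 e1 - k%:~R * pi| < pi].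
Proof.
apply/seteqP; split=> [_ [x Bx <-]|p /= hp].
  by rewrite /= /hyperbolic_chart vec3E addrC addKr -[x 0 e0]subr0.
exists (hyperbolic_chart_inv k p); last exact: hyperbolic_chart_invK.
by rewrite /band /= /hyperbolic_chart_inv vec3E subr0.
Qed.

Lemma hyperbolic_chart_analytic k p j : analytic_at (fun x => hyperbolic_chart k x 0 j) p.
Proof.
have c i := analytic_coord p i.
apply: analytic_vec3.
- by apply: analytic_mul => //; exact: rhoA.
- by apply: analytic_add => //; exact: analytic_cst.
- by apply: analytic_mul => //; exact: rhoA.
Qed.

Lemma hyperbolic_chartP k x : band x -> @cone R 2 x <-> hyperbolic_set (hyperbolic_chart k x).
Proof.
rewrite /band /= subr0 => /rho_neq0 r0.
rewrite coneE /hyperbolic_set /= /hyperbolic_chart !vec3E sin_shift rhoE !exprMn csgn2.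
rewrite (_ : _ - _ = rho (x 0 e0) ^+ 2 * (x 0 e2 ^+ 2 - (x 0 e0 ^+ 2 + x 0 e1 ^+ 2))); last by ring.
split=> [->|/eqP]; first by rewrite subrr mulr0.
by rewrite mulf_eq0 expf_eq0 /= (negbTE r0) /= subr_eq0 => /eqP.
Qed.

Lemma hyperbolic_ambient k : ambient_chart hyperbolic_set hyperbolic_sing band (hyperbolic_chart k).
Proof.
have G0 : hyperbolic_chart k 0 = vec3 0 (k%:~R * pi) 0.
  by rewrite /hyperbolic_chart !mxE !mulr0 addr0.
split.
- exact: open_band.
- by rewrite hyperbolic_chart_img; exact: open_band.
- apply: (@analytic_diffeo_of _ _ _ _ _ _ (hyperbolic_chart_inv k)).
  + exact: analytic_fun_at (hyperbolic_chart_analytic k) _.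
  + rewrite hyperbolic_chart_img; apply: analytic_on_at => p /rho_neq0 r0.
    have c i := analytic_coord p i.
    have d : analytic_at (fun p : V3 => p 0 e1 - k%:~R * pi) p.
      by apply: analytic_sub => //; exact: analytic_cst.
    apply: analytic_vec3 => //.
    * by apply: analytic_div => //; exact: rhoA.
    * by apply: analytic_div => //; exact: rhoA.
  + by move=> x Bx; exists x.
  + by move=> _ [x Bx <-]; rewrite hyperbolic_chartK.
  + by move=> x; exact: hyperbolic_chartK.
  + by rewrite hyperbolic_chart_img => p; exact: hyperbolic_chart_invK.
- apply: (connected_star_image (x0 := 0)).
  + apply: continuous_within => x _; apply: analytic_cvg; exact: hyperbolic_chart_analytic.
  + by split; [exact: cone0|rewrite /band /= mxE subrr normr0 pi_gt0].
  + move=> y t [cy By] t01; split; first exact: cone_star.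
    rewrite [y - 0]subr0 add0r; move: By t01.
    rewrite /band /= !subr0 mxE in_itv /= => By /andP[t0 t1].
    rewrite normrM (ger0_norm t0); apply: le_lt_trans By.
    by rewrite ler_piMl.
- split=> x Bx; first exact: hyperbolic_chartP.
  move=> cx; split=> [->|[l _]]; first by rewrite G0; exists k.
  move=> /(congr1 (fun p : V3 => p 0 e0)); rewrite /hyperbolic_chart !vec3E => /esym /eqP.
  have r0 : rho (x 0 e0) != 0 by apply: rho_neq0; move: Bx; rewrite /band /= subr0.
  by rewrite mulf_eq0 (negbTE r0) /= => /eqP; exact: cone_vertex.
Qed.

Lemma hyperbolic_charted :
  charted hyperbolic_set hyperbolic_sing [set (band, hyperbolic_chart k) | k in [set: int]].
Proof.
split.
- by move=> _ [k _ <-]; exact: hyperbolic_ambient.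
- move=> z _; have [k hk] := near_zpi (z 0 e1).
  have : (hyperbolic_chart k @` band) z by rewrite hyperbolic_chart_img.
  by exists (band, hyperbolic_chart k); first by exists k.
- move=> _ [k _ <-]; rewrite /hyperbolic_set /= !vec3E sin_zpi expr0n /=; ring.
- move=> z [k _ zE]; split; first by apply/mem_set; exists k.
  exists [set p : V3 | `|p 0 e1 - k%:~R * pi| < pi].
    apply: open_nbhs_nbhs; split; first exact: open_band.
    by rewrite /= -zE vec3E subrr normr0 pi_gt0.
  apply/seteqP; split=> [p [/= + [l _ pE]]|_ -> /=].
    by rewrite -pE vec3E => /zpi_inj ->.
  by split; [rewrite -zE vec3E subrr normr0 pi_gt0|exists k].
Qed.

(** With a = v - k pi, the straightened point is (a, csgn a sinh u, csgn a cosh u). The factor a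
    cancels in the quotients by the last entry, so the formula is analytic at v = k pi too. *)
Definition hyperbolic_lift (k : int) (p : R * R) : 'rV[R]_(2 + 1) :=
  let u := p.1 in let v := p.2 in
  vec3 (csgn k / cosh u) (sinh u / cosh u) (csgn k * (v - k%:~R * pi) * cosh u).

Lemma hyperbolic_liftP k p : [/\ cylinder 2 (hyperbolic_lift k p),
  (@cone_proj R 2 (hyperbolic_lift k p)) 0 e0 = p.2 - k%:~R * pi &
  hyperbolic_chart k (@cone_proj R 2 (hyperbolic_lift k p)) = f_H p].
Proof.
have n0 : cosh p.1 != 0 by rewrite gt_eqF // cosh_gt0.
have E : @cone_proj R 2 (hyperbolic_lift k p) = vec3 (p.2 - k%:~R * pi)
   (csgn k * (p.2 - k%:~R * pi) * sinh p.1) (csgn k * (p.2 - k%:~R * pi) * cosh p.1).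
  rewrite cone_projE /hyperbolic_lift !vec3E.
  move: (cosh p.1) (sinh p.1) n0 => a b a0; apply: rV3P; rewrite !vec3E //.
    transitivity (csgn k ^+ 2 * (p.2 - k%:~R * pi)); last by rewrite csgn2 mul1r.
    by move: (csgn k) => e; field.
  by move: (csgn k) => e; field.
split.
- apply/cylinderE; rewrite /hyperbolic_lift !vec3E.
  have := cosh2 p.1; move: (cosh p.1) (sinh p.1) n0 => a b a0 ab.
  have := csgn2 k; move: (csgn k) => e e1'.
  by rewrite !expr_div_n e1' -mulrDl -ab divff // expf_neq0.
- by rewrite E vec3E.
- rewrite E /hyperbolic_chart !vec3E /f_H.
  have sv : csgn k * ((p.2 - k%:~R * pi) * rho (p.2 - k%:~R * pi)) = sin p.2.
    by rewrite -rhoE -sin_shift addrC subrK.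
  rewrite /= -sv; apply: rV3P; rewrite !vec3E; [|by rewrite addrC subrK|].
  + by move: (_ - _) => d; move: (rho d) (cosh _) (csgn _) => a b c; ring.
  + by move: (_ - _) => d; move: (rho d) (sinh _) (csgn _) => a b c; ring.
Qed.

End Charts.
End Hyperbolic.

(** * Completion of the hyperbolic catenoid and of the W-catenoid *)

Section HyperbolicW.
Context {R : realType}.
Notation V2 := 'rV[R]_2.
Notation V3 := 'rV[R]_3.

Definition hyperbolic_sheet (e : R) (w : V2) : V3 :=
  vec3 (e * Num.sqrt (w 0 1 ^+ 2 + sin (w 0 0) ^+ 2)) (w 0 0) (w 0 1).

Lemma hyperbolic_sheet_connected e : connected (hyperbolic_sheet e @` setT).
Proof.
apply: (@connected_star_image _ _ _ setT _ 0) => //.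
apply: continuous_within => w _; apply: rV_continuous.
have c i := analytic_coord w i.
have rA : analytic_at (fun w : V2 => w 0 1 ^+ 2 + sin (w 0 0) ^+ 2) w.
  by apply: analytic_add; apply: analytic_exp => //; exact: analytic_sin.
apply: I3P.
- rewrite (_ : (fun x => _) = fun w : V2 => e * Num.sqrt (w 0 1 ^+ 2 + sin (w 0 0) ^+ 2)); last first.
    by apply/funext => x; rewrite vec3E.
  rewrite vec3E; have h := continuous_comp (analytic_continuous rA) (@sqrt_continuous R _).
  exact: (cvgM (cvg_cst e) h).
- rewrite (_ : (fun x => _) = fun w : V2 => w 0 0); last by apply/funext => x; rewrite vec3E.
  by rewrite vec3E; exact: analytic_continuous.
- rewrite (_ : (fun x => _) = fun w : V2 => w 0 1); last by apply/funext => x; rewrite vec3E.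
  by rewrite vec3E; exact: analytic_continuous.
Qed.

Lemma hyperbolic_connected : connected (@hyperbolic_set R).
Proof.
(* The nappes t >= 0 and t <= 0 are continuous graphs over the plane, and both contain the
   origin. *)
have -> : @hyperbolic_set R = hyperbolic_sheet 1 @` setT `|` hyperbolic_sheet (-1) @` setT.
  apply/seteqP; split=> [p|p [] [w _ <-]]; last 2 first.
  - rewrite /hyperbolic_set /hyperbolic_sheet /= !vec3E exprMn sqr_sqrtr ?addr_ge0 ?sqr_ge0 //.
    by ring.
  - rewrite /hyperbolic_set /hyperbolic_sheet /= !vec3E exprMn sqr_sqrtr ?addr_ge0 ?sqr_ge0 //.
    by ring.
  rewrite /hyperbolic_set /= => h.
  have {}h : p 0 e2 ^+ 2 + sin (p 0 e1) ^+ 2 = p 0 e0 ^+ 2 by lra.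
  have [p0|p0] := lerP 0 (p 0 e0); [left|right]; exists (vec2 (p 0 e1) (p 0 e2)) => //;
    rewrite /hyperbolic_sheet; apply: rV3P; rewrite vec3E !vec2E // h sqrtr_sqr.
    by rewrite ger0_norm // mul1r.
  by rewrite ltr0_norm // mulN1r opprK.
apply: connectedU; try exact: hyperbolic_sheet_connected.
exists 0; split; exists 0 => //; rewrite /hyperbolic_sheet; apply: rV3P;
  by rewrite vec3E !mxE // sin0 !expr0n /= addr0 sqrtr0 mulr0.
Qed.

Lemma hyperbolic_complete : analytically_complete (@hyperbolic_set R).
Proof.
apply: zero_set_complete; last first.
  by exists 0; rewrite !mxE sin0 !expr0n /= !subr0.
move=> p; have c i := analytic_coord p i.
by apply: analytic_sub; [apply: analytic_sub|]; apply: analytic_exp => //; exact: analytic_sin.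
Qed.

Lemma f_H_analytic p j : analytic_at (fun w : V2 => f_H (plane_map w) 0 j) p.
Proof.
have u := analytic_coord p 0; have v := analytic_coord p 1; have sv := analytic_sin v.
apply: analytic_vec3 => //.
- by apply: analytic_mul => //; exact: analytic_cosh.
- by apply: analytic_mul => //; exact: analytic_sinh.
Qed.

Lemma f_H_in p : hyperbolic_set (@f_H R p).
Proof.
rewrite /hyperbolic_set /f_H /= !vec3E; have := cosh2 p.1.
by move: (cosh _) (sinh _) => a b h; rewrite !exprMn h; ring.
Qed.

Lemma hyperbolic_lift_analytic k p j :
  analytic_at (fun w : V2 => hyperbolic_lift k (plane_map w) 0 j) p.
Proof.
have u := analytic_coord p 0; have v := analytic_coord p 1.
have cu := analytic_cosh u; have su := analytic_sinh u.
have n0 : cosh (p 0 0) != 0 by rewrite gt_eqF // cosh_gt0.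
apply: analytic_vec3.
- by apply: analytic_div => //; exact: analytic_cst.
- exact: analytic_div.
- apply: analytic_mul => //; apply: analytic_mul; first exact: analytic_cst.
  by apply: analytic_sub => //; exact: analytic_cst.
Qed.

Lemma hyperbolic_completion : @dc_submanifold R 2 0 (@hyperbolic_set R) /\
  exists A, analytic_extension (plane_dc R) f_H A (set_val : set_type hyperbolic_set -> V3).
Proof.
have dsin : is_derive (0 : R) 1 (@sin R) 1.
  by apply: is_derive_eq; rewrite cos0.
have [rho [rhoE rho1 rhoA]] := slope_function (@analytic_sin R) (@sin0 R) dsin.
have ch := hyperbolic_charted rhoE rho1 rhoA.
have Z0 : (0 : V3) \in hyperbolic_set.
  by apply/mem_set; rewrite /hyperbolic_set /= !mxE sin0 !expr0n /= !subr0.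
pose z0 : set_type hyperbolic_set := exist _ 0 Z0.
split.
  apply: (charted_dc_submanifold z0 ch).
  by apply: second_countable_set_type; exact: second_countable_rV.
eexists; have [fA fc] := plane_analytic_map f_H_analytic.
apply: (charted_extension z0 _ _ _ _ ch) => //.
- exact: plane_dc_manifold.
- exact: plane_connected.
- exact: hyperbolic_connected.
- exact: f_H_in.
- move=> x; have [k hk] := near_zpi x.2.
  have imgE : hyperbolic_chart rho k @` band = [set p : V3 | `|p 0 e1 - k%:~R * pi| < pi].
    exact: hyperbolic_chart_img.
  exists (band, hyperbolic_chart rho k), (hyperbolic_lift k); split=> /=.
  + by exists k.
  + by have : (hyperbolic_chart rho k @` band) (f_H x) by rewrite imgE /f_H /= vec3E.
  + move=> P AP; rewrite imgE; apply: plane_lift => //.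
      by apply: open_comp; [move=> p _; exact: fc|exact: open_band].
    by apply: analytic_fun_at; exact: hyperbolic_lift_analytic.
  + move=> y [x' Bx' e]; have [cy l0 ->] := hyperbolic_liftP rhoE k y; split=> //.
    have : [set p : V3 | `|p 0 e1 - k%:~R * pi| < pi] (f_H y) by rewrite -imgE; exists x'.
    by rewrite /band /= l0 subr0 /f_H vec3E.
(* Over x = pi / 2 the map f_H has t = cosh u, so it misses the points with t negative. *)
- exists (vec3 (-1) (pi / 2) 0).
    by rewrite /hyperbolic_set /= !vec3E sin_pihalf; ring.
  move=> [[u v] _] /(congr1 (fun x : V3 => (x 0 e0, x 0 e1))).
  rewrite /f_H !vec3E /= => -[+ v0]; rewrite v0 sin_pihalf mulr1 => h.
  by have := cosh_gt0 u; rewrite h; lra.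
Qed.

Definition wcat_set : set V3 :=
  [set p | p 0 e0 * cosh (p 0 e1) - p 0 e2 * sinh (p 0 e1) = 0].

Definition tanh (x : R) : R := sinh x / cosh x.

Definition wcat_graph (w : V2) : V3 := vec3 (w 0 1 * tanh (w 0 0)) (w 0 0) (w 0 1).

Lemma cosh_neq0 (x : R) : cosh x != 0.
Proof. by rewrite gt_eqF // cosh_gt0. Qed.

Lemma wcat_setP p : wcat_set p <-> p = wcat_graph (vec2 (p 0 e1) (p 0 e2)).
Proof.
rewrite /wcat_set /wcat_graph /tanh !vec2E /=; have n0 := cosh_neq0 (p 0 e1).
split=> [h|->]; last by rewrite !vec3E; move: (cosh _) n0 => a a0; field.
apply: rV3P; rewrite !vec3E //; move: h; move: (cosh _) (sinh _) n0 => a b a0 h.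
by apply: (mulIf a0); rewrite mulrA divfK //; lra.
Qed.

Lemma analytic_tanh : analytic_fun tanh.
Proof.
move=> k f p fA; apply: analytic_div; first exact: cosh_neq0.
  exact: analytic_sinh.
exact: analytic_cosh.
Qed.

Lemma wcat_graph_analytic p j : analytic_at (fun w : V2 => wcat_graph w 0 j) p.
Proof.
have u := analytic_coord p 0; have v := analytic_coord p 1.
by apply: analytic_vec3 => //; apply: analytic_mul => //; exact: analytic_tanh.
Qed.

Lemma wcat_graph_cont w : wcat_graph @ w --> wcat_graph w.
Proof. by apply: analytic_cvg; exact: wcat_graph_analytic. Qed.

Lemma wcat_connected : connected wcat_set.
Proof.
have -> : wcat_set = wcat_graph @` setT.
  apply/seteqP; split=> [p /wcat_setP ->|_ [w _ <-]]; first by exists (vec2 (p 0 e1) (p 0 e2)).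
  by apply/wcat_setP; rewrite /wcat_graph !vec3E !vec2E.
apply: (@connected_star_image _ _ _ setT _ 0) => //.
by apply: continuous_within => w _; exact: wcat_graph_cont.
Qed.

Lemma wcat_complete : analytically_complete wcat_set.
Proof.
apply: zero_set_complete; last by exists 0; rewrite !mxE !mul0r subr0.
move=> p; have c i := analytic_coord p i.
apply: analytic_sub; apply: analytic_mul => //; first exact: analytic_cosh.
exact: analytic_sinh.
Qed.

Definition wcat_dom : set V3 := [set x | 0 < x 0 e2 + x 0 e0].

(* In the null coordinates of half_coords, the cone is the graph over the half
   plane x > c, which is sheared onto the graph t = y tanh x. *)
Definition wcat_chart (c : R) (x : V3) : V3 :=
  let s := x 0 e2 + x 0 e0 in
  vec3 (x 0 e1 * tanh (c + s) + ((x 0 e2 - x 0 e0) * s - x 0 e1 ^+ 2)) (c + s) (x 0 e1).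

Definition wcat_chart_inv (c : R) (p : V3) : V3 :=
  let s := p 0 e1 - c in
  let d := (p 0 e0 - p 0 e2 * tanh (p 0 e1) + p 0 e2 ^+ 2) / s in
  vec3 ((s - d) / 2) (p 0 e2) ((s + d) / 2).

Lemma wcat_chartK c x : wcat_dom x -> wcat_chart_inv c (wcat_chart c x) = x.
Proof.
rewrite /wcat_dom /= => s0; have n0 : x 0 e2 + x 0 e0 != 0 by rewrite gt_eqF.
rewrite /wcat_chart_inv /wcat_chart !vec3E.
have -> : c + (x 0 e2 + x 0 e0) - c = x 0 e2 + x 0 e0 by ring.
move: (tanh _) => T.
have -> : x 0 e1 * T + ((x 0 e2 - x 0 e0) * (x 0 e2 + x 0 e0) - x 0 e1 ^+ 2) - x 0 e1 * T +
  x 0 e1 ^+ 2 = (x 0 e2 - x 0 e0) * (x 0 e2 + x 0 e0) by ring.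
by rewrite mulfK //; apply: rV3P; rewrite !vec3E //; field.
Qed.

Lemma wcat_chart_invK c (p : V3) : c < p 0 e1 -> wcat_chart c (wcat_chart_inv c p) = p.
Proof.
move=> cp; have n0 : p 0 e1 - c != 0 by rewrite subr_eq0 gt_eqF.
rewrite /wcat_chart_inv /wcat_chart !vec3E.
set d := (_ / (p 0 e1 - c)).
have -> : (p 0 e1 - c + d) / 2 + (p 0 e1 - c - d) / 2 = p 0 e1 - c by field.
have -> : (p 0 e1 - c + d) / 2 - (p 0 e1 - c - d) / 2 = d by field.
rewrite [c + _]addrC subrK /d divfK //.
by apply: rV3P; rewrite !vec3E //; ring.
Qed.

Lemma wcat_chart_img c : wcat_chart c @` wcat_dom = [set p : V3 | c < p 0 e1].
Proof.
apply/seteqP; split=> [_ [x Bx <-]|p /= hp].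
  by rewrite /= /wcat_chart vec3E ltrDl.
exists (wcat_chart_inv c p); last exact: wcat_chart_invK.
rewrite /wcat_dom /= /wcat_chart_inv !vec3E; move: (_ / (_ - c)) => d; lra.
Qed.

Lemma wcat_chart_analytic c p j : analytic_at (fun x : V3 => wcat_chart c x 0 j) p.
Proof.
have x i := analytic_coord p i.
have s : analytic_at (fun x : V3 => x 0 e2 + x 0 e0) p by exact: analytic_add.
have cs : analytic_at (fun x : V3 => c + (x 0 e2 + x 0 e0)) p.
  by apply: analytic_add => //; exact: analytic_cst.
apply: analytic_vec3 => //; apply: analytic_add.
  by apply: analytic_mul => //; exact: analytic_tanh.
apply: analytic_sub; last exact: analytic_exp.
by apply: analytic_mul => //; exact: analytic_sub.
Qed.

Lemma wcat_chart_inv_analytic c (p : V3) j : c < p 0 e1 ->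
  analytic_at (fun x : V3 => wcat_chart_inv c x 0 j) p.
Proof.
move=> cp; have n0 : p 0 e1 - c != 0 by rewrite subr_eq0 gt_eqF.
have x i := analytic_coord p i.
have s : analytic_at (fun x : V3 => x 0 e1 - c) p.
  by apply: analytic_sub => //; exact: analytic_cst.
have d : analytic_at (fun x : V3 =>
    (x 0 e0 - x 0 e2 * tanh (x 0 e1) + x 0 e2 ^+ 2) / (x 0 e1 - c)) p.
  apply: analytic_div => //; apply: analytic_add; last exact: analytic_exp.
  by apply: analytic_sub => //; apply: analytic_mul => //; exact: analytic_tanh.
apply: analytic_vec3 => //.
- by apply: analytic_mul; [exact: analytic_sub|exact: analytic_cst].
- by apply: analytic_mul; [exact: analytic_add|exact: analytic_cst].
Qed.

Lemma wcat_chartP c x : wcat_dom x -> @cone R 2 x <-> wcat_set (wcat_chart c x).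
Proof.
move=> s0; rewrite coneE wcat_setP /wcat_chart /wcat_graph !vec3E !vec2E.
split=> [h|/(congr1 (fun p : V3 => p 0 e0))].
  congr vec3; rewrite -[RHS]addr0; congr (_ + _).
  by transitivity (x 0 e2 ^+ 2 - (x 0 e0 ^+ 2 + x 0 e1 ^+ 2)); [ring|rewrite h subrr].
rewrite !vec3E => /eqP; rewrite -subr_eq0 addrC addKr => /eqP h.
apply/eqP; rewrite eq_sym -subr_eq0 -{}h; apply/eqP; ring.
Qed.

Lemma wcat_dom_open : open wcat_dom.
Proof.
apply: (@open_comp _ _ (fun x : V3 => x 0 e2 + x 0 e0) [set r | 0 < r]); last exact: open_gt.
by move=> x _; apply: analytic_continuous; apply: analytic_add; exact: analytic_coord.
Qed.

(** The half cone does not contain the vertex, hence the empty singular set. Its image is the part x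
    > c of the graph. *)
Lemma wcat_ambient c : ambient_chart wcat_set set0 wcat_dom (wcat_chart c).
Proof.
split.
- exact: wcat_dom_open.
- by rewrite wcat_chart_img; exact: half_space_gt_open.
- apply: (@analytic_diffeo_of _ _ _ _ _ _ (wcat_chart_inv c)).
  + exact: analytic_fun_at (wcat_chart_analytic c) _.
  + rewrite wcat_chart_img; apply: analytic_on_at => p cp j; exact: wcat_chart_inv_analytic.
  + by move=> x Bx; exists x.
  + by move=> _ [x Bx <-]; rewrite wcat_chartK.
  + by move=> x; exact: wcat_chartK.
  + by rewrite wcat_chart_img => p; exact: wcat_chart_invK.
- rewrite (_ : _ @` _ = wcat_graph @` [set w : V2 | c < w 0 0]).
    apply: (connected_star_image (x0 := vec2 (c + 1) 0)).
    + by apply: continuous_within => w _; exact: wcat_graph_cont.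
    + by rewrite /= vec2E; lra.
    + move=> y t cy t01; have c1 : c < c + 1 by lra.
      have := segment_gt c1 cy t01.
      by rewrite /= !mxE.
  apply/seteqP; split=> [_ [x [cx sx] <-]|_ [w cw <-]].
    exists (vec2 (wcat_chart c x 0 e1) (wcat_chart c x 0 e2)).
      by rewrite /= vec2E /wcat_chart vec3E ltrDl.
    by apply/esym/wcat_setP/wcat_chartP.
  have h : (wcat_chart c @` wcat_dom) (wcat_graph w) by rewrite wcat_chart_img /= /wcat_graph vec3E.
  case: h => x sx xw; exists x => //; split=> //; apply/(wcat_chartP c sx); rewrite xw.
  by apply/wcat_setP; rewrite /wcat_graph !vec3E !vec2E.
- split=> x sx; first exact: wcat_chartP.
  by move=> _; split=> // x0; move: sx; rewrite x0 /wcat_dom /= !mxE addr0 ltxx.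
Qed.

Lemma wcat_charted : charted wcat_set set0 [set (wcat_dom, wcat_chart c) | c in [set: R]].
Proof.
split=> //; first by move=> _ [c _ <-]; exact: wcat_ambient.
move=> z _; pose c := z 0 e1 - 1.
have : (wcat_chart c @` wcat_dom) z by rewrite wcat_chart_img /= /c; lra.
by exists (wcat_dom, wcat_chart c); first by exists c.
Qed.

(** The (x, y) coordinates of f_K, which folds the tube onto the part |y| <= cosh x of the graph t =
    y tanh x. *)
Definition wcat_coords (p : R * T1 R) : V2 := vec2 p.1 (cosh p.1 * cos (of_T1 p.2)).

Lemma f_KE p : f_K p = wcat_graph (wcat_coords p).
Proof.
rewrite /f_K /wcat_graph /wcat_coords !vec2E /tanh; congr vec3.
by have := cosh_neq0 p.1; move: (cosh _) => a a0; field.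
Qed.

Lemma wcat_coords_analytic p j : analytic_at (fun w : V2 => wcat_coords (tube_map w) 0 j) p.
Proof.
have u := analytic_coord p 0; have v := analytic_coord p 1.
have h := analytic_vec2 u (analytic_mul (analytic_cosh u) (analytic_cos v)) j.
by apply: analytic_near h; near=> w; rewrite /wcat_coords /tube_map /= cos_of_T1.
Unshelve. all: by end_near. Qed.

Lemma f_K_analytic p j : analytic_at (fun w : V2 => f_K (tube_map w) 0 j) p.
Proof.
have h := analytic_comp (wcat_coords_analytic p) (wcat_graph_analytic (wcat_coords (tube_map p)) j).
by apply: analytic_near h; near=> w; rewrite f_KE.
Unshelve. all: by end_near. Qed.

Lemma f_K_in p : wcat_set (@f_K R p).
Proof. by rewrite f_KE; apply/wcat_setP; rewrite /wcat_graph !vec3E !vec2E. Qed.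

Lemma wcat_liftP c (w : V2) : c < w 0 0 ->
  [/\ cylinder 2 (half_lift c w), wcat_dom (@cone_proj R 2 (half_lift c w)) &
      wcat_chart c (@cone_proj R 2 (half_lift c w)) = wcat_graph w].
Proof.
move=> cw; have [cy ->] := half_liftP cw; split=> //.
  have := congr1 (fun x : V2 => x 0 0) (half_pointK cw).
  by rewrite /= /half_coords vec2E /wcat_dom /= => h; move: cw; rewrite -h ltrDl.
have /coneE cx := half_point_cone cw.
have := half_pointK cw; move: (half_point c w) cx => x cx xw.
rewrite -xw /wcat_chart /wcat_graph /half_coords !vec2E; congr vec3.
rewrite (_ : _ - x 0 e1 ^+ 2 = 0) ?addr0 //.
by transitivity (x 0 e2 ^+ 2 - (x 0 e0 ^+ 2 + x 0 e1 ^+ 2)); [ring|rewrite cx subrr].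
Qed.

Lemma wcat_completion : @dc_submanifold R 2 0 wcat_set /\
  exists A, analytic_extension (tube_dc R) f_K A (set_val : set_type wcat_set -> V3).
Proof.
have Z0 : (0 : V3) \in wcat_set by apply/mem_set; rewrite /wcat_set /= !mxE !mul0r subr0.
pose z0 : set_type wcat_set := exist _ 0 Z0.
split.
  apply: (charted_dc_submanifold z0 wcat_charted).
  by apply: second_countable_set_type; exact: second_countable_rV.
eexists; have [fA fc] := tube_analytic_map f_K_analytic.
apply: (charted_extension z0 _ _ _ _ wcat_charted) => //.
- exact: tube_dc_manifold.
- exact: tube_connected.
- exact: wcat_connected.
- exact: f_K_in.
- move=> x; pose c := x.1 - 1.
  have imgE p : (wcat_chart c @` wcat_dom) (f_K p) <-> c < p.1.
    by rewrite wcat_chart_img /= /f_K vec3E.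
  exists (wcat_dom, wcat_chart c), (fun p => half_lift c (wcat_coords p)); split=> /=.
  + by exists c.
  + by apply/imgE; rewrite /c; lra.
  + move=> P AP; apply: (@tube_lift _ _ _ _ (fun p => half_lift c (wcat_coords p))) => //.
      rewrite wcat_chart_img; apply: open_comp; last exact: half_space_gt_open.
      by move=> p _; exact: fc.
    apply: analytic_on_at => w /imgE cw j.
    apply: (@analytic_comp _ _ _ (fun w : V2 => half_lift c w 0 j)).
      exact: wcat_coords_analytic.
    by apply: half_lift_analytic; rewrite /wcat_coords vec2E.
  + move=> y /imgE cy; rewrite f_KE; apply: wcat_liftP.
    by rewrite /wcat_coords vec2E.
(* At x = 0 the image of f_K has |y| <= 1. *)
- exists (vec3 0 0 2); first by rewrite /wcat_set /= !vec3E sinh0 mulr0 mul0r subr0.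
  move=> [[u t] _] /(congr1 (fun x : V3 => (x 0 e1, x 0 e2))).
  rewrite /f_K !vec3E /= => -[-> ]; rewrite cosh0 mul1r => h.
  by have := cos_le1 (of_T1 t); rewrite h; lra.
Qed.

End HyperbolicW.

Theorem theorem2p25 (R : realType) :
  exists (XP XH XK : topologicalType)
         (AP : set (@local_param R (2 + 1) XP))
         (AH : set (@local_param R (2 + 1) XH))
         (AK : set (@local_param R (2 + 1) XK))
         (gP : XP -> 'rV[R]_3) (gH : XH -> 'rV[R]_3) (gK : XK -> 'rV[R]_3),
  [/\ analytically_complete (range (@f_E R)),
      [/\ analytic_extension (plane_dc R) f_P AP gP /\
            analytically_complete (range gP),
          analytic_extension (plane_dc R) f_H AH gH /\
            analytically_complete (range gH) &
          analytic_extension (tube_dc R) f_K AK gK /\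
            analytically_complete (range gK)] &
      [/\ @dc_submanifold R 2 0 (range (@f_E R)),
          @dc_submanifold R 2 0 (range gP),
          @dc_submanifold R 2 0 (range gH) &
          @dc_submanifold R 2 0 (range gK)]].
Proof.
have Z1 (Z : set 'rV[R]_3) : @second_countable (set_type Z).
  by apply: second_countable_set_type; exact: second_countable_rV.
have [AP extP] := @parabolic_extension R.
have [subH [AH extH]] := @hyperbolic_completion R.
have [subK [AK extK]] := @wcat_completion R.
have [G chE] := @elliptic_charted R.
have ZE : (0 : 'rV[R]_3) \in elliptic_set by apply/mem_set; have [_ _ + _] := chE; apply.
have ZP : (0 : 'rV[R]_3) \in parabolic_set.
  by apply/mem_set; have [_ _ + _] := @parabolic_charted R; apply.
exists (set_type parabolic_set), (set_type hyperbolic_set), (set_type wcat_set), AP, AH, AK,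
  set_val, set_val, set_val.
rewrite range_f_E !range_set_val; split; first exact: elliptic_complete.
- by split; split=> //; [exact: parabolic_complete|exact: hyperbolic_complete|exact: wcat_complete].
- split=> //; first exact: (charted_dc_submanifold (exist _ 0 ZE) chE).
  exact: (charted_dc_submanifold (exist _ 0 ZP) (@parabolic_charted R)).
Qed.
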